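(* Consider the additive Cauchy channel with finite input alphabet $\mathcal{Y}=\{1,\dots,l\}$, output alphabet $\mathbb{R}$ and densities $$q(z|i)=\frac{1}{\pi}\,\frac{\gamma_i}{(z-\mu_i)^2+\gamma_i^2},\qquad i=1,\dots,l,$$ parameterized by $(\gamma_i,\mu_i)$ with $\gamma_i>0$, $\mu_i\in\mathbb{R}$. If all entries of $\Pi^{\vec{\varepsilon}_0}$ are strictly positive at $\vec{\varepsilon}_0\in\Omega_1$, then the entropy rate $H(Z)$, as a function of $\vec{\varepsilon}$ and of the channel parameters, is analytic around $(\vec{\varepsilon}_0,(\gamma_1,\mu_1,\gamma_2,\mu_2,\dots,\gamma_l,\mu_l))$.
   Context: Let $\Omega_1\subset\mathbb{R}^{m_1}$ be a bounded domain (open connected set). For $\vec{\varepsilon}\in\Omega_1$, $\Pi^{\vec{\varepsilon}}$ is an $l\times l$ stochastic matrix depending real-analytically on $\vec{\varepsilon}$, and $Y=(Y_n)$ is the $\mathcal{Y}$-valued stationary first-order Markov chain with transition matrix $\Pi^{\vec{\varepsilon}}$. The hidden Markov chain $Z$ is the output of the memoryless channel with input $Y$: conditionally on $Y$, the $Z_n$ are independent and $Z_n$ has density $q(\cdot|Y_n)$. Let $p$ denote the resulting joint densities, with $z_{-n}^0=(z_{-n},\dots,z_0)$. The entropy rate is $$H(Z)=\lim_{n\to\infty}\frac{1}{n+1}H(Z_{-n}^0),\qquad H(Z_{-n}^0)=-\int_{\mathbb{R}^{n+1}}p(z_{-n}^0)\log p(z_{-n}^0)\,dz_{-n}^0.$$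 ''Analytic around'' a point means real analytic, jointly in all the parameters, on a neighborhood of that point. *)

(* Defs.v *)
From HB Require Import structures.
From mathcomp Require Import all_boot all_order all_algebra.
From mathcomp Require Import all_classical all_reals all_analysis.
From mathcomp Require summability.
Set Implicit Arguments.
Unset Strict Implicit.
Unset Printing Implicit Defensive.
Import Order.TTheory GRing.Theory Num.Theory.
Import numFieldNormedType.Exports.
Local Open Scope classical_set_scope.
Local Open Scope ring_scope.

Section lebesgue_tuple.
Context {R : realType}.
Local Notation RR := (measurableTypeR R).

Definition cons_pair n (xt : RR * n.-tuple RR) : n.+1.-tuple RR :=
  [tuple of xt.1 :: xt.2].

Lemma measurable_cons_pair n :
  measurable_fun [set: RR * n.-tuple RR] (@cons_pair n).
Proof. exact: measurable_cons. Qed.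

(* Lebesgue measure on R^n: the point mass for n = 0, and otherwise the image
   of the product measure on R * R^(n-1) under (x, t) |-> x :: t. *)
Fixpoint lebesgue_tuple (n : nat) : set (n.-tuple RR) -> \bar R :=
  match n return set (n.-tuple RR) -> \bar R with
  | 0 => \d_[tuple]
  | n'.+1 => pushforward (lebesgue_measure \x @lebesgue_tuple n')%E
               (@cons_pair n')
  end.

Section step.
Variables (n : nat) (m : {sigma_finite_measure set (n.-tuple RR) -> \bar R}).

Let step := pushforward (lebesgue_measure \x m)%E (@cons_pair n).

Let mpre A : measurable A -> measurable (@cons_pair n @^-1` A).
Proof.
by move=> mA; rewrite -[X in measurable X]setTI; exact: measurable_cons_pair.
Qed.

Let step0 : step set0 = 0%E.
Proof. by rewrite /step /pushforward preimage_set0 measure0. Qed.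

Let step_ge0 A : (0 <= step A)%E.
Proof. by rewrite /step /pushforward. Qed.

Let step_sigma_additive : semi_sigma_additive step.
Proof.
move=> F mF tF mUF; rewrite /step /pushforward preimage_bigcup.
apply: measure_semi_sigma_additive.
- by move=> i; exact: mpre.
- apply/trivIsetP => /= i j _ _ ij; rewrite -preimage_setI.
  by move/trivIsetP : tF => /(_ _ _ _ _ ij) ->//; rewrite preimage_set0.
- by rewrite -preimage_bigcup; exact: mpre.
Qed.

HB.instance Definition _ := isMeasure.Build _ _ _ step
  step0 step_ge0 step_sigma_additive.

Let step_sigma_finite : sigma_finite setT step.
Proof.
pose g (t : n.+1.-tuple RR) : RR * n.-tuple RR := (thead t, [tuple of behead t]).
have cg (xt : RR * n.-tuple RR) : g (cons_pair xt) = xt.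
  by case: xt => x t; congr pair => //=; apply/val_inj.
have mg : measurable_fun [set: n.+1.-tuple RR] g.
  apply/measurable_fun_pairP; split; first exact: measurable_tnth.
  exact: measurable_behead.
(* The canonical sigma-finite structure of [_ \x _] is only found for finite
   factors. *)
have [F UF mF] : sigma_finite setT (lebesgue_measure \x m)%E.
  have /sigma_finiteP[F [TF ndF Foo]] := sigma_finiteT (@lebesgue_measure R).
  have /sigma_finiteP[G [TG ndG Goo]] := sigma_finiteT m.
  exists (fun k => F k `*` G k).
    rewrite -setXTT TF TG predeqE => -[x y]; split.
      move=> [/= [i _ Fix] [k _ Gky]]; exists (maxn i k) => //; split.
      - by move: x Fix; exact/subsetPset/ndF/leq_maxl.
      - by move: y Gky; exact/subsetPset/ndG/leq_maxr.
    by move=> [i _ []/= ? ?]; split; exists i.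
  move=> k; have [? ?] := Foo k; have [? ?] := Goo k.
  split; first exact: measurableX.
  by rewrite product_measure1E// lte_mul_pinfty// ge0_fin_numE.
exists (fun k => g @^-1` F k); first by rewrite -preimage_bigcup -UF.
move=> k; have [mFk Fk] := mF k; split.
  by rewrite -[X in measurable X]setTI; exact: mg.
rewrite /step /pushforward (_ : _ @^-1` _ = F k)//.
by apply/seteqP; split=> xt /=; rewrite cg.
Qed.

HB.instance Definition _ := Measure_isSigmaFinite.Build _ _ _ step
  step_sigma_finite.

Definition lebesgue_tuple_step :
  {sigma_finite_measure set (n.+1.-tuple RR) -> \bar R} := step.
End step.

Lemma lebesgue_tuple_sigma_finite_measure n :
  {m : {sigma_finite_measure set (n.-tuple RR) -> \bar R}
     | m = @lebesgue_tuple n :> (set _ -> \bar R)}.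
Proof.
elim: n => [|n [m mE]]; first by exists \d_[tuple].
by exists (lebesgue_tuple_step m); rewrite /= -mE.
Qed.

Let lebesgue_tuple0 n : @lebesgue_tuple n set0 = 0%E.
Proof. by have [m <-] := lebesgue_tuple_sigma_finite_measure n. Qed.
Let lebesgue_tuple_ge0 n A : (0 <= @lebesgue_tuple n A)%E.
Proof. by have [m <-] := lebesgue_tuple_sigma_finite_measure n. Qed.
Let lebesgue_tuple_sigma_additive n : semi_sigma_additive (@lebesgue_tuple n).
Proof.
have [m <-] := lebesgue_tuple_sigma_finite_measure n.
exact: measure_semi_sigma_additive.
Qed.
HB.instance Definition _ n := isMeasure.Build _ _ _ (@lebesgue_tuple n)
  (lebesgue_tuple0 n) (@lebesgue_tuple_ge0 n) (@lebesgue_tuple_sigma_additive n).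

Let lebesgue_tuple_sigma_finite n : sigma_finite setT (@lebesgue_tuple n).
Proof.
have [m <-] := lebesgue_tuple_sigma_finite_measure n.
exact: sigma_finiteT.
Qed.
HB.instance Definition _ n := Measure_isSigmaFinite.Build _ _ _
  (@lebesgue_tuple n) (@lebesgue_tuple_sigma_finite n).

Lemma lebesgue_tuple_box n (A : 'I_n -> set RR) :
  (forall i, measurable (A i)) ->
  lebesgue_tuple [set t | forall i, A i (tnth t i)] =
  (\prod_(i < n) lebesgue_measure (A i))%E.
Proof.
elim: n A => [|n IH] A mA /=.
  by rewrite big_ord0 diracE mem_set// => i; have := ltn_ord i.
rewrite /pushforward.
pose B : set (n.-tuple RR) := [set t | forall i, A (lift ord0 i) (tnth t i)].
rewrite (_ : _ @^-1` _ = A ord0 `*` B).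
  rewrite product_measure1E//; last first.
    rewrite (_ : B = \bigcap_(i in [set: 'I_n])
        ((fun t : n.-tuple RR => tnth t i) @^-1` A (lift ord0 i))).
      apply: fin_bigcap_measurable => // i _.
      by rewrite -[X in measurable X]setTI; exact: measurable_tnth.
    by apply/seteqP; split=> t Bt i //=; exact: Bt.
  rewrite big_ord_recl; congr (_ * _)%E.
  by apply: (IH (fun i => A (lift ord0 i))) => i; exact: mA.
apply/seteqP; split=> -[x t] /=.
  move=> H; split; first exact: (H ord0).
  by move=> i; have := H (lift ord0 i); rewrite /cons_pair/= tnthS.
move=> [Ax Bt] i; case: (unliftP ord0 i) => [j|] ->//.
by rewrite /cons_pair/= tnthS; exact: Bt.
Qed.

End lebesgue_tuple.

Arguments lebesgue_tuple : clear implicits.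
Arguments lebesgue_tuple {R} n A : rename.

Definition monomial (R : realType) (N : nat) (a : {ffun 'I_N -> nat})
    (h : 'rV[R]_N) : R :=
  \prod_(i < N) h 0 i ^+ a i.

(* The power series is summed along the finite sets of multi-indices, ordered
   by inclusion: this is unconditional, hence absolute, convergence. *)
Definition real_analytic_at (R : realType) (N : nat) (f : 'rV[R]_N -> R)
    (x : 'rV[R]_N) : Prop :=
  exists c : {ffun 'I_N -> nat} -> R, \forall y \near x,
    summability.partial_sum (fun a => c a * monomial a (y - x))
    @ summability.totally --> f y.

Definition real_analytic_around (R : realType) (N : nat) (f : 'rV[R]_N -> R)
    (x : 'rV[R]_N) : Prop :=
  \forall y \near x, real_analytic_at f y.

Definition stochastic_mx (R : realType) (l : nat) (Pi : 'M[R]_l) : Prop :=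
  (forall i j, 0 <= Pi i j) /\ (forall i, \sum_(j < l) Pi i j = 1).

Section processes.
Context {R : realType} {d : measure_display} {T : measurableType d} {l : nat}.
Implicit Types (P : probability T R) (Y : int -> T -> 'I_l) (Z : int -> T -> R).

(* The event (Y_k, ..., Y_(k+n-1)) = y. *)
Definition path_event Y (k : int) (n : nat) (y : n.-tuple 'I_l) : set T :=
  [set w | forall i : 'I_n, Y (k + i%:Z) w = tnth y i].

(* The Markov property is written without division, so that it also covers
   paths of probability zero. *)
Record stationary_markov_chain P (Pi : 'M[R]_l) Y : Prop := {
  chain_measurable : forall k i, measurable (Y k @^-1` [set i]) ;
  chain_stationary : forall (k : int) (n : nat) (y : n.-tuple 'I_l),
    P (path_event Y k y) = P (path_event Y 0 y) ;
  chain_markov : forall (k : int) (n : nat) (y : n.+1.-tuple 'I_l) (j : 'I_l),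
    P (path_event Y k [tuple of rcons y j]) =
    (P (path_event Y k y) * (Pi (tnth y ord_max) j)%:E)%E
}.

(* Conditionally on the input Y, the outputs Z_k are independent and Z_k has
   density q (Y_k). *)
Record memoryless_output P (q : 'I_l -> R -> R) Y Z : Prop := {
  output_measurable : forall k, measurable_fun [set: T] (Z k) ;
  output_law : forall (k : int) (n : nat) (y : n.-tuple 'I_l)
      (A : 'I_n -> set (measurableTypeR R)), (forall i, measurable (A i)) ->
    P (path_event Y k y `&` [set w | forall i : 'I_n, A i (Z (k + i%:Z) w)]) =
    (P (path_event Y k y) *
     \prod_(i < n) \int[lebesgue_measure]_(z in A i) (q (tnth y i) z)%:E)%E
}.

Definition hidden_markov_chain P (Pi : 'M[R]_l) (q : 'I_l -> R -> R) Y Z :=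
  stationary_markov_chain P Pi Y /\ memoryless_output P q Y Z.

Definition past_block Z (n : nat) (w : T) : n.+1.-tuple (measurableTypeR R) :=
  [tuple Z (i%:Z - n%:Z) w | i < n.+1].

Definition is_density P (n : nat) (X : T -> n.-tuple (measurableTypeR R))
    (p : n.-tuple (measurableTypeR R) -> R) : Prop :=
  [/\ measurable_fun setT p, (forall z, 0 <= p z) &
      forall A, measurable A ->
        P (X @^-1` A) = (\int[lebesgue_tuple n]_(z in A) (p z)%:E)%E].

End processes.

Section entropy.
Context {R : realType}.

(* [ln 0 = 0] in the library, whence the convention 0 log 0 = 0. *)
Definition differential_entropy (n : nat)
    (p : n.-tuple (measurableTypeR R) -> R) : \bar R :=
  (- \int[lebesgue_tuple n]_z (p z * ln (p z))%:E)%E.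

Variable p : forall n, n.+1.-tuple (measurableTypeR R) -> R.

Definition normalized_entropy (n : nat) : \bar R :=
  ((n.+1%:R^-1)%:E * differential_entropy (@p n))%E.

Definition entropy_rate : \bar R := limn normalized_entropy.

End entropy.

Section cauchy_channel.
Context {R : realType} {m1 l : nat}.

Definition cauchy_density (gamma mu z : R) : R :=
  pi^-1 * (gamma / ((z - mu) ^+ 2 + gamma ^+ 2)).

(* A point of the parameter space is the row vector
   (eps, (gamma_1, mu_1, ..., gamma_l, mu_l)). *)
Implicit Type th : 'rV[R]_(m1 + l * 2).

Definition input_param th : 'rV[R]_m1 := lsubmx th.
Definition cauchy_scale th (i : 'I_l) : R := vec_mx (rsubmx th) i 0.
Definition cauchy_location th (i : 'I_l) : R := vec_mx (rsubmx th) i 1.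

Definition cauchy_channel th (i : 'I_l) : R -> R :=
  cauchy_density (cauchy_scale th i) (cauchy_location th i).

End cauchy_channel.

(* Main.v *)
Require Import Defs.
From HB Require Import structures.
From mathcomp Require Import all_boot all_order all_algebra finmap.
From mathcomp Require Import all_classical all_reals all_analysis.
From mathcomp Require Import ring lra.
From mathcomp Require Import measurable_realfun.
From mathcomp Require summability.
Set Implicit Arguments.
Unset Strict Implicit.
Unset Printing Implicit Defensive.
Import Order.TTheory GRing.Theory Num.Theory.
Import numFieldNormedType.Exports.
Local Open Scope classical_set_scope.
Local Open Scope ring_scope.

(* Near an admissible parameter, every quantity is expanded as a power series
   in the increment h of the parameter, with coefficients depending on the
   outputs z and with a majorant M(z) of the sum of the absolute values of its
   terms on |h| <= r. Such expansions survive sums, products, inverses and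
   logarithms of small perturbations of 1, and integration in z as soon as M is
   integrable.

   Let B(i..j) be the density of the outputs i, ..., j. The second difference
   of the block entropies is, up to sign, the expectation of
   D_m = ln (B(0..m+1) B(1..m) / (B(0..m) B(1..m+1))), and the entropy rate is
   the limit of the first differences. The ratio minus 1 is a quotient whose
   numerator is a combination of 2x2 minors of products of transition matrices;
   since the entries of the matrix are bounded below, Cauchy-Binet makes these
   minors smaller than the corresponding permanents by a factor exponential in
   m. This gain beats the loss (1 + delta)^m of the expansion: the forward
   variables, divided by a common scalar, stay within a fixed relative error of
   their values at h = 0 because each step contracts that error. Hence B D_m has
   the majorant C rho^m B at h = 0 with rho < 1, and the series of entropies
   converges together with its expansion.

   The heavy tails of the Cauchy law are harmless: the ratio of the densities at
   two parameters is expanded uniformly in z, and f ln f is integrable when f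
   decays quadratically. *)

(** * Power series majorized uniformly on a polydisc *)

(** A majorant does the work of a bound on a complex polydisc: it controls the terms of an expansion
    in absolute value, which is what renumbering, termwise integration and summation over m require,
    and no complex parameter is introduced. The obstacle is length. A product of m factors, each
    within a relative error dl of its value at h = 0, may be off by (1 + dl)^m, so that on a fixed
    polydisc neither the inverse nor the logarithm of a long block density can be expanded directly
    around its value at h = 0. Writing B(h) = B(0) scal (1 + g), with g bounded independently of m,
    confines the accumulation to [scal], a product of m factors each of which can be inverted, or
    has a logarithm, by itself. The chains at different parameters live on unrelated probability
    spaces, so only the stationarity equation ties their initial laws together; the expansion of the
    initial law has to be extracted from it. *)

Section double_series.
Context {R : realType}.
Implicit Types (w : nat -> R) (u : nat -> nat -> R) (M : R).

Lemma nonneg_series_cvg w M : (forall k, 0 <= w k) ->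
  (forall n, \sum_(0 <= k < n) w k <= M) ->
  [/\ series w @ \oo --> fine (\sum_(k <oo) (w k)%:E),
      (\sum_(k <oo) (w k)%:E)%E = (fine (\sum_(k <oo) (w k)%:E))%:E &
      fine (\sum_(k <oo) (w k)%:E) <= M].
Proof.
move=> w0 wM.
have cw : cvgn (series w).
  apply: nondecreasing_is_cvgn.
    by apply: nondecreasing_series => n _ _; exact: w0.
  by exists M => _ [n _ <-]; exact: wM.
have E : (\sum_(k <oo) (w k)%:E)%E = (limn (series w))%:E.
  rewrite -EFin_lim //; congr (limn _); apply/funext => n /=.
  by rewrite /series /= sumEFin.
rewrite E /=; split => //.
by apply: limr_le => //; near=> n; exact: wM.
Unshelve. all: by end_near. Qed.

(** Pairs are enumerated by the countable-type code of [nat * nat]; a number that codes no pair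
    receives the default [v0], always chosen so that it contributes 0 to the sums. No explicit
    bijection is needed. *)
Definition flatten_series (V : Type) (v0 : V) (v : nat -> nat -> V) (k : nat) : V :=
  if (pickle_inv k : option (nat * nat)) is Some p then v p.1 p.2 else v0.

Lemma nneseries_flatten (v : nat -> nat -> \bar R) :
  (forall i j, 0 <= v i j)%E ->
  (\sum_(k <oo) flatten_series 0 v k = \sum_(i <oo) \sum_(j <oo) v i j)%E.
Proof.
move=> v0.
have f0 k : (0 <= flatten_series 0 v k)%E.
  by rewrite /flatten_series; case: pickle_inv.
rewrite nneseries_esumT// nneseries_esumT; last by move=> i; exact: nneseries_ge0.
have -> : \esum_(i in [set: nat]) (\sum_(j <oo) v i j)%E =
    \esum_(i in [set: nat]) \esum_(j in [set: nat]) v i j.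
  by apply: eq_esum => i _; rewrite nneseries_esumT.
rewrite esum_esum//.
rewrite (_ : setT `*`` _ = [set: nat * nat]); last first.
  by apply/seteqP; split => -[].
have -> : \esum_(k in [set: nat]) flatten_series 0%E v k =
    \esum_(k in range (choice.pickle : nat * nat -> nat)) flatten_series 0%E v k.
  rewrite [RHS]esum_mkcond; apply: eq_esum => k _; case: ifPn => //.
  rewrite notin_setE /flatten_series => kr.
  case E : pickle_inv => [p|//]; exfalso; apply: kr; exists p => //.
  have := @pickle_invK _ k : oapp (choice.pickle : nat * nat -> nat) k (pickle_inv k) = k.
  by rewrite E.
rewrite esum_image//.
by apply: eq_esum => p _; rewrite /flatten_series pickleK_inv.
Qed.

(** Tonelli's theorem for the positive and the negative parts of [u]. The bounds [m] and [M] on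
    absolute values keep every sum in [key] finite, so that the two results can be subtracted. *)
Lemma double_series_cvg u (s m : nat -> R) (S : R) M :
  (forall i n, \sum_(0 <= j < n) `|u i j| <= m i) ->
  (forall n, \sum_(0 <= i < n) m i <= M) ->
  (forall i, series (u i) @ \oo --> s i) ->
  series s @ \oo --> S ->
  (forall n, \sum_(0 <= k < n) `|flatten_series 0 u k| <= M) /\
  series (flatten_series 0 u) @ \oo --> S.
Proof.
move=> um mM us sS.
have m0 i : 0 <= m i by rewrite (le_trans _ (um i 0%N))// big_geq.
have key (v : nat -> nat -> R) : (forall i j, 0 <= v i j <= `|u i j|) ->
    exists (t : nat -> R) (T : R), [/\ (forall i, series (v i) @ \oo --> t i),
      series t @ \oo --> T, series (flatten_series 0 v) @ \oo --> T &
      forall n, \sum_(0 <= k < n) flatten_series 0 v k <= M].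
  move=> vu.
  have v0 i j : 0 <= v i j by case/andP: (vu i j).
  have vm i n : \sum_(0 <= j < n) v i j <= m i.
    by rewrite (le_trans _ (um i n))// ler_sum// => j _; case/andP: (vu i j).
  have [t1 t2 t3] : [/\ forall i, series (v i) @ \oo --> fine (\sum_(k <oo) (v i k)%:E),
      forall i, (\sum_(k <oo) (v i k)%:E)%E = (fine (\sum_(k <oo) (v i k)%:E))%:E &
      forall i, fine (\sum_(k <oo) (v i k)%:E) <= m i].
    by split => i; case: (nonneg_series_cvg (v0 i) (vm i)).
  set t := fun i => fine (\sum_(k <oo) (v i k)%:E).
  have t0 i : 0 <= t i by apply/fine_ge0/nneseries_ge0 => // *; rewrite lee_fin.
  have tM n : \sum_(0 <= i < n) t i <= M.
    by rewrite (le_trans _ (mM n))// ler_sum// => i _; exact: t3.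
  have [T1 T2 T3] := nonneg_series_cvg t0 tM.
  have fv0 k : 0 <= flatten_series 0 v k.
    by rewrite /flatten_series; case: pickle_inv.
  have fE : (\sum_(k <oo) (flatten_series 0 v k)%:E = \sum_(k <oo) (t k)%:E)%E.
    transitivity (\sum_(k <oo) flatten_series 0 (fun i j => (v i j)%:E) k)%E.
      by apply: eq_eseriesr => k _; rewrite /flatten_series; case: pickle_inv.
    rewrite nneseries_flatten; last by move=> i j; rewrite lee_fin.
    by apply: eq_eseriesr => k _; rewrite -t2.
  have fM n : \sum_(0 <= k < n) flatten_series 0 v k <= M.
    rewrite (le_trans _ T3)// -lee_fin -T2 -fE -sumEFin.
    by apply: nneseries_lim_ge => k _ _; rewrite lee_fin.
  have [F1 _ _] := nonneg_series_cvg fv0 fM.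
  exists t, (fine (\sum_(k <oo) (t k)%:E)); split => //.
  by rewrite -fE.
have hp i j : 0 <= Num.max (u i j) 0 <= `|u i j|.
  by rewrite le_max lexx orbT/= ge_max ler_norm normr_ge0.
have hn i j : 0 <= Num.max (- u i j) 0 <= `|u i j|.
  by rewrite le_max lexx orbT/= ge_max -normrN ler_norm normr_ge0.
have ha i j : 0 <= `|u i j| <= `|u i j| by rewrite normr_ge0 lexx.
have [p [P [p1 p2 p3 _]]] := key _ hp.
have [q [Q [q1 q2 q3 _]]] := key _ hn.
have [_ [_ [_ _ _ aM]]] := key _ ha.
have uE x : x = Num.max x 0 - Num.max (- x) 0 :> R.
  by case: (leP 0 x) => x0; rewrite /Num.max; do 2 case: ltP => //; lra.
split.
  move=> n; rewrite (le_trans _ (aM n))// ler_sum// => k _.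
  by rewrite /flatten_series; case: pickle_inv => //; rewrite normr0.
have sE i : s i = p i - q i.
  apply: (cvg_unique _ (us i)) => //.
  have -> : series (u i) = series (fun j => Num.max (u i j) 0) -
      series (fun j => Num.max (- u i j) 0).
    apply/funext => n; rewrite /series /= [RHS]/(_ - _) -[RHS]sumrB.
    by apply: eq_bigr => j _; exact: uE.
  exact: cvgB.
have -> : S = P - Q.
  apply: (cvg_unique _ sS) => //.
  have -> : series s = series p - series q.
    apply/funext => n; rewrite /series /= [RHS]/(_ - _) -[RHS]sumrB.
    by apply: eq_bigr.
  exact: cvgB.
have -> : series (flatten_series 0 u) =
   series (flatten_series 0 (fun i j => Num.max (u i j) 0)) -
   series (flatten_series 0 (fun i j => Num.max (- u i j) 0)).
  apply/funext => n; rewrite /series /= [RHS]/(_ - _) -[RHS]sumrB.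
  apply: eq_bigr => k _; rewrite /flatten_series.
  by case: pickle_inv => [x|]; [exact: uE|rewrite subr0].
exact: cvgB.
Qed.

End double_series.

Lemma cvgn_norm_le {R : realType} (u : nat -> R) (l e : R) : u @ \oo --> l ->
  (\forall n \near \oo, `|u n| <= e) -> `|l| <= e.
Proof.
move=> ul ue.
have cn : `|u n| @[n --> \oo] --> `|l| by exact: cvg_norm.
rewrite -(cvg_lim _ cn)//; apply: limr_le => //.
by apply/cvg_ex; exists `|l|.
Qed.

Section majorized.
Context {R : realType} {N : nat} {d : measure_display} {Z : measurableType d}.
Implicit Types (r : R) (f g : Z -> 'rV[R]_N -> R) (M : Z -> R).

Definition mdeg (a : {ffun 'I_N -> nat}) : nat := \sum_(i < N) a i.

Lemma coord_le_norm (h : 'rV[R]_N) i : `|h 0 i| <= `|h|.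
Proof.
rewrite [leRHS]/Num.norm/= mx_normrE.
exact: (le_bigmax _ (fun i : 'I_1 * 'I_N => `|h i.1 i.2|) (0, i)).
Qed.

Lemma monomial_le r (a : {ffun 'I_N -> nat}) (h : 'rV[R]_N) :
  `|h| <= r -> `|monomial a h| <= r ^+ mdeg a.
Proof.
move=> hr; rewrite /monomial normr_prod /mdeg -prodrXr.
apply: ler_prod => i _; rewrite normr_ge0 normrX lerXn2r ?nnegrE//.
  exact: le_trans hr.
exact: le_trans (coord_le_norm h i) hr.
Qed.

Lemma monomialD (a b : {ffun 'I_N -> nat}) (h : 'rV[R]_N) :
  monomial [ffun i => (a i + b i)%N] h = monomial a h * monomial b h.
Proof.
by rewrite /monomial -big_split; apply: eq_bigr => i _; rewrite ffunE exprD.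
Qed.

Lemma mdegD (a b : {ffun 'I_N -> nat}) :
  mdeg [ffun i => (a i + b i)%N] = (mdeg a + mdeg b)%N.
Proof. by rewrite /mdeg -big_split; apply: eq_bigr => i _; rewrite ffunE. Qed.

Lemma monomial0 (h : 'rV[R]_N) : monomial [ffun=> 0%N] h = 1.
Proof. by rewrite /monomial big1// => i _; rewrite ffunE. Qed.

Lemma mdeg0 : mdeg [ffun=> 0%N] = 0%N.
Proof. by rewrite /mdeg big1// => i _; rewrite ffunE. Qed.

(* The monomials may be repeated: this makes products and series of
   expansions a matter of renumbering. *)
Definition majorized r f M := exists (a : nat -> {ffun 'I_N -> nat})
    (c : nat -> Z -> R),
  (forall k, measurable_fun setT (c k)) /\
  forall z, (forall n, \sum_(0 <= k < n) `|c k z| * r ^+ mdeg (a k) <= M z) /\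
    forall h, `|h| <= r -> series (fun k => c k z * monomial (a k) h) @ \oo --> f z h.

Lemma majorized_ge0 r f M : majorized r f M -> forall z, 0 <= M z.
Proof. by move=> [a [c [_ H]]] z; have [/(_ 0%N)] := H z; rewrite big_geq. Qed.

Lemma majorized_le r f M M' : (forall z, M z <= M' z) ->
  majorized r f M -> majorized r f M'.
Proof.
move=> MM' [a [c [mc H]]]; exists a, c; split => // z; have [H1 H2] := H z.
by split => // n; exact: le_trans (MM' z).
Qed.

Lemma majorized_ext r f g M : (forall z h, `|h| <= r -> f z h = g z h) ->
  majorized r f M -> majorized r g M.
Proof.
move=> fg [a [c [mc H]]]; exists a, c; split => // z; have [H1 H2] := H z.
by split => // h hr; rewrite -fg//; exact: H2.
Qed.

Lemma majorized_bound r f M z h : majorized r f M -> `|h| <= r -> `|f z h| <= M z.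
Proof.
move=> [a [c [mc H]]] hr; have [H1 H2] := H z.
apply: (cvgn_norm_le (H2 h hr)); near=> n.
rewrite (le_trans _ (H1 n))// (le_trans (ler_norm_sum _ _ _))//.
by apply: ler_sum => k _; rewrite normrM ler_wpM2l// monomial_le.
Unshelve. all: by end_near. Qed.

Lemma majorized_double r (a : nat -> nat -> {ffun 'I_N -> nat})
    (c : nat -> nat -> Z -> R) (m : nat -> Z -> R) (s : nat -> Z -> 'rV[R]_N -> R)
    f M : 0 <= r ->
  (forall i j, measurable_fun setT (c i j)) ->
  (forall i z n, \sum_(0 <= j < n) `|c i j z| * r ^+ mdeg (a i j) <= m i z) ->
  (forall n z, \sum_(0 <= i < n) m i z <= M z) ->
  (forall i z h, `|h| <= r ->
    series (fun j => c i j z * monomial (a i j) h) @ \oo --> s i z h) ->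
  (forall z h, `|h| <= r -> series (fun i => s i z h) @ \oo --> f z h) ->
  majorized r f M.
Proof.
move=> r0 mc cm mM cs sf.
exists (flatten_series [ffun=> 0%N] a), (flatten_series (fun=> 0) c); split.
  by move=> k; rewrite /flatten_series; case: pickle_inv.
move=> z; pose w i j := `|c i j z| * r ^+ mdeg (a i j).
have w0 i j : 0 <= w i j by rewrite mulr_ge0// exprn_ge0.
(* [m i] is only an upper bound; the renumbering lemma wants the exact row sums of the absolute
   values. *)
pose s' i := fine (\sum_(j <oo) (w i j)%:E).
have s'cvg i : series (w i) @ \oo --> s' i.
  by have [] := nonneg_series_cvg (w0 i) (cm i z).
have s'0 i : 0 <= s' i by apply/fine_ge0/nneseries_ge0 => j _ _; rewrite lee_fin.
have s'M n : \sum_(0 <= i < n) s' i <= M z.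
  rewrite (le_trans _ (mM n z))// ler_sum// => i _.
  by have [] := nonneg_series_cvg (w0 i) (cm i z).
have wm i n : \sum_(0 <= j < n) `|w i j| <= m i z.
  by under eq_bigr do rewrite ger0_norm//; exact: cm.
split.
  have [S_cvg _ _] := nonneg_series_cvg s'0 s'M.
  have [H _] := double_series_cvg wm (mM^~ z) s'cvg S_cvg.
  move=> n; rewrite (le_trans _ (H n))// ler_sum// => k _; rewrite /flatten_series.
  case: pickle_inv => [p|]; last by rewrite !normr0 mul0r.
  by rewrite [leRHS]ger0_norm.
move=> h hr.
have um i n : \sum_(0 <= j < n) `|c i j z * monomial (a i j) h| <= m i z.
  rewrite (le_trans _ (cm i z n))// ler_sum// => j _.
  by rewrite normrM ler_wpM2l// monomial_le.
have [_] := double_series_cvg um (mM^~ z) (fun i => cs i z h hr) (sf z h hr).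
rewrite (_ : flatten_series 0 _ = (fun k => flatten_series (fun=> 0) c k z *
  monomial (flatten_series [ffun=> 0%N] a k) h))//; apply/funext => k.
by rewrite /flatten_series; case: pickle_inv => //; rewrite mul0r.
Qed.

Lemma majorized_series r (f_ : nat -> Z -> 'rV[R]_N -> R) (m : nat -> Z -> R) f M :
  0 <= r -> (forall i, majorized r (f_ i) (m i)) ->
  (forall n z, \sum_(0 <= i < n) m i z <= M z) ->
  (forall z h, `|h| <= r -> series (fun i => f_ i z h) @ \oo --> f z h) ->
  majorized r f M.
Proof.
move=> r0 /choice[a /choice[c H]] mM sf.
apply: (majorized_double (a := a) (c := c) (m := m) (s := f_)) => //.
- by move=> i; case: (H i).
- by move=> i z n; case: (H i) => _ /(_ z)[].
- by move=> i z h hr; case: (H i) => _ /(_ z)[_]; apply.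
Qed.

Lemma series_cst0 (u : nat -> R) n : (forall k, (n <= k)%N -> u k = 0) ->
  series u @ \oo --> \sum_(0 <= k < n) u k.
Proof.
move=> u0; apply: cvg_near_cst; near=> m.
rewrite /series /= (big_cat_nat (n := n))//=; last by near: m; exists n.
rewrite [X in _ + X]big1_seq ?addr0// => k /=.
by rewrite mem_index_iota => /andP[nk _]; exact: u0.
Unshelve. all: by end_near. Qed.

Lemma sum_nat_support (u : nat -> R) n m : (forall k, 0 <= u k) ->
  (forall k, (n <= k)%N -> u k = 0) ->
  \sum_(0 <= k < m) u k <= \sum_(0 <= k < n) u k.
Proof.
move=> u0 un; have [nm|mn] := leqP n m.
  rewrite (big_cat_nat (n := n))//= [X in _ + X]big1_seq ?addr0// => k /=.
  by rewrite mem_index_iota => /andP[nk _]; exact: un.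
by rewrite [leRHS](big_cat_nat (n := m))//= ?(ltnW mn)// lerDl sumr_ge0.
Qed.

Lemma majorized_monomial r (c : Z -> R) (a : {ffun 'I_N -> nat}) :
  0 <= r -> measurable_fun setT c ->
  majorized r (fun z h => c z * monomial a h) (fun z => `|c z| * r ^+ mdeg a).
Proof.
move=> r0 mc; exists (fun=> a), (fun k => if k is 0%N then c else (fun=> 0)).
split; first by case.
move=> z; split.
  move=> n; rewrite (le_trans (sum_nat_support (n := 1) _ _ _))//.
  - by move=> k; rewrite mulr_ge0// exprn_ge0.
  - by case=> // k _; rewrite normr0 mul0r.
  - by rewrite big_nat1.
move=> h hr; have := @series_cst0 (fun k =>
  (if k is 0%N then c else (fun=> 0)) z * monomial a h) 1.
rewrite big_nat1; apply => -[//|k _]; exact: mul0r.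
Qed.

Lemma majorized_cst r (c : Z -> R) : 0 <= r -> measurable_fun setT c ->
  majorized r (fun z h => c z) (fun z => `|c z|).
Proof.
move=> r0 mc; have := majorized_monomial [ffun=> 0%N] r0 mc.
rewrite mdeg0; under [X in majorized r X]eq_fun do under eq_fun do rewrite monomial0 mulr1.
by under [X in majorized r _ X]eq_fun do rewrite mulr1.
Qed.

Lemma majorized_const r (c : R) : 0 <= r -> majorized r (fun _ _ => c) (fun=> `|c|).
Proof. by move=> r0; apply: majorized_cst. Qed.

Lemma majorized_coord r (i : 'I_N) : 0 <= r ->
  majorized r (fun z h => h 0 i) (fun=> r).
Proof.
move=> r0; have := majorized_monomial [ffun j => (j == i) : nat] r0
   (measurable_cst (1 : R)).
have -> : mdeg [ffun j => (j == i) : nat] = 1%N.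
  by rewrite /mdeg (bigD1 i)//= ffunE eqxx big1 ?addn0// => j /negPf ji; rewrite ffunE ji.
have E (h : 'rV[R]_N) : monomial [ffun j => (j == i) : nat] h = h 0 i.
  rewrite /monomial (bigD1 i)//= ffunE eqxx expr1 big1 ?mulr1// => j /negPf ji.
  by rewrite ffunE ji.
under [X in majorized r X]eq_fun do under eq_fun do rewrite E mul1r.
by under [X in majorized r _ X]eq_fun do rewrite normr1 mul1r.
Qed.

Lemma majorizedD r f g Mf Mg : 0 <= r -> majorized r f Mf -> majorized r g Mg ->
  majorized r (fun z h => f z h + g z h) (fun z => Mf z + Mg z).
Proof.
move=> r0 mf mg.
pose F i := if i is 0%N then f else if i is 1%N then g else (fun _ _ => 0).
pose m i := if i is 0%N then Mf else if i is 1%N then Mg else (fun _ => 0).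
have Mf0 := majorized_ge0 mf; have Mg0 := majorized_ge0 mg.
apply: (majorized_series (f_ := F) (m := m)) => //.
- case=> [//|[//|i]]; have := majorized_const 0 r0.
  by rewrite /F/=; under [X in majorized r _ X -> _]eq_fun do rewrite normr0.
- move=> n z; rewrite (le_trans (sum_nat_support (n := 2) _ _ _))//.
  + by case=> [//|[//|i]].
  + by case=> [//|[//|i]].
  + by rewrite big_nat_recl//= big_nat1.
- move=> z h hr; have := @series_cst0 (fun i => F i z h) 2.
  by rewrite big_nat_recl//= big_nat1; apply; case=> [//|[//|i]].
Qed.

Lemma majorizedM r f g Mf Mg : 0 <= r -> majorized r f Mf -> majorized r g Mg ->
  majorized r (fun z h => f z h * g z h) (fun z => Mf z * Mg z).
Proof.
move=> r0 mf mg.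
have Mf0 := majorized_ge0 mf; have Mg0 := majorized_ge0 mg.
case: mf => a [c [mc H]]; case: mg => b [e [me K]].
apply: (majorized_double (a := fun i j => [ffun k => (a i k + b j k)%N])
  (c := fun i j z => c i z * e j z)
  (m := fun i z => `|c i z| * r ^+ mdeg (a i) * Mg z)
  (s := fun i z h => c i z * monomial (a i) h * g z h)) => //.
- by move=> i j; exact: measurable_funM.
- move=> i z n; have [K1 _] := K z.
  have -> : \sum_(0 <= j < n) `|c i z * e j z| * r ^+ mdeg [ffun k => (a i k + b j k)%N] =
    `|c i z| * r ^+ mdeg (a i) * (\sum_(0 <= j < n) `|e j z| * r ^+ mdeg (b j)).
    by rewrite mulr_sumr; apply: eq_bigr => j _; rewrite mdegD exprD normrM; ring.
  by rewrite ler_wpM2l// mulr_ge0// exprn_ge0.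
- by move=> n z; rewrite -mulr_suml ler_wpM2r//; case: (H z).
- move=> i z h hr; have [_ K2] := K z.
  have -> : series (fun j => c i z * e j z * monomial [ffun k => (a i k + b j k)%N] h) =
      (fun n => c i z * monomial (a i) h * series (fun j => e j z * monomial (b j) h) n).
    apply/funext => n; rewrite /series /= mulr_sumr; apply: eq_bigr => j _.
    by rewrite monomialD; ring.
  by apply: cvgMr; exact: K2.
- move=> z h hr; have [_ H2] := H z.
  have -> : series (fun i => c i z * monomial (a i) h * g z h) =
      (fun n => series (fun i => c i z * monomial (a i) h) n * g z h).
    by apply/funext => n; rewrite /series /= mulr_suml.
  by apply: cvgMl; exact: H2.
Qed.

Lemma majorized_scale r (c : Z -> R) f M : 0 <= r -> measurable_fun setT c ->
  majorized r f M ->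
  majorized r (fun z h => c z * f z h) (fun z => `|c z| * M z).
Proof. by move=> r0 mc; apply: majorizedM => //; exact: majorized_cst. Qed.

Lemma majorizedN r f M : 0 <= r -> majorized r f M ->
  majorized r (fun z h => - f z h) M.
Proof.
move=> r0 /(majorized_scale r0 (measurable_cst (-1 : R))).
under [X in majorized r X]eq_fun do under eq_fun do rewrite mulN1r.
by under [X in majorized r _ X]eq_fun do rewrite normrN1 mul1r.
Qed.

Lemma majorizedB r f g Mf Mg : 0 <= r -> majorized r f Mf -> majorized r g Mg ->
  majorized r (fun z h => f z h - g z h) (fun z => Mf z + Mg z).
Proof. by move=> r0 mf mg; apply: majorizedD => //; exact: majorizedN. Qed.

Lemma majorized0 r : 0 <= r -> majorized r (fun _ _ => 0) (fun=> 0).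
Proof.
move=> r0; have := majorized_const 0 r0.
by under [X in majorized r _ X -> _]eq_fun do rewrite normr0.
Qed.

Lemma majorized1 r : 0 <= r -> majorized r (fun _ _ => 1) (fun=> 1).
Proof.
move=> r0; have := majorized_const 1 r0.
by under [X in majorized r _ X -> _]eq_fun do rewrite normr1.
Qed.

Lemma majorized_sum r (I : Type) (s : seq I) (F : I -> Z -> 'rV[R]_N -> R)
    (m : I -> Z -> R) : 0 <= r -> (forall i, majorized r (F i) (m i)) ->
  majorized r (fun z h => \sum_(i <- s) F i z h) (fun z => \sum_(i <- s) m i z).
Proof.
move=> r0 Fm; elim: s => [|i s IH].
  apply: majorized_ext (majorized_le _ (majorized0 r0)) => [z h _|z];
  by rewrite big_nil.
apply: majorized_ext (majorized_le _ (majorizedD r0 (Fm i) IH)) => [z h _|z];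
by rewrite big_cons.
Qed.

Lemma majorizedX r f M n : 0 <= r -> majorized r f M ->
  majorized r (fun z h => f z h ^+ n) (fun z => M z ^+ n).
Proof.
move=> r0 fM; elim: n => [|n IH].
  by apply: majorized_ext (majorized_le _ (majorized1 r0)) => [z h _|z]; rewrite expr0.
by apply: majorized_ext (majorized_le _ (majorizedM r0 fM IH)) => [z h _|z]; rewrite exprS.
Qed.

(** Subtracting the value at 0 removes exactly the terms of degree 0. Every other term has degree at
    least 1, so passing from radius [r] to [t * r] multiplies its bound by at most [t]. *)
Lemma majorized_comp_scale r (t : R) f M : 0 <= r -> 0 <= t <= 1 -> majorized r f M ->
  majorized (t * r) (fun z h => f z h - f z 0) (fun z => t * M z).
Proof.
move=> r0 /andP[t0 t1] [a [c [mc H]]].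
pose b k := mdeg (a k) == 0%N.
have mon0 (k : nat) : monomial (a k) (0 : 'rV[R]_N) = (b k)%:R.
  rewrite /monomial /b; case: (eqVneq (mdeg (a k)) 0%N) => [/eqP|].
    rewrite /mdeg sum_nat_eq0 => /forallP a0; rewrite big1// => i _.
    by have := a0 i; rewrite implyTb => /eqP ->; rewrite expr0.
  rewrite /mdeg sum_nat_eq0 negb_forall => /existsP[i /= ai].
  by rewrite (bigD1 i)//= mxE expr0n (negPf ai) mul0r.
have monb k (h : 'rV[R]_N) : b k -> monomial (a k) h = 1.
  rewrite /b /mdeg sum_nat_eq0 => /forallP a0; rewrite /monomial big1// => i _.
  by have := a0 i; rewrite implyTb => /eqP ->; rewrite expr0.
exists a, (fun k => if b k then (fun=> 0) else c k); split.
  by move=> k; case: ifP.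
move=> z; have [H1 H2] := H z; split.
  move=> n; apply: le_trans (ler_wpM2l t0 (H1 n)).
  rewrite mulr_sumr ler_sum// => k _; case: ifPn => bk.
    by rewrite normr0 mul0r mulr_ge0// mulr_ge0// exprn_ge0.
  rewrite exprMn mulrA [leRHS]mulrCA mulrA ler_wpM2r ?exprn_ge0// ler_wpM2l//.
  by move: bk; rewrite /b; case: mdeg => // m _; rewrite exprS ler_piMr// exprn_ile1.
move=> h hr.
have hr' : `|h| <= r by rewrite (le_trans hr)// ler_piMl.
have -> : series (fun k => (if b k then fun=> 0 else c k) z * monomial (a k) h) =
  series (fun k => c k z * monomial (a k) h) -
  series (fun k => c k z * monomial (a k) (0 : 'rV[R]_N)).
  apply/funext => n; rewrite /series /= [RHS]/(_ - _) -[RHS]sumrB.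
  apply: eq_bigr => k _; rewrite mon0; case: ifPn => bk.
    by rewrite mul0r monb// subrr.
  by rewrite mulr0 subr0.
by apply: cvgB; apply: H2; rewrite ?normr0.
Qed.

Lemma majorized_radius r r' f M : 0 <= r' <= r -> majorized r f M -> majorized r' f M.
Proof.
move=> /andP[r0 rr] [a [c [mc H]]]; exists a, c; split => // z; have [H1 H2] := H z.
split => [n|h hr]; last by apply: H2; exact: le_trans rr.
apply: le_trans (H1 n); apply: ler_sum => k _; rewrite ler_wpM2l//.
by rewrite lerXn2r ?nnegrE// (le_trans r0).
Qed.

End majorized.

(** * The power series of ln (1 + x) *)

Section ln_series.
Context {R : realType}.
Implicit Types x t : R.

Lemma sum_geometric_le (x : R) n : 0 <= x < 1 ->
  \sum_(0 <= i < n) x ^+ i <= (1 - x)^-1.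
Proof.
move=> /andP[x0 x1]; have x1' : 0 < 1 - x by rewrite subr_gt0.
rewrite -[leRHS]mul1r ler_pdivlMr//.
elim: n => [|n IH]; first by rewrite big_geq// mul0r ler01.
have E m : (\sum_(0 <= i < m) x ^+ i) * (1 - x) = 1 - x ^+ m.
  elim: m => [|m IHm]; first by rewrite big_geq// mul0r expr0 subrr.
  by rewrite big_nat_recr//= mulrDl IHm exprS; ring.
by rewrite E gerBl exprn_ge0.
Qed.

Definition ln1p_coef (x : R) (i : nat) : R := (-1) ^+ i * x ^+ i.+1 / i.+1%:R.

Lemma is_derive_ln1p_series t n :
  is_derive t 1 (fun x => \sum_(0 <= i < n) ln1p_coef x i) (\sum_(0 <= i < n) (- t) ^+ i).
Proof.
elim: n => [|n IH].
  rewrite big_geq// (_ : (fun x => _) = cst (0 : R)).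
    exact: is_derive_cst.
  by apply/funext => x; rewrite big_geq.
have -> : (fun x => \sum_(0 <= i < n.+1) ln1p_coef x i) =
  (fun x => \sum_(0 <= i < n) ln1p_coef x i) + (((-1) ^+ n / n.+1%:R) \*: (@id R ^+ n.+1)).
  apply/funext => x; rewrite big_nat_recr//= [RHS]/(_ + _) /= /ln1p_coef.
  by rewrite !fctE/= /GRing.scale/= mulrAC.
rewrite big_nat_recr//=; apply: is_derive_eq.
rewrite /GRing.scale/= -mulr_natr [in RHS]exprNn.
by congr (_ + _); rewrite !mulr1 mul1r; field.
Qed.

(** Mean value theorem for the error: its derivative (1 + t)^-1 minus a geometric sum equals (-t)^n
    / (1 + t), at most |x|^n / (1 - |x|) for |t| <= |x|. The length |x| of the interval is bounded
    by 1. *)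
Lemma ln1p_remainder x n : `|x| < 1 ->
  `|ln (1 + x) - \sum_(0 <= i < n) ln1p_coef x i| <= `|x| ^+ n / (1 - `|x|).
Proof.
move=> x1.
have x1' : 0 < 1 - `|x| by rewrite subr_gt0.
pose E t := ln (1 + t) - \sum_(0 <= i < n) ln1p_coef t i.
pose dE t := (1 + t)^-1 - \sum_(0 <= i < n) (- t) ^+ i.
have tpos t : `|t| <= `|x| -> 0 < 1 + t.
  move=> tx; have : - `|t| <= t by rewrite lerNl -normrN ler_norm.
  lra.
have dEE t : `|t| <= `|x| -> is_derive t 1 E (dE t).
  move=> /tpos t0.
  have h1 : is_derive t 1 (fun t : R => ln (1 + t)) (1 + t)^-1.
    have h2 : is_derive t 1 (fun t : R => 1 + t) 1.
      rewrite (_ : (fun t : R => 1 + t) = cst 1 + id)//.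
      by apply: is_derive_eq; rewrite add0r.
    have := @is_derive1_comp _ (@ln R) (fun t : R => 1 + t) t _ _ (is_derive1_ln t0) h2.
    by rewrite mulr1.
  exact: is_deriveB h1 (is_derive_ln1p_series t n).
have dEb t : `|t| <= `|x| -> `|dE t| <= `|x| ^+ n / (1 - `|x|).
  move=> tx; have t0 := tpos _ tx.
  have -> : dE t = (- t) ^+ n / (1 + t).
    apply: (mulIf (lt0r_neq0 t0)); rewrite mulrBl mulVf ?lt0r_neq0//.
    rewrite -mulrA mulVf ?lt0r_neq0// mulr1.
    elim: n {E dE dEE} => [|m IHm]; first by rewrite big_geq// mul0r subr0 expr0.
    by rewrite big_nat_recr//= mulrDl opprD addrA IHm exprS; ring.
  rewrite normrM normrX normrN normfV (gtr0_norm t0) ler_pM ?exprn_ge0 ?invr_ge0 ?(ltW t0)//.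
    by rewrite lerXn2r ?nnegrE.
  rewrite lef_pV2 ?posrE//.
  have : - `|t| <= t by rewrite lerNl -normrN ler_norm.
  lra.
have E0 : E 0 = 0.
  rewrite /E addr0 ln1 big1 ?subrr// => i _.
  by rewrite /ln1p_coef exprS !mul0r mulr0 mul0r.
have cE (a b : R) : (forall t, a <= t <= b -> `|t| <= `|x|) -> {within `[a, b], continuous E}.
  move=> ab; apply: continuous_in_subspaceT => t.
  rewrite inE/= in_itv/= => /ab /dEE [H _].
  exact/differentiable_continuous/derivable1_diffP.
have B0 : 0 <= `|x| ^+ n / (1 - `|x|) by rewrite divr_ge0 ?exprn_ge0// ltW.
case: (leP 0 x) => x0.
  have tx t : 0 <= t <= x -> `|t| <= `|x|.
    by move=> /andP[t0 tx]; rewrite !ger0_norm//.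
  have [|c] := @MVT_segment _ E dE 0 x x0 _ (cE _ _ tx).
    by move=> t; rewrite in_itv/= => /andP[t0 t1]; apply: dEE; apply: tx; rewrite !ltW.
  rewrite in_itv/= E0 !subr0 => cx /= ; rewrite {1}/E => ->.
  rewrite normrM -[leRHS]mulr1 ler_pM// ?dEb//; first exact: tx.
  exact: ltW.
have tx t : x <= t <= 0 -> `|t| <= `|x|.
  by move=> /andP[t0 t1]; rewrite !ler0_norm ?lerN2// ltW.
have [|c] := @MVT_segment _ E dE x 0 (ltW x0) _ (cE _ _ tx).
  by move=> t; rewrite in_itv/= => /andP[t0 t1]; apply: dEE; apply: tx; rewrite !ltW.
rewrite in_itv/= E0 !sub0r => cx /=; rewrite {1}/E => EE.
rewrite -normrN EE normrM normrN -[leRHS]mulr1 ler_pM// ?dEb//; first exact: tx.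
exact: ltW.
Qed.

Lemma cvg_ln1p_series x : `|x| < 1 -> series (ln1p_coef x) @ \oo --> ln (1 + x).
Proof.
move=> x1; apply/cvgrPdist_lt => e e0.
have : geometric (1 - `|x|)^-1 `|x| @ \oo --> (0 : R).
  by apply: cvg_geometric; rewrite normr_id.
move=> /cvgrPdist_lt /(_ _ e0); apply: filterS => n /=.
rewrite sub0r normrN mulrC ger0_norm; last by rewrite divr_ge0 ?exprn_ge0// subr_ge0 ltW.
by move=> H; apply: le_lt_trans H; exact: ln1p_remainder.
Qed.

End ln_series.

Section integrable_real.
Context {R : realType} {d : measure_display} {Z : measurableType d}.
Variable mu : {measure set Z -> \bar R}.
Implicit Types f g : Z -> R.

Lemma integrable_realD f g : mu.-integrable setT (EFin \o f) ->
  mu.-integrable setT (EFin \o g) ->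
  mu.-integrable setT (EFin \o (fun z => f z + g z)).
Proof. by move=> If Ig; apply: eq_integrable (integrableD _ If Ig). Qed.

Lemma integrable_realZr f (e : R) : mu.-integrable setT (EFin \o f) ->
  mu.-integrable setT (EFin \o (fun z => f z * e)).
Proof. by move=> If; apply: eq_integrable (integrableZr _ e If). Qed.

End integrable_real.

Section majorized_functions.
Context {R : realType} {N : nat} {d : measure_display} {Z : measurableType d}.
Implicit Types (r : R) (f : Z -> 'rV[R]_N -> R) (M : Z -> R).

Lemma majorized_inv1p r f M : 0 <= r -> majorized r f M -> (forall z, M z < 1) ->
  majorized r (fun z h => (1 + f z h)^-1) (fun z => (1 - M z)^-1).
Proof.
move=> r0 fM M1; have M0 := majorized_ge0 fM.
apply: (majorized_series (f_ := fun i z h => (- f z h) ^+ i) (m := fun i z => M z ^+ i)) => //.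
- by move=> i; apply: majorizedX => //; exact: majorizedN.
- by move=> n z; apply: sum_geometric_le; rewrite M0 M1.
- move=> z h hr; have := @cvg_geometric_series _ 1 (- f z h).
  rewrite mul1r opprK; under [geometric _ _]funext do rewrite /= mul1r; apply.
  by rewrite normrN; apply: le_lt_trans (M1 z); exact: majorized_bound fM hr.
Qed.

Lemma majorized_ln1p r f M : 0 <= r -> majorized r f M -> (forall z, M z < 1) ->
  majorized r (fun z h => ln (1 + f z h)) (fun z => M z / (1 - M z)).
Proof.
move=> r0 fM M1; have M0 := majorized_ge0 fM.
apply: (majorized_series (f_ := fun i z h => ln1p_coef (f z h) i)
  (m := fun i z => M z * M z ^+ i)) => //.
- move=> i; apply: (@majorized_le _ _ _ _ _ _ (fun z => `|(-1) ^+ i / i.+1%:R| * M z ^+ i.+1)).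
    move=> z; rewrite -exprS ler_piMl ?exprn_ge0// normrM normrX normrN1 expr1n mul1r.
    by rewrite normfV ger0_norm// invf_le1 ?ltr0n// ler1n.
  apply: majorized_ext (majorized_scale r0 (measurable_cst _) (majorizedX i.+1 r0 fM)).
  by move=> z h _; rewrite /ln1p_coef mulrAC.
- move=> n z; rewrite -mulr_sumr ler_wpM2l//; apply: sum_geometric_le.
  by rewrite M0 M1.
- move=> z h hr; apply: cvg_ln1p_series.
  by apply: le_lt_trans (M1 z); exact: majorized_bound fM hr.
Qed.

Lemma majorized_measurable r f M h : majorized r f M -> `|h| <= r ->
  measurable_fun setT (f^~ h).
Proof.
move=> [a [c [mc H]]] hr.
apply: (@measurable_fun_cvg _ _ _ _ (fun n z => series (fun k => c k z * monomial (a k) h) n)).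
  move=> n; rewrite /series /=; apply: measurable_sum => k.
  exact: measurable_funM.
by move=> z _; case: (H z) => _; apply.
Qed.

Lemma majorized_comp d' (Z' : measurableType d') (phi : Z' -> Z) r f M :
  measurable_fun setT phi -> majorized r f M ->
  majorized r (fun z => f (phi z)) (fun z => M (phi z)).
Proof.
move=> mphi [a [c [mc H]]]; exists a, (fun k z => c k (phi z)); split.
  by move=> k; exact: measurableT_comp.
by move=> z; case: (H (phi z)).
Qed.

(** The coefficients are integrated one by one, by dominated convergence with [M] as dominating
    function. The result no longer depends on [z] and may be read over any space [Z']. *)
Lemma majorized_integral d' (Z' : measurableType d')
    (mu : {measure set Z -> \bar R}) r f M : 0 < r ->
  majorized r f M -> mu.-integrable setT (EFin \o M) ->
  majorized (Z := Z') r (fun _ h => \int[mu]_z f z h) (fun=> \int[mu]_z M z).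
Proof.
move=> r0 [a [c [mc H]]] iM.
have ck k z : `|c k z| * r ^+ mdeg (a k) <= M z.
  have [/(_ k.+1) H1 _] := H z; rewrite (le_trans _ H1)// big_nat_recr//= lerDr.
  by apply: sumr_ge0 => i _; rewrite mulr_ge0// exprn_ge0// ltW.
have ic k : mu.-integrable setT (EFin \o c k).
  apply: (@le_integrable _ _ _ _ _ _ _ (fun z => ((r ^+ mdeg (a k))^-1 * M z)%:E)) => //.
  - exact/measurable_EFinP.
  - move=> z _ /=; rewrite lee_fin [leRHS]ger0_norm.
      by rewrite mulrC ler_pdivlMr ?exprn_gt0.
    rewrite mulr_ge0 ?invr_ge0 ?exprn_ge0 ?(ltW r0)//.
    by have [/(_ 0%N)] := H z; rewrite big_geq.
  - by under eq_fun do rewrite EFinM; exact: integrableZl.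
have isum (n : nat) (e : nat -> R) : mu.-integrable setT
    (EFin \o (fun z => \sum_(0 <= k < n) c k z * e k)).
  elim: n => [|n IH].
    by under [X in EFin \o X]eq_fun do rewrite big_geq//; exact: integrable0.
  under [X in EFin \o X]eq_fun do rewrite big_nat_recr//=.
  by apply: integrable_realD => //; exact: integrable_realZr.
have Esum (n : nat) (e : nat -> R) :
    \int[mu]_z (\sum_(0 <= k < n) c k z * e k) =
    \sum_(0 <= k < n) (\int[mu]_z c k z) * e k.
  elim: n => [|n IH].
    rewrite big_geq//; under eq_Rintegral do rewrite big_geq//.
    by rewrite Rintegral_cst// mul0r.
  rewrite big_nat_recr//= -IH -RintegralZr// -RintegralD//.
  - by apply: eq_Rintegral => z _; rewrite big_nat_recr.
  - exact: integrable_realZr.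
exists a, (fun k _ => \int[mu]_z c k z); split => // _; split.
  move=> n.
  (* Giving each coefficient the sign of its integral turns the sum of absolute values of integrals
     into the integral of a single combination, which is pointwise at most [M]. *)
  pose s k : R := Num.sg (\int[mu]_z c k z) * r ^+ mdeg (a k).
  have -> : \sum_(0 <= k < n) `|\int[mu]_z c k z| * r ^+ mdeg (a k) =
     \int[mu]_z (\sum_(0 <= k < n) c k z * s k).
    rewrite Esum; apply: eq_bigr => k _.
    by rewrite /s mulrA [_ * Num.sg _]mulrC -normrEsg.
  apply: le_Rintegral => // z _; have [H1 _] := H z.
  rewrite (le_trans _ (H1 n))//; apply: ler_sum => k _.
  rewrite /s mulrA ler_wpM2r ?exprn_ge0 ?(ltW r0)//.
  rewrite (le_trans (ler_norm _))// normrM ler_piMr// normr_sg.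
  by case: (_ != 0).
move=> h hr.
have mf : measurable_fun setT (f^~ h).
  apply: (@majorized_measurable r f M) => //; by exists a, c.
have := @dominated_convergence _ _ _ mu setT measurableT
  (fun n z => (series (fun k => c k z * monomial (a k) h) n)%:E)
  (fun z => (f z h)%:E) (EFin \o M).
case.
- move=> n; apply/measurable_EFinP.
  by case/integrableP: (isum n (fun k => monomial (a k) h)) => /measurable_EFinP.
- exact/measurable_EFinP.
- apply: aeW => z _; apply: cvg_EFin; first exact: nearW.
  by case: (H z) => _; apply.
- exact: iM.
- apply: aeW => z n _ /=; rewrite lee_fin; case: (H z) => H1 _.
  rewrite (le_trans _ (H1 n))// (le_trans (ler_norm_sum _ _ _))//.
  by apply: ler_sum => k _; rewrite normrM ler_wpM2l// monomial_le.
move=> If _ H'.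
have -> : series (fun k => \int[mu]_z c k z * monomial (a k) h) =
  fine \o (fun n => \int[mu]_z (series (fun k => c k z * monomial (a k) h) n)%:E)%E.
  by apply/funext => n; rewrite /= -[LHS](Esum n (fun k => monomial (a k) h)).
by apply: fine_cvg; rewrite fineK//; exact: integrable_fin_num If.
Qed.

End majorized_functions.

(** * Real analytic functions and majorized power series *)

Lemma cvg_finite_sum {R : realType} (I : Type) (s : seq I) (F : I -> nat -> R)
    (l : I -> R) : (forall i, F i @ \oo --> l i) ->
  (fun n => \sum_(i <- s) F i n) @ \oo --> \sum_(i <- s) l i.
Proof.
move=> Fl; elim: s => [|i s IH].
  by rewrite big_nil; under eq_fun do rewrite big_nil; exact: cvg_cst.
by rewrite big_cons; under eq_fun do rewrite big_cons; exact: cvgD.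
Qed.

Section finite_sums.
Context {R : realType} {I : choiceType}.
Implicit Types (u : I -> R) (A B : {fset I}).

Lemma partial_sumE u A : summability.partial_sum u A = \sum_(i <- A) u i.
Proof. by rewrite /summability.partial_sum -(big_seq_fsetE _ A xpredT u). Qed.

Lemma sum_fsetU_disjoint u A B : fdisjoint A B ->
  \sum_(i <- (A `|` B)%fset) u i = \sum_(i <- A) u i + \sum_(i <- B) u i.
Proof.
move=> dAB; rewrite -big_cat; apply: perm_big; apply: uniq_perm.
- exact: fset_uniq.
- rewrite cat_uniq !fset_uniq andbT/=; apply/hasPn => x xB.
  by apply/negP => /(fdisjointP dAB); rewrite xB.
- by move=> x; rewrite mem_cat in_fsetU.
Qed.

End finite_sums.

Section analytic_of_majorized.
Context {R : realType} {N : nat}.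
Local Notation idx := {ffun 'I_N -> nat}.

(** Repeated monomials are collected: the coefficient of [b] is the sum of the [c k] with [a k = b],
    absolutely convergent as part of a majorized series. *)
Lemma majorized_analytic d (Z : measurableType d) (z : Z) (r M : R) (f : 'rV[R]_N -> R)
    (x : 'rV[R]_N) : 0 < r ->
  majorized (Z := Z) r (fun _ h => f (x + h)) (fun=> M) -> real_analytic_at f x.
Proof.
move=> r0 [a [c0 [_ /(_ z)]]]; set c := c0^~ z => -[cM cf].
have cE k : c0 k z = c k by [].
pose u b k := if a k == b then c k else 0.
have ub b n : \sum_(0 <= k < n) `|u b k| <= M / r ^+ mdeg b.
  rewrite ler_pdivlMr ?exprn_gt0// mulr_suml (le_trans _ (cM n))// ler_sum// => k _.
  rewrite /u; case: eqP => [->//|_]; rewrite normr0 mul0r mulr_ge0//.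
  by rewrite exprn_ge0// ltW.
have cu b : cvgn (series (u b)).
  apply: normed_cvg; have [] := nonneg_series_cvg (fun k => normr_ge0 (u b k)) (ub b).
  by move=> H _ _; apply/cvg_ex; eexists; exact: H.
exists (fun b => limn (series (u b))).
apply/nbhs_normP; exists r => //= y; rewrite /ball_/= distrC => /ltW yr.
set h := y - x; have hr : `|h| <= r by [].
have -> : f y = f (x + h) by rewrite /h addrC subrK.
have [T1 _ _] := nonneg_series_cvg (w := fun k => `|c k| * r ^+ mdeg (a k))
   (fun k => mulr_ge0 (normr_ge0 _) (exprn_ge0 _ (ltW r0))) cM.
have FF := @summability.totally_filter idx.
apply/cvgrPdist_le => e e0.
have /cvgrPdist_le/(_ _ (divr_gt0 e0 (ltr0n R 2))) [K _ HK] := T1.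
have tail n : \sum_(K <= k < n) `|c k| * r ^+ mdeg (a k) <= e.
  have [nK|/ltnW Kn] := leqP n K; first by rewrite big_geq// ltW.
  have -> : \sum_(K <= k < n) `|c k| * r ^+ mdeg (a k) =
    series (fun k => `|c k| * r ^+ mdeg (a k)) n - series (fun k => `|c k| * r ^+ mdeg (a k)) K.
    by rewrite sub_series_geq.
  have := HK K (leqnn K); have := HK n Kn; rewrite /= !ler_norml => /andP[A1 A2] /andP[B1 B2].
  lra.
(* Once [A] contains the multi-indices of the first [K] terms, only terms of rank at least [K] are
   missing, and these add up to at most [e]. *)
exists [fset a k | k in iota 0 K]%fset => // A /= KA.
have sA : series (fun k => (a k \in A)%:R * (c k * monomial (a k) h)) @ \oo -->
   summability.partial_sum (fun b => limn (series (u b)) * monomial b h) A.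
  rewrite partial_sumE.
  have -> : series (fun k => (a k \in A)%:R * (c k * monomial (a k) h)) =
      (fun n => \sum_(b <- A) series (u b) n * monomial b h).
    apply/funext => n; rewrite /series /=.
    under [RHS]eq_bigr do rewrite mulr_suml.
    rewrite exchange_big/=; apply: eq_bigr => k _.
    have [aA|aA] := boolP (a k \in A).
      rewrite mul1r (big_fsetD1 (a k))//= /u eqxx big1_seq ?addr0// => b.
      by rewrite in_fsetD1 eq_sym => /andP[_ /andP[/negPf ->]]; rewrite mul0r.
    rewrite mul0r big1_seq// => b /andP[_ bA]; rewrite /u.
    by case: eqP => [E|_]; rewrite ?mul0r//; move: aA; rewrite E bA.
  apply: (@cvg_finite_sum _ _ _ (fun b n => series (u b) n * monomial b h)) => b.
  by apply: cvgMl; exact: cu.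
have sD : series (fun k => (a k \notin A)%:R * (c k * monomial (a k) h)) @ \oo -->
   f (x + h) - summability.partial_sum (fun b => limn (series (u b)) * monomial b h) A.
  have -> : series (fun k => (a k \notin A)%:R * (c k * monomial (a k) h)) =
     series (fun k => c k * monomial (a k) h) -
     series (fun k => (a k \in A)%:R * (c k * monomial (a k) h)).
    apply/funext => n; rewrite /series /= [RHS]/(_ - _) -[RHS]sumrB.
    by apply: eq_bigr => k _; case: (a k \in A) => /=; ring.
  by apply: cvgB sA; exact: cf.
apply: cvgn_norm_le sD _.
near=> n; rewrite (le_trans _ (tail n))// (le_trans (ler_norm_sum _ _ _))//.
have Kn : (K <= n)%N by near: n; exists K.
rewrite (big_cat_nat (n := K))//= big1_seq ?add0r.
  apply: ler_sum => k _; rewrite normrM (le_trans (ler_piMl _ _))//.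
    by rewrite normr_nat; case: (_ \in _).
  by rewrite normrM ler_wpM2l// monomial_le.
move=> k /=; rewrite mem_index_iota => /= kK.
rewrite (_ : (a k \notin A) = false) ?mul0r ?normr0//.
apply/negbTE; rewrite negbK; apply: (fsubsetP KA); apply/imfsetP; exists k => //=.
by rewrite mem_iota.
Unshelve. all: by end_near. Qed.

End analytic_of_majorized.

Section majorized_of_analytic.
Context {R : realType} {m k : nat}.
Local Notation idx := {ffun 'I_m -> nat}.

(** Exponent 0 on the last k variables: a function of the first m parameters thus gets an expansion
    in all of them. *)
Definition pad_idx (a : idx) : {ffun 'I_(m + k) -> nat} :=
  [ffun i => if fintype.split i is inl j then a j else 0%N].

Lemma monomial_pad (a : idx) (h : 'rV[R]_(m + k)) :
  monomial (pad_idx a) h = monomial a (lsubmx h).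
Proof.
rewrite /monomial big_split_ord/= [X in _ * X]big1 ?mulr1.
  apply: eq_bigr => i _; rewrite ffunE mxE; congr (_ ^+ _).
  by case: split_ordP => j /eqP; rewrite ?eq_lshift ?eq_lrshift// => /eqP ->.
move=> i _; rewrite ffunE; case: split_ordP => j /eqP.
  by rewrite eq_rlshift.
by rewrite expr0.
Qed.

Lemma mdeg_pad (a : idx) : mdeg (pad_idx a) = mdeg a.
Proof.
rewrite /mdeg big_split_ord/= [X in (_ + X)%N]big1 ?addn0.
  apply: eq_bigr => i _; rewrite ffunE.
  by case: split_ordP => j /eqP; rewrite ?eq_lshift ?eq_lrshift// => /eqP ->.
move=> i _; rewrite ffunE; case: split_ordP => j /eqP//.
by rewrite eq_rlshift.
Qed.

Lemma norm_lsubmx (h : 'rV[R]_(m + k)) : `|lsubmx h| <= `|h|.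
Proof.
rewrite [leLHS]/Num.norm/= mx_normrE.
apply/bigmax_leP; split => // -[i j] _ /=; rewrite mxE.
by rewrite ord1 coord_le_norm.
Qed.

Definition idx_prefix (n : nat) : seq idx := pmap pickle_inv (iota 0 n).

Lemma mem_idx_prefix n (a : idx) : (a \in idx_prefix n) = (choice.pickle a < n)%N.
Proof.
rewrite /idx_prefix mem_pmap; apply/mapP/idP.
  move=> [i]; rewrite mem_iota => /= i_n /esym E.
  by have := @pickle_invK idx i; rewrite E /= => ->.
by move=> an; exists (choice.pickle a); rewrite ?mem_iota// pickleK_inv.
Qed.

Lemma mem_fset_prefix n (a : idx) :
  (a \in [fset b in idx_prefix n]%fset) = (choice.pickle a < n)%N.
Proof. by rewrite inE /= mem_idx_prefix. Qed.

Lemma idx_prefix_uniq n : uniq (idx_prefix n).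
Proof.
apply: (@pmap_uniq _ _ _ choice.pickle); last exact: iota_uniq.
exact: pickle_invK.
Qed.

Lemma big_idx_prefix (g : idx -> R) n :
  \sum_(0 <= i < n) (if pickle_inv i is Some a then g a else 0) =
  summability.partial_sum g [fset a in idx_prefix n]%fset.
Proof.
rewrite partial_sumE.
rewrite (perm_big (idx_prefix n)); last first.
  apply: uniq_perm; [exact: fset_uniq|exact: idx_prefix_uniq|].
  by move=> a; rewrite inE.
rewrite /idx_prefix /index_iota subn0; elim: (iota 0 n) => [|i s IH].
  by rewrite !big_nil.
rewrite big_cons IH /=; case: pickle_inv => [a|]/=; last by rewrite add0r.
by rewrite big_cons.
Qed.

(** Let [A0] be such that all larger partial sums are within 1 of the limit. A finite set disjoint
    from [A0] then has a sum of absolute value at most 2; separating the terms by sign bounds the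
    sum of their absolute values by 4. *)
Lemma unconditional_bounded (I : choiceType) (u : I -> R) (s : R) :
  summability.partial_sum u @ summability.totally --> s ->
  exists M, forall A : {fset I}, \sum_(i <- A) `|u i| <= M.
Proof.
have FF := @summability.totally_filter I.
move=> /cvgrPdist_le/(_ _ ltr01)[A0 _ H0].
have HB (B : {fset I}) : fdisjoint A0 B -> `|\sum_(i <- B) u i| <= 2.
  move=> dB.
  have := H0 (A0 `|` B)%fset (fsubsetUl _ _); have := H0 A0 (fsubset_refl _).
  rewrite /= !partial_sumE sum_fsetU_disjoint//= => h1 h2.
  rewrite !ler_norml in h1 h2 *; move: h1 h2 => /andP[? ?] /andP[? ?].
  by apply/andP; split; lra.
exists (\sum_(i <- A0) `|u i| + 4) => A.
have -> : \sum_(i <- A) `|u i| =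
    \sum_(i <- (A `&` A0)%fset) `|u i| + \sum_(i <- (A `\` A0)%fset) `|u i|.
  rewrite -sum_fsetU_disjoint ?fsetID//.
  by apply/fdisjointP => x; rewrite !inE => /andP[_ ->].
rewrite lerD//.
  rewrite -[in leRHS](fsetID A A0) sum_fsetU_disjoint; last first.
    by apply/fdisjointP => x; rewrite !inE => /andP[_ ->].
  by rewrite fsetIC lerDl sumr_ge0.
set B := (A `\` A0)%fset.
have -> : \sum_(i <- B) `|u i| =
    \sum_(i <- [fset i in B | 0 <= u i]%fset) u i -
    \sum_(i <- [fset i in B | u i < 0]%fset) u i.
  rewrite !big_fset /=.
  rewrite (bigID (fun i => 0 <= u i))/= -sumrN; congr (_ + _).
    by apply: eq_bigr => i /ger0_norm.
  by apply: eq_big => i; rewrite -ltNge// => /ltr0_norm.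
have d1 : fdisjoint A0 [fset i in B | 0 <= u i]%fset.
  by apply/fdisjointP => x xA; rewrite !inE xA.
have d2 : fdisjoint A0 [fset i in B | u i < 0]%fset.
  by apply/fdisjointP => x xA; rewrite !inE xA.
have := HB _ d1; have := HB _ d2.
rewrite !ler_norml => /andP[? ?] /andP[? ?]; lra.
Qed.

Lemma analytic_majorized (f : 'rV[R]_m -> R) (x : 'rV[R]_m) : real_analytic_at f x ->
  exists r M, 0 < r /\ forall d (Z : measurableType d),
    majorized (N := m + k) (Z := Z) r (fun _ h => f (x + lsubmx h)) (fun=> M).
Proof.
move=> [c /nbhs_normP[e /= e0 He]].
pose r := e / 2; have r0 : 0 < r by rewrite divr_gt0.
have re : r < e by rewrite /r; lra.
(* At this corner of the cube every monomial in the increment equals r^deg, so that absolute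
   convergence at one point bounds the sums of |c a| r^deg. *)
pose y0 := x + const_mx r.
have ny0 : `|const_mx r : 'rV[R]_m| <= r.
  rewrite [leLHS]/Num.norm/= mx_normrE; apply/bigmax_leP; split; first exact: ltW.
  by move=> [i j] _ /=; rewrite mxE gtr0_norm.
have mon0 (a : idx) : monomial a (const_mx r : 'rV[R]_m) = r ^+ mdeg a.
  by rewrite /monomial /mdeg -prodrXr; apply: eq_bigr => i _; rewrite mxE.
have := He y0; rewrite /ball_/= /y0 opprD addNKr normrN => /(_ (le_lt_trans ny0 re)).
have -> : x + const_mx r - x = const_mx r by rewrite addrC addKr.
move=> /unconditional_bounded[M HM].
exists r, M; split => // d Z.
exists (fun i => if pickle_inv i is Some a then pad_idx a else [ffun=> 0%N]).
exists (fun i _ => if pickle_inv i is Some a then c a else 0); split => // z; split.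
  move=> n.
  rewrite (eq_bigr (fun i =>
      if pickle_inv i is Some a then `|c a * monomial a (const_mx r)| else 0)).
    rewrite (big_idx_prefix (fun a => `|c a * monomial a (const_mx r)|)).
    by rewrite partial_sumE.
  move=> i _; case: pickle_inv => [a|]; last by rewrite normr0 mul0r.
  by rewrite mdeg_pad mon0 normrM (ger0_norm (exprn_ge0 _ (ltW r0))).
move=> h hr.
have hre : `|lsubmx h| < e by rewrite (le_lt_trans (norm_lsubmx h))// (le_lt_trans hr).
have := He (x + lsubmx h); rewrite /ball_/= opprD addNKr normrN => /(_ hre).
have -> : x + lsubmx h - x = lsubmx h by rewrite addrC addKr.
move=> H.
have -> : series (fun i => (if pickle_inv i is Some a then c a else 0) *
      monomial (if pickle_inv i is Some a then pad_idx a else [ffun=> 0%N]) h) =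
    summability.partial_sum (fun a => c a * monomial a (lsubmx h)) \o
    (fun n => [fset a in idx_prefix n]%fset).
  apply/funext => n; rewrite /= -big_idx_prefix; apply: eq_bigr => i _.
  by case: pickle_inv => [a|]; rewrite ?mul0r// monomial_pad.
apply: cvg_comp H => P [A _ HA].
exists (\max_(a <- A) choice.pickle a).+1 => // n /= An; apply: HA.
apply/fsubsetP => a aA; rewrite (mem_fset_prefix n a); apply: leq_trans An.
by rewrite ltnS (big_fsetD1 a)//= leq_maxl.
Qed.

End majorized_of_analytic.

(** * Forward variables of a hidden Markov chain *)

Section forward.
Context {R : realFieldType} {l : nat}.
Implicit Types (pi : 'I_l -> R) (Q : 'I_l -> 'I_l -> R) (f : nat -> 'I_l -> R).

(* [forward pi Q f s m j] is the joint density of the outputs s, ..., s+m-1 and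
   of the state j at time s+m, for the chain with law [pi] at time s. *)
Fixpoint forward pi Q f (s m : nat) : 'I_l -> R :=
  if m is m'.+1 then
    fun j => \sum_i forward pi Q f s m' i * f (s + m')%N i * Q i j
  else pi.

Definition block pi Q f s m := \sum_i forward pi Q f s m i.

Lemma forwardS pi Q f s m j : forward pi Q f s m.+1 j =
  \sum_i forward pi Q f s m i * f (s + m)%N i * Q i j.
Proof. by []. Qed.

Lemma sum_ord_gt0 (i0 : 'I_l) (g : 'I_l -> R) : (forall i, 0 < g i) -> 0 < \sum_i g i.
Proof.
move=> g0; rewrite (bigD1 i0)//= ltr_wpDr// sumr_ge0// => i _; exact: ltW.
Qed.

Lemma forward_gt0 (i0 : 'I_l) pi Q f s m : (forall i, 0 < pi i) ->
  (forall i j, 0 < Q i j) -> (forall k i, 0 < f k i) ->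
  forall j, 0 < forward pi Q f s m j.
Proof.
move=> pi0 Q0 f0; elim: m => [//|m IH] j /=.
by apply: (sum_ord_gt0 i0) => i; rewrite !mulr_gt0.
Qed.

Lemma blockS pi Q f s m : (forall i, \sum_j Q i j = 1) ->
  block pi Q f s m.+1 = \sum_i forward pi Q f s m i * f (s + m)%N i.
Proof.
move=> Q1; rewrite /block/= exchange_big/=; apply: eq_bigr => i _.
by rewrite -mulr_sumr Q1 mulr1.
Qed.

(* Cauchy-Binet for 2x2 minors (e = -1), and its analogue for permanents
   (e = 1). *)
Lemma cauchy_binet2 (e : R) (x y a b : 'I_l -> R) : e * e = 1 ->
  2^-1 * (\sum_p \sum_q (x p * y q + e * (x q * y p)) * (a p * b q + e * (b p * a q))) =
  (\sum_p x p * a p) * (\sum_q y q * b q) + e * ((\sum_p x p * b p) * (\sum_q y q * a q)).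
Proof.
move=> e2.
have E p q : (x p * y q + e * (x q * y p)) * (a p * b q + e * (b p * a q)) =
   (x p * a p) * (y q * b q) + e * ((x p * b p) * (y q * a q)) +
   (e * ((y p * a p) * (x q * b q)) + (y p * b p) * (x q * a q)).
  have -> : (y p * b p) * (x q * a q) = e * e * ((y p * b p) * (x q * a q)).
    by rewrite e2 mul1r.
  ring.
under eq_bigr do under eq_bigr do rewrite E.
under eq_bigr do rewrite !big_split/= -!mulr_sumr.
rewrite !big_split/= -!mulr_sumr -!mulr_suml.
set A := (\sum_p x p * a p); set B := (\sum_p x p * b p).
set C := (\sum_p y p * a p); set D := (\sum_p y p * b p).
by field.
Qed.

(** For e = -1 the 2x2 minor, and for e = 1 the permanent, of two forward vectors taken at the same
    time s + m + 1, one started at time s and the other at time s + 1. *)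
Definition wedge (e : R) pi Q f s m i j :=
  forward pi Q f s m.+1 i * forward pi Q f s.+1 m j +
  e * (forward pi Q f s m.+1 j * forward pi Q f s.+1 m i).

(** Both vectors are propagated by the same matrix, the emission weights at time s + m + 1 followed
    by [Q], so Cauchy-Binet applies. The factor 1/2 compensates for summing over ordered pairs of
    states. *)
Lemma wedgeS (e : R) pi Q f s m i j : e * e = 1 ->
  wedge e pi Q f s m.+1 i j = 2^-1 * (\sum_p \sum_q
    wedge e pi Q f s m p q * (f (s + m.+1)%N p * f (s + m.+1)%N q) *
    (Q p i * Q q j + e * (Q p j * Q q i))).
Proof.
move=> e2; rewrite /wedge (forwardS pi Q f s m.+1 i) (forwardS pi Q f s m.+1 j).
rewrite (forwardS pi Q f s.+1 m i) (forwardS pi Q f s.+1 m j) addSnnS.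
rewrite -(cauchy_binet2 (fun p => forward pi Q f s m.+1 p * f (s + m.+1)%N p)
  (fun q => forward pi Q f s.+1 m q * f (s + m.+1)%N q) (Q^~ i) (Q^~ j) e2).
congr (_ * _); apply: eq_bigr => p _; apply: eq_bigr => q _.
ring.
Qed.

(** As the rows of [Q] sum to 1, weighting a forward vector by the next emission and summing over
    the states adds that output to the block. With e = -1 the right-hand side is the numerator of
    the cross-ratio of blocks minus 1. *)
Lemma sum_wedge (e : R) pi Q f s m : (forall i, \sum_j Q i j = 1) ->
  \sum_i \sum_j wedge e pi Q f s m i j * f (s + m.+1)%N i =
  block pi Q f s m.+2 * block pi Q f s.+1 m +
  e * (block pi Q f s m.+1 * block pi Q f s.+1 m.+1).
Proof.
move=> Q1; rewrite (blockS _ _ _ m.+1 Q1) (blockS _ _ s.+1 m Q1) addSnnS.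
rewrite /block /wedge.
have E i : \sum_j (forward pi Q f s m.+1 i * forward pi Q f s.+1 m j +
   e * (forward pi Q f s m.+1 j * forward pi Q f s.+1 m i)) * f (s + m.+1)%N i =
   forward pi Q f s m.+1 i * f (s + m.+1)%N i * (\sum_j forward pi Q f s.+1 m j) +
   e * (\sum_j forward pi Q f s m.+1 j) * (forward pi Q f s.+1 m i * f (s + m.+1)%N i).
  rewrite mulr_sumr [e * _]mulr_sumr mulr_suml -big_split/=.
  by apply: eq_bigr => j _; ring.
by under eq_bigr do rewrite E; rewrite big_split/= -mulr_suml -mulr_sumr mulrA.
Qed.

(** Termwise, from [x i] <= sum of [x] and eps * (sum of [y]) <= [y i]. After division by the total
    masses it compares the means of [f] under two laws, the second of which gives every state at
    least [eps]. *)
Lemma weighted_swap_le (eps : R) (x y f : 'I_l -> R) : 0 <= eps ->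
  (forall i, 0 <= f i) -> (forall i, 0 <= x i) -> (forall i, 0 <= y i) ->
  (forall i, eps * (\sum_j y j) <= y i) ->
  eps * ((\sum_i x i * f i) * (\sum_j y j)) <= (\sum_i x i) * (\sum_j y j * f j).
Proof.
move=> eps0 f0 x0 y0 ey; rewrite mulrCA !mulr_suml.
apply: (@le_trans _ _ (\sum_i (\sum_k x k) * (y i * f i))); last by rewrite -mulr_sumr mulr_suml.
apply: ler_sum => i _; rewrite mulrAC [leRHS]mulrA ler_wpM2r//.
rewrite ler_pM//; first by rewrite mulr_ge0// sumr_ge0.
by rewrite (bigD1 i)//= lerDl sumr_ge0.
Qed.

(** After at least one transition, the bound on the entries of [Q] alone suffices; for m = 0 it is
    the assumption on [pi]. *)
Lemma forward_lower (eps : R) pi Q f s m : (forall i, 0 <= pi i) ->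
  (forall i, eps * (\sum_j pi j) <= pi i) ->
  (forall i j, 0 <= Q i j) -> (forall i j, eps <= Q i j) ->
  (forall i, \sum_j Q i j = 1) -> (forall k i, 0 <= f k i) ->
  (forall i, 0 <= forward pi Q f s m i) /\
  forall i, eps * block pi Q f s m <= forward pi Q f s m i.
Proof.
move=> pi0 epi Q0 eQ Q1 f0.
have F0 n i : 0 <= forward pi Q f s n i.
  elim: n i => [//|n IH] i /=; apply: sumr_ge0 => j _.
  by rewrite !mulr_ge0.
split => //; case: m => [//|m] i.
rewrite (blockS _ _ _ _ Q1) mulr_sumr /=; apply: ler_sum => j _.
by rewrite mulrC ler_wpM2l// mulr_ge0.
Qed.

(** The quotient of the two products compares the predictive densities of the last output given the
    outputs from s on and given those from s + 1 on. It stays between eps and 1/eps whatever the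
    number of outputs. *)
Lemma block_swap (eps : R) pi Q f s m : 0 <= eps -> (forall i, 0 <= pi i) ->
  (forall i, eps * (\sum_j pi j) <= pi i) ->
  (forall i j, 0 <= Q i j) -> (forall i j, eps <= Q i j) ->
  (forall i, \sum_j Q i j = 1) -> (forall k i, 0 <= f k i) ->
  eps * (block pi Q f s m.+2 * block pi Q f s.+1 m) <=
    block pi Q f s m.+1 * block pi Q f s.+1 m.+1 /\
  eps * (block pi Q f s m.+1 * block pi Q f s.+1 m.+1) <=
    block pi Q f s m.+2 * block pi Q f s.+1 m.
Proof.
move=> eps0 pi0 epi Q0 eQ Q1 f0.
have [x0 ex] := forward_lower s m.+1 pi0 epi Q0 eQ Q1 f0.
have [y0 ey] := forward_lower s.+1 m pi0 epi Q0 eQ Q1 f0.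
rewrite (blockS _ _ _ m.+1 Q1) (blockS _ _ s.+1 m Q1) addSnnS.
split; first exact: weighted_swap_le.
rewrite [X in eps * X]mulrC [leRHS]mulrC; exact: weighted_swap_le.
Qed.

End forward.

Lemma measurable_fun_inv {R : realType} d (Z : measurableType d) (f : Z -> R) :
  measurable_fun setT f -> (forall z, 0 < f z) ->
  measurable_fun setT (fun z => (f z)^-1).
Proof.
move=> mf f0; have -> : (fun z => (f z)^-1) = (@powR R)^~ (-1) \o f.
  by apply/funext => z /=; rewrite powR_inv1// ltW.
by apply: measurableT_comp => //; exact: measurable_powR.
Qed.

(** * Expansions of the forward variables, uniform in the number of outputs *)

Section relative_closeness.
Context {R : realType} {N : nat} {d : measure_display} {Z : measurableType d}.
Implicit Types (r m : R) (f : Z -> 'rV[R]_N -> R) (fo : Z -> R).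

Lemma majorized_1p r f M : 0 <= r -> majorized r f M ->
  majorized r (fun z h => 1 + f z h) (fun z => 1 + M z).
Proof. by move=> r0 fM; exact: majorizedD (majorized1 r0) fM. Qed.

Lemma majorized_of_ratio r m f fo : 0 <= r -> measurable_fun setT fo ->
  (forall z, 0 < fo z) ->
  majorized r (fun z h => f z h / fo z - 1) (fun=> m) ->
  majorized r f (fun z => (1 + m) * fo z).
Proof.
move=> r0 mfo fo0 H.
have := majorized_scale r0 mfo (majorized_1p r0 H).
move/(majorized_le (M' := fun z => (1 + m) * fo z)) => H'.
apply: majorized_ext (H' _) => [z h _|z].
  by rewrite addrC subrK mulrC divfK// lt0r_neq0.
by rewrite gtr0_norm// mulrC.
Qed.

Lemma ratio_gt0 r m f fo z h : majorized r (fun z h => f z h / fo z - 1) (fun=> m) ->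
  m < 1 -> 0 < fo z -> `|h| <= r -> 0 < f z h.
Proof.
move=> H m1 fo0 hr; have := majorized_bound z H hr; rewrite ler_norml => /andP[H1 _].
have : 0 < f z h / fo z by lra.
by rewrite pmulr_lgt0// invr_gt0.
Qed.

End relative_closeness.

Section closeness.
Context {R : realType} {N l : nat} {d : measure_display} {Z : measurableType d}.
Variables (r eps t dl : R) (i0 : 'I_l).
Variables (pi : 'rV[R]_N -> 'I_l -> R) (Q : 'rV[R]_N -> 'I_l -> 'I_l -> R).
Variable q : nat -> 'I_l -> Z -> 'rV[R]_N -> R.
Hypotheses (r0 : 0 <= r) (eps0 : 0 < eps) (t0 : 0 < t) (t1 : t < 1)
  (dl0 : 0 <= dl) (dlt : dl <= t).
(** The tolerance [t] reproduces itself over one output: on the left the error from the perturbed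
    emission and transition plus the contracted old error, on the right [t] times the lower bound 1
    - eps * t of the renormalization. *)
Hypothesis step : (1 + t) * ((1 + dl) ^+ 2 - 1) + (1 - eps) * t <= t * (1 - eps * t).
Hypotheses (pi_ge : forall i, eps <= pi 0 i) (pi_sum : \sum_i pi 0 i = 1).
Hypotheses (Q_ge : forall i j, eps <= Q 0 i j)
  (Q_sum : forall h, `|h| <= r -> forall i, \sum_j Q h i j = 1).
Hypotheses (q_gt0 : forall k i z, 0 < q k i z 0)
  (q_meas : forall k i, measurable_fun setT (q k i ^~ 0)).
Hypothesis pi_close : forall i,
  majorized (Z := Z) r (fun _ h => pi h i / pi 0 i - 1) (fun=> dl).
Hypothesis Q_close : forall i j,
  majorized (Z := Z) r (fun _ h => Q h i j / Q 0 i j - 1) (fun=> dl).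
Hypothesis q_close : forall k i,
  majorized r (fun z h => q k i z h / q k i z 0 - 1) (fun=> dl).

Let F z h := forward (pi h) (Q h) (fun k i => q k i z h).
Let B z h := block (pi h) (Q h) (fun k i => q k i z h).

Let norm0 : `|0 : 'rV[R]_N| <= r. Proof. by rewrite normr0. Qed.
Let dl1 : dl < 1. Proof. exact: le_lt_trans dlt t1. Qed.
Let pi0_gt0 i : 0 < pi 0 i. Proof. exact: lt_le_trans (pi_ge i). Qed.
Let Q0_gt0 i j : 0 < Q 0 i j. Proof. exact: lt_le_trans (Q_ge i j). Qed.
Let Q0_le1 i j : Q 0 i j <= 1.
Proof.
rewrite -(Q_sum norm0 i) (bigD1 j)//= lerDl sumr_ge0// => k _; exact: ltW.
Qed.
Let eps1 : eps <= 1. Proof. exact: le_trans (Q_ge i0 i0) (Q0_le1 i0 i0). Qed.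

Lemma initial_gt0 (z : Z) h i : `|h| <= r -> 0 < pi h i.
Proof.
move=> hr.
exact: (ratio_gt0 (f := fun _ h => pi h i) (fo := fun=> pi 0 i) (z := z)
  (pi_close i) dl1 (pi0_gt0 i) hr).
Qed.

Lemma transition_gt0 (z : Z) h i j : `|h| <= r -> 0 < Q h i j.
Proof.
move=> hr; exact: (ratio_gt0 (f := fun _ h => Q h i j) (fo := fun=> Q 0 i j) (z := z)
  (Q_close i j) dl1 (Q0_gt0 i j) hr).
Qed.

Lemma emission_gt0 k i z h : `|h| <= r -> 0 < q k i z h.
Proof. by move=> hr; apply: (ratio_gt0 (q_close k i)). Qed.

Lemma forward_near_gt0 z h s m i : `|h| <= r -> 0 < F z h s m i.
Proof.
move=> hr; apply: forward_gt0 => // *.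
- exact: initial_gt0.
- exact: transition_gt0.
- exact: emission_gt0.
Qed.

Lemma block_near_gt0 z h s m : `|h| <= r -> 0 < B z h s m.
Proof. by move=> hr; apply: (sum_ord_gt0 i0) => i; exact: forward_near_gt0. Qed.

Lemma measurable_forward s m i : measurable_fun setT (fun z => F z 0 s m i).
Proof.
elim: m i => [|m IH] i; first exact: measurable_cst.
rewrite /F; under eq_fun do rewrite forwardS.
apply: measurable_sum => j; apply: measurable_funM => //.
exact: measurable_funM (IH j) (q_meas _ j).
Qed.

Lemma measurable_block s m : measurable_fun setT (fun z => B z 0 s m).
Proof. by apply: measurable_sum => i; exact: measurable_forward. Qed.

Lemma initial_majorized i : majorized (Z := Z) r (fun _ h => pi h i) (fun=> (1 + dl) * pi 0 i).
Proof.
apply: (majorized_of_ratio (f := fun _ h => pi h i) (fo := fun=> pi 0 i)) => //.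
Qed.

Lemma transition_majorized i j :
  majorized (Z := Z) r (fun _ h => Q h i j) (fun=> (1 + dl) * Q 0 i j).
Proof.
apply: (majorized_of_ratio (f := fun _ h => Q h i j) (fo := fun=> Q 0 i j)) => //.
Qed.

Lemma emission_majorized k i : majorized r (q k i) (fun z => (1 + dl) * q k i z 0).
Proof. exact: (majorized_of_ratio (f := q k i)). Qed.

(** Each output costs two factors 1 + dl, for its emission and its transition; the initial law costs
    one more. *)
Lemma forward_majorized s m i :
  majorized r (fun z h => F z h s m i) (fun z => (1 + dl) ^+ (2 * m).+1 * F z 0 s m i).
Proof.
elim: m i => [|m IH] i.
  by rewrite muln0 expr1; exact: initial_majorized.
have := majorized_sum (index_enum 'I_l) r0
   (fun j => majorizedM r0 (majorizedM r0 (IH j) (emission_majorized (s + m) j))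
      (transition_majorized j i)).
apply: majorized_le => z; rewrite /F forwardS mulr_sumr le_eqVlt; apply/orP; left; apply/eqP.
apply: eq_bigr => j _; rewrite mulnS !exprS; ring.
Qed.

Lemma block_majorized s m :
  majorized r (fun z h => B z h s m) (fun z => (1 + dl) ^+ (2 * m).+1 * B z 0 s m).
Proof.
have := majorized_sum (index_enum 'I_l) r0 (forward_majorized s m).
by apply: majorized_le => z; rewrite mulr_sumr.
Qed.

(** The filter at h = 0: the conditional law of the state at time s + m given the outputs s, ..., s
    + m. *)
Let nu z s m i := F z 0 s m i * q (s + m)%N i z 0 /
  \sum_k F z 0 s m k * q (s + m)%N k z 0.

(* The part of the update that is common to all the states is put in the
   scalar [scal]; what remains is contracted by the factor 1 - eps. *)
Fixpoint scal z h s m : R := if m is m'.+1 then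
  scal z h s m' * (1 + eps * \sum_i nu z s m' i *
     (F z h s m' i / F z 0 s m' i / scal z h s m' - 1)) else 1.

Let E z h s m i := F z h s m i / F z 0 s m i / scal z h s m - 1.

Let nu_den_gt0 z s m : 0 < \sum_k F z 0 s m k * q (s + m)%N k z 0.
Proof. by apply: (sum_ord_gt0 i0) => k; rewrite mulr_gt0// forward_near_gt0. Qed.

Let nu_ge0 z s m i : 0 <= nu z s m i.
Proof. by rewrite /nu divr_ge0 ?mulr_ge0 ?ltW// forward_near_gt0. Qed.

Let nu_sum z s m : \sum_i nu z s m i = 1.
Proof. by rewrite /nu -mulr_suml divff// lt0r_neq0. Qed.

Let nu_meas s m i : measurable_fun setT (fun z => nu z s m i).
Proof.
apply: measurable_funM; first exact: measurable_funM (measurable_forward _ _ _) (q_meas _ _).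
apply: measurable_fun_inv => //.
by apply: measurable_sum => k; exact: measurable_funM (measurable_forward _ _ _) (q_meas _ _).
Qed.

(** The backward kernel at h = 0: the conditional law of the state at time s + m given the state j
    at time s + m + 1 and the outputs s, ..., s + m. *)
Let K z s m i j := F z 0 s m i * q (s + m)%N i z 0 * Q 0 i j / F z 0 s m.+1 j.

(** Doeblin's minorization: the numerator of [K] contains [Q 0 i j] >= eps, while [Q 0] <= 1 bounds
    its denominator by that of [nu]. *)
Let K_ge z s m i j : eps * nu z s m i <= K z s m i j.
Proof.
have Fm := forward_near_gt0 z s m i norm0; have Fm1 := forward_near_gt0 z s m.+1 j norm0.
rewrite /nu /K mulrCA -[leRHS]mulrA ler_wpM2l//; first by rewrite mulr_ge0 ?ltW.
rewrite ler_pM ?(ltW eps0) ?invr_ge0 ?(ltW (nu_den_gt0 _ _ _))// lef_pV2 ?posrE//.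
rewrite /F forwardS; apply: ler_sum => k _; rewrite ler_piMr//.
by rewrite mulr_ge0 ?ltW//; exact: forward_near_gt0.
Qed.

Let K_sum z s m j : \sum_i K z s m i j = 1.
Proof. by rewrite /K -mulr_suml divff// lt0r_neq0//; exact: (forward_near_gt0 z s m.+1 j). Qed.

Let K_meas s m i j : measurable_fun setT (fun z => K z s m i j).
Proof.
apply: measurable_funM.
  by apply: measurable_funM => //; exact: measurable_funM (measurable_forward _ _ _) (q_meas _ _).
by apply: measurable_fun_inv; [exact: measurable_forward|move=> z; exact: forward_near_gt0].
Qed.

Let eta k i j z h := (1 + (q k i z h / q k i z 0 - 1)) * (1 + (Q h i j / Q 0 i j - 1)) - 1.

Let eta_maj k i j : majorized r (eta k i j) (fun=> (1 + dl) ^+ 2 - 1).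
Proof.
have h1 := majorizedD r0 (majorizedD r0 (q_close k i) (Q_close i j))
  (majorizedM r0 (q_close k i) (Q_close i j)).
apply: majorized_ext (majorized_le _ h1) => [z h _|z].
  by rewrite /eta; ring.
by rewrite le_eqVlt; apply/orP; left; apply/eqP; ring.
Qed.

Let c z h s m := eps * \sum_i nu z s m i * E z h s m i.

(** The ratio of the new forward variables is the [K]-average of (1 + E)(1 + eta). In its linear
    part [eps * nu] may be taken out of [K], since the piece removed is [c], which does not depend
    on [j] and is what the scalar absorbs. The kernel that remains is nonnegative of mass 1 -
    eps. *)
Let E_rec z h s m j : `|h| <= r -> 0 < scal z h s m -> 0 < 1 + c z h s m ->
  E z h s m.+1 j = (\sum_i K z s m i j * ((1 + E z h s m i) * eta (s + m) i j z h) +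
    \sum_i (K z s m i j - eps * nu z s m i) * E z h s m i) * (1 + c z h s m)^-1.
Proof.
move=> hr s0 c0.
have H : F z h s m.+1 j / F z 0 s m.+1 j / scal z h s m =
    \sum_i K z s m i j * ((1 + E z h s m i) * (1 + eta (s + m) i j z h)).
  rewrite {1}/F forwardS !mulr_suml; apply: eq_bigr => i _.
  rewrite /K /E /eta !(addrC 1) !subrK -/(F z h s m).
  have := lt0r_neq0 (forward_near_gt0 z s m i norm0).
  have := lt0r_neq0 (forward_near_gt0 z s m.+1 j norm0).
  have := lt0r_neq0 s0; have := lt0r_neq0 (q_gt0 (s + m) i z); have := lt0r_neq0 (Q0_gt0 i j).
  by move=> *; field; do ![apply/andP; split].
rewrite {1}/E /= -/(c z h s m) invfM mulrA H.
have -> : \sum_i K z s m i j * ((1 + E z h s m i) * (1 + eta (s + m) i j z h)) =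
   1 + c z h s m + (\sum_i K z s m i j * ((1 + E z h s m i) * eta (s + m) i j z h) +
    \sum_i (K z s m i j - eps * nu z s m i) * E z h s m i).
  rewrite -[X in _ = X + _ + _](K_sum z s m j) /c mulr_sumr -!big_split/=; apply: eq_bigr => i _.
  by ring.
by rewrite mulrDl divff ?lt0r_neq0// addrAC subrr add0r.
Qed.

Let c_maj s m : (forall i, majorized r (fun z h => E z h s m i) (fun=> t)) ->
  majorized r (fun z h => c z h s m) (fun=> eps * t).
Proof.
move=> Et.
have := majorized_scale r0 (measurable_cst eps) (majorized_sum (index_enum 'I_l) r0
   (fun i => majorized_scale r0 (nu_meas s m i) (Et i))).
apply: majorized_le => z; rewrite gtr0_norm// ler_wpM2l ?(ltW eps0)//.
by rewrite -mulr_suml; under eq_bigr do rewrite ger0_norm//; rewrite nu_sum mul1r.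
Qed.

Let epst : eps * t < 1.
Proof. by rewrite (le_lt_trans _ t1)// ler_piMl// ltW. Qed.

Let c_gt0 s m z h : (forall i, majorized r (fun z h => E z h s m i) (fun=> t)) ->
  `|h| <= r -> 0 < 1 + c z h s m.
Proof.
move=> Et hr; have := majorized_bound z (c_maj Et) hr.
by rewrite ler_norml => /andP[+ _]; move: epst; lra.
Qed.

Lemma filter_error_majorized s m : (forall z h, `|h| <= r -> 0 < scal z h s m) /\
  forall i, majorized r (fun z h => E z h s m i) (fun=> t).
Proof.
elim: m => [|m [s0 Et]].
  split=> [//|i]; apply: majorized_ext (majorized_le _ (pi_close i)) => // z h _.
  by rewrite /E /= divr1.
split=> [z h hr|j].
  by rewrite /= mulr_gt0//; [exact: s0|exact: c_gt0].
have h1 := majorized_sum (index_enum 'I_l) r0 (fun i => majorized_scale r0 (K_meas s m i j)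
  (majorizedM r0 (majorized_1p r0 (Et i)) (eta_maj (s + m) i j))).
have h2 := majorized_sum (index_enum 'I_l) r0 (fun i => majorized_scale r0
  (measurable_funB (K_meas s m i j) (measurable_funM (measurable_cst eps) (nu_meas s m i))) (Et i)).
have h3 := majorized_inv1p r0 (c_maj Et) (fun=> epst).
apply: majorized_ext (majorized_le _ (majorizedM r0 (majorizedD r0 h1 h2) h3)).
  by move=> z h hr /=; rewrite -E_rec//; [exact: s0|exact: c_gt0].
move=> z /=; rewrite -!mulr_suml.
rewrite (eq_bigr (fun i => K z s m i j)); last first.
  move=> i _; rewrite ger0_norm// (le_trans _ (K_ge z s m i j))// mulr_ge0//.
  exact: ltW.
rewrite K_sum mul1r (eq_bigr (fun i => K z s m i j - eps * nu z s m i)); last first.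
  by move=> i _ /=; rewrite ger0_norm// subr_ge0; exact: K_ge.
(* The mass 1 - eps of the reduced kernel appears; with the denominator cleared, what is left is
   [step]. *)
rewrite sumrB K_sum -mulr_sumr nu_sum mulr1 ler_pdivrMr ?subr_gt0//.
Qed.

Let ka : R := (1 - t)^-1.
Let ka_gt0 : 0 < ka. Proof. by rewrite invr_gt0 subr_gt0. Qed.

Let kaE : (1 - eps * t)^-1 <= ka.
Proof.
rewrite lef_pV2 ?posrE ?subr_gt0//.
by rewrite lerD2l lerN2 ler_piMl// ltW.
Qed.

Let scal_gt0 s m z h : `|h| <= r -> 0 < scal z h s m.
Proof. by case: (filter_error_majorized s m) => H _; exact: H. Qed.

Let Et s m i : majorized r (fun z h => E z h s m i) (fun=> t).
Proof. by case: (filter_error_majorized s m). Qed.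

Let scal_inv_maj s m : majorized r (fun z h => (scal z h s m)^-1) (fun=> ka ^+ m).
Proof.
elim: m => [|m IH].
  by apply: majorized_ext (majorized_le _ (majorized1 r0)) => [z h _ /=|z]; rewrite ?invr1.
have h := majorizedM r0 IH (majorized_inv1p r0 (c_maj (Et s m)) (fun=> epst)).
apply: majorized_ext (majorized_le _ h) => [z h' _ /=|z]; first by rewrite invfM.
by rewrite exprSr ler_wpM2l// exprn_ge0// ltW.
Qed.

(** The mean of the errors under the law, at h = 0, of the state at time s + m given the outputs
    before s + m. As a mean it inherits the majorant [t] for every m. *)
Let g z h s m := \sum_i F z 0 s m i / B z 0 s m * E z h s m i.

Let g_maj s m : majorized r (fun z h => g z h s m) (fun=> t).
Proof.
have mB i : measurable_fun setT (fun z => F z 0 s m i / B z 0 s m).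
  apply: measurable_funM; first exact: measurable_forward.
  by apply: measurable_fun_inv; [exact: measurable_block|move=> z; exact: block_near_gt0].
have := majorized_sum (index_enum 'I_l) r0 (fun i => majorized_scale r0 (mB i) (Et s m i)).
apply: majorized_le => z; rewrite -mulr_suml ler_piMl ?(ltW t0)//.
under eq_bigr do rewrite ger0_norm ?divr_ge0 ?ltW ?forward_near_gt0 ?block_near_gt0//.
by rewrite -mulr_suml -/(B z 0 s m) divff// lt0r_neq0// block_near_gt0.
Qed.

Let BE z h s m : `|h| <= r -> B z h s m = B z 0 s m * scal z h s m * (1 + g z h s m).
Proof.
move=> hr; have s0 := lt0r_neq0 (scal_gt0 s m z hr).
have B0 := lt0r_neq0 (block_near_gt0 z s m norm0).
have -> : 1 = \sum_i F z 0 s m i / B z 0 s m by rewrite -mulr_suml divff.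
rewrite /g -big_split/= mulr_sumr; apply: eq_bigr => i _.
rewrite /E -/(F z h) ; have := lt0r_neq0 (forward_near_gt0 z s m i norm0) => F0.
by rewrite -/(F z h s m i); field; do ![apply/andP; split].
Qed.

Let g_gt0 z h s m : `|h| <= r -> 0 < 1 + g z h s m.
Proof.
move=> hr; have := majorized_bound z (g_maj s m) hr.
by rewrite ler_norml => /andP[+ _]; move: t1; lra.
Qed.

(** One factor 1 / (1 - t) for each of the m factors of [scal], and one for 1 + g. *)
Lemma inv_block_majorized s m :
  majorized r (fun z h => (B z h s m)^-1) (fun z => ka ^+ m.+1 / B z 0 s m).
Proof.
have mB : measurable_fun setT (fun z => (B z 0 s m)^-1).
  by apply: measurable_fun_inv; [exact: measurable_block|move=> z; exact: block_near_gt0].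
have H := majorizedM r0 (majorized_scale r0 mB (scal_inv_maj s m))
  (majorized_inv1p r0 (g_maj s m) (fun=> t1)).
apply: majorized_ext (majorized_le _ H) => [z h hr|z].
  by rewrite (BE z s m hr) !invfM.
rewrite gtr0_norm ?invr_gt0 ?block_near_gt0// -mulrA -exprSr mulrC.
by [].
Qed.

Let la : R := t / (1 - t).
Let la_ge0 : 0 <= la.
Proof. by rewrite /la divr_ge0 ?subr_ge0; [|exact: ltW|exact: ltW]. Qed.

Let lnB z h s m : `|h| <= r ->
  ln (B z h s m) = ln (B z 0 s m) + ln (scal z h s m) + ln (1 + g z h s m).
Proof.
move=> hr; rewrite BE// !lnM ?posrE ?mulr_gt0 ?block_near_gt0 ?scal_gt0 ?g_gt0//.
Qed.

(** The logarithm of [scal] is a sum of m terms whose majorants would add up, but only the last one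
    enters an increment. The three logarithms that remain, two of 1 + g and one of 1 + c, have
    majorants at most [la]. *)
Lemma ln_block_increment_majorized s m : majorized r (fun z h =>
  ln (B z h s m.+1) - ln (B z h s m) -
  (ln (B z 0 s m.+1) - ln (B z 0 s m))) (fun=> 3 * la).
Proof.
have h1 := majorized_ln1p r0 (g_maj s m.+1) (fun=> t1).
have h2 := majorized_ln1p r0 (c_maj (Et s m)) (fun=> epst).
have h3 := majorized_ln1p r0 (g_maj s m) (fun=> t1).
apply: majorized_ext (majorized_le _ (majorizedB r0 (majorizedD r0 h1 h2) h3)).
  move=> z h hr; rewrite (lnB z s m.+1 hr) (lnB z s m hr) /=.
  have cg : 0 < 1 + c z h s m by apply: c_gt0 => // i; exact: Et.
  rewrite lnM ?posrE ?scal_gt0//.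
  by rewrite /c; ring.
move=> z; have : eps * t / (1 - eps * t) <= la.
  apply: ler_pM => //; first by rewrite mulr_ge0 ?ltW.
    by rewrite invr_ge0 subr_ge0 ltW.
  by rewrite ler_piMl// ltW.
by rewrite -/la; lra.
Qed.

Let QQ_maj p i k j : majorized (Z := Z) r (fun _ h => Q h p i * Q h k j - Q 0 p i * Q 0 k j)
  (fun=> ((1 + dl) ^+ 2 - 1) * (Q 0 p i * Q 0 k j)).
Proof.
have h1 := majorizedD r0 (majorizedD r0 (Q_close p i) (Q_close k j))
  (majorizedM r0 (Q_close p i) (Q_close k j)).
have h2 := majorized_scale r0 (measurable_cst (Q 0 p i * Q 0 k j)) h1.
apply: majorized_ext (majorized_le _ h2) => [z h _ /=|z].
  by field; rewrite !lt0r_neq0.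
by rewrite /= gtr0_norm ?mulr_gt0// le_eqVlt; apply/orP; left; apply/eqP; ring.
Qed.

(** At h = 0 the two products lie between eps^2 and 1, so their difference is at most 1 - eps^2
    times their sum. The perturbation adds (1 + dl)^2 - 1 times that sum. *)
Lemma minor_majorized p i k j :
  majorized (Z := Z) r (fun _ h => Q h p i * Q h k j + -1 * (Q h p j * Q h k i))
  (fun=> ((1 + dl) ^+ 2 - eps ^+ 2) * (Q 0 p i * Q 0 k j + 1 * (Q 0 p j * Q 0 k i))).
Proof.
have h1 := majorizedB r0 (QQ_maj p i k j) (QQ_maj p j k i).
have h2 := majorizedD r0 h1 (majorized_const (Q 0 p i * Q 0 k j - Q 0 p j * Q 0 k i) r0).
apply: majorized_ext (majorized_le _ h2) => [z h _|z]; first by ring.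
have lo a b a' b' : eps ^+ 2 <= Q 0 a b * Q 0 a' b'.
  by rewrite expr2 ler_pM// ltW.
have hi a b a' b' : Q 0 a b * Q 0 a' b' <= 1.
  by rewrite mulr_ile1// ltW.
have := lo p i k j; have := lo p j k i; have := hi p i k j; have := hi p j k i.
set A := Q 0 p i * Q 0 k j; set A' := Q 0 p j * Q 0 k i => h3 h4 h5 h6.
suff : `|A - A'| <= (1 - eps ^+ 2) * (A + A') by lra.
have e2 : 0 <= eps ^+ 2 by rewrite exprn_ge0// ltW.
by rewrite ler_norml; apply/andP; split; nra.
Qed.

(** The cost of one output for the minors, relative to the permanents at h = 0: (1 + dl)^2 for two
    emissions, and the factor of [minor_majorized] for the transition. *)
Let sig : R := (1 + dl) ^+ 2 * ((1 + dl) ^+ 2 - eps ^+ 2).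

Let sig_ge0 : 0 <= sig.
Proof.
rewrite /sig mulr_ge0 ?exprn_ge0 ?subr_ge0 ?addr_ge0//.
rewrite lerXn2r ?nnegrE ?addr_ge0 ?(ltW eps0)//.
by apply: le_trans eps1 _; rewrite lerDl.
Qed.

Let W e z h s m i j := wedge e (pi h) (Q h) (fun k i => q k i z h) s m i j.

(** The permanents at h = 0 obey the recursion of the minors with plus signs, hence with positive
    terms only, so they can carry the majorant through the induction. The factor (1 + dl)^4 is (1 +
    dl)^3 for a forward vector after one output times 1 + dl for the initial law. *)
Lemma wedge_majorized s m i j : majorized r (fun z h => W (-1) z h s m i j)
  (fun z => (1 + dl) ^+ 4 * sig ^+ m * W 1 z 0 s m i j).
Proof.
elim: m i j => [|m IH] i j.
  have h := majorizedB r0 (majorizedM r0 (forward_majorized s 1 i) (forward_majorized s.+1 0 j))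
    (majorizedM r0 (forward_majorized s 1 j) (forward_majorized s.+1 0 i)).
  apply: majorized_ext (majorized_le _ h) => [z h' _|z].
    by rewrite /W /wedge -!/(F _ _ _ _ _); ring.
  rewrite le_eqVlt; apply/orP; left; apply/eqP.
  by rewrite /W /wedge -!/(F _ _ _ _ _) ; ring.
have h := majorized_scale r0 (measurable_cst (2^-1 : R))
  (majorized_sum (index_enum 'I_l) r0 (fun p => majorized_sum (index_enum 'I_l) r0
  (fun k => majorizedM r0 (majorizedM r0 (IH p k)
     (majorizedM r0 (emission_majorized (s + m.+1) p) (emission_majorized (s + m.+1) k)))
     (minor_majorized p i k j)))).
apply: majorized_ext (majorized_le _ h) => [z h' _|z].
  by rewrite /W wedgeS// mulrNN mulr1.
rewrite gtr0_norm ?invr_gt0// le_eqVlt; apply/orP; left; apply/eqP.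
rewrite /W wedgeS ?mulr1// [RHS]mulrCA; congr (_ * _).
rewrite mulr_sumr; apply: eq_bigr => p _; rewrite mulr_sumr; apply: eq_bigr => k _.
rewrite [sig ^+ m.+1]exprS; set S := sig ^+ m; rewrite /sig; ring.
Qed.

Let X z h s m := B z h s m.+2 * B z h s.+1 m / (B z h s m.+1 * B z h s.+1 m.+1) - 1.

Let C2 : R := (1 + dl) ^+ 5 * (eps^-1 + 1) * ka ^+ 4.
Let tau : R := sig * ka ^+ 2.

Let tau_ge0 : 0 <= tau. Proof. by rewrite mulr_ge0// exprn_ge0// ltW. Qed.
Let C2_gt0 : 0 < C2.
Proof.
have dl_gt0 : 0 < 1 + dl by rewrite ltr_pwDl.
apply: mulr_gt0; last exact: exprn_gt0.
by apply: mulr_gt0; [exact: exprn_gt0|rewrite addr_gt0// invr_gt0].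
Qed.

Let swap z s m : eps * (B z 0 s m.+2 * B z 0 s.+1 m) <=
    B z 0 s m.+1 * B z 0 s.+1 m.+1 /\
  eps * (B z 0 s m.+1 * B z 0 s.+1 m.+1) <= B z 0 s m.+2 * B z 0 s.+1 m.
Proof.
apply: block_swap => //.
- exact: ltW.
- by move=> i; exact: ltW.
- by move=> i; rewrite pi_sum mulr1.
- by move=> i j; exact: ltW.
- exact: Q_sum.
- by move=> k i; exact: ltW.
Qed.

(** [sum_wedge] serves twice: with e = -1 for the numerator, with e = 1 to sum the permanents at h =
    0 into P + P', where P' is the denominator at h = 0 and P <= P' / eps by [swap]. Hence the
    factor eps^-1 + 1 of [C2]; the powers of [ka] come from the two inverse blocks. *)
Lemma cross_ratio_majorized s m : majorized r (fun z h => X z h s m) (fun=> C2 * tau ^+ m).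
Proof.
have h1 := majorized_sum (index_enum 'I_l) r0 (fun i =>
  majorized_sum (index_enum 'I_l) r0 (fun j =>
    majorizedM r0 (wedge_majorized s m i j) (emission_majorized (s + m.+1) i))).
have h2 := majorizedM r0 h1
  (majorizedM r0 (inv_block_majorized s m.+1) (inv_block_majorized s.+1 m.+1)).
apply: majorized_ext (majorized_le _ h2) => [z h hr|z].
  rewrite /W (sum_wedge _ _ _ _ _ (Q_sum hr)) -!/(B _ _ _ _) /X.
  have := lt0r_neq0 (block_near_gt0 z s m.+1 hr); have := lt0r_neq0 (block_near_gt0 z s.+1 m.+1 hr).
  by move=> *; field; do ![apply/andP; split].
have -> : \sum_i \sum_j (1 + dl) ^+ 4 * sig ^+ m * W 1 z 0 s m i j *
    ((1 + dl) * q (s + m.+1)%N i z 0) = (1 + dl) ^+ 5 * sig ^+ m *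
    (B z 0 s m.+2 * B z 0 s.+1 m + B z 0 s m.+1 * B z 0 s.+1 m.+1).
  have <- : \sum_i \sum_j W 1 z 0 s m i j * q (s + m.+1)%N i z 0 =
      B z 0 s m.+2 * B z 0 s.+1 m + B z 0 s m.+1 * B z 0 s.+1 m.+1.
    by rewrite /W (sum_wedge _ _ _ _ _ (Q_sum norm0)) mul1r.
  rewrite mulr_sumr.
  apply: eq_bigr => i _; rewrite mulr_sumr; apply: eq_bigr => j _.
  by rewrite /W; ring.
have B1 := block_near_gt0 z s m.+1 norm0; have B2 := block_near_gt0 z s.+1 m.+1 norm0.
set b := B z 0 s m.+1; set b' := B z 0 s.+1 m.+1.
have -> : ka ^+ m.+2 / b * (ka ^+ m.+2 / b') = ka ^+ 4 * ka ^+ 2 ^+ m * (b * b')^-1.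
  rewrite exprAC (exprD _ 2 m) invfM.
  by ring.
rewrite /tau [(sig * _) ^+ m]exprMn /C2.
have -> : (1 + dl) ^+ 5 * (eps^-1 + 1) * ka ^+ 4 * (sig ^+ m * ka ^+ 2 ^+ m) =
  (1 + dl) ^+ 5 * sig ^+ m * (ka ^+ 4 * ka ^+ 2 ^+ m) * (eps^-1 + 1) by ring.
rewrite [leLHS]mulrACA ler_wpM2l//.
  rewrite mulr_ge0 ?mulr_ge0 ?exprn_ge0 ?addr_ge0 ?(ltW ka_gt0)//.
rewrite ler_pdivrMr ?mulr_gt0// mulrDl mul1r lerD2r ler_pdivlMl//.
exact: (swap z s m).1.
Qed.

Let D z h s m := ln (B z h s m.+2) + ln (B z h s.+1 m) -
  ln (B z h s m.+1) - ln (B z h s.+1 m.+1).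

Let D_ln z h s m : `|h| <= r -> D z h s m = ln (1 + X z h s m).
Proof.
move=> hr; rewrite /X addrC subrK lnM ?posrE ?mulr_gt0 ?invr_gt0 ?mulr_gt0 ?block_near_gt0//.
by rewrite lnV ?posrE ?mulr_gt0 ?block_near_gt0// !lnM ?posrE ?block_near_gt0// /D opprD addrA.
Qed.

Lemma log_cross_ratio_bound z s m : `|D z 0 s m| <= - ln eps.
Proof.
have [s1 s2] := swap z s m.
set P := B z 0 s m.+2 * B z 0 s.+1 m in s1 s2.
set P' := B z 0 s m.+1 * B z 0 s.+1 m.+1 in s1 s2.
have P0 : 0 < P by rewrite mulr_gt0// block_near_gt0.
have P0' : 0 < P' by rewrite mulr_gt0// block_near_gt0.
have -> : D z 0 s m = ln P - ln P'.
  by rewrite !lnM ?posrE ?block_near_gt0// /D opprD addrA.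
have [e1 e2] : 0 < eps * P /\ 0 < eps * P' by split; exact: mulr_gt0.
have s3 : ln (eps * P) <= ln P' by rewrite ler_ln ?posrE.
have s4 : ln (eps * P') <= ln P by rewrite ler_ln ?posrE.
move: s3 s4; rewrite [ln (eps * P)]lnM ?posrE// [ln (eps * P')]lnM ?posrE// => s3 s4.
by rewrite ler_norml; apply/andP; split; lra.
Qed.

Let M0 : R := - ln eps + 6 * la.

(** A majorant independent of m, for the short blocks: at h = 0 the value is at most -ln eps, and
    two increments of majorant [3 * la] account for the dependence on h. *)
Let D_maj1 s m : majorized r (fun z h => D z h s m) (fun=> M0).
Proof.
have mD : measurable_fun setT (fun z => D z 0 s m).
  have mln k n : measurable_fun setT (fun z => ln (B z 0 k n)).
    by apply: measurableT_comp => //; exact: measurable_block.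
  apply: measurable_funB => //; apply: measurable_funB => //.
  exact: measurable_funD.
have h := majorizedD r0 (majorized_cst r0 mD)
  (majorizedB r0 (ln_block_increment_majorized s m.+1) (ln_block_increment_majorized s.+1 m)).
apply: majorized_ext (majorized_le _ h) => [z h' _|z].
  by rewrite /D; ring.
by have := log_cross_ratio_bound z s m; rewrite /M0; lra.
Qed.

Let C3 : R := 2 * C2 * Num.max 1 M0.

(** If y = C2 * tau^m is at most 1/2, the series of ln (1 + X) converges and y / (1 - y) <= 2 y.
    Otherwise 2 y > 1 and the uniform majorant [M0] suffices. [C3] covers both cases. *)
Lemma log_cross_ratio_majorized s m : majorized r (fun z h => D z h s m) (fun=> C3 * tau ^+ m).
Proof.
have tm : 0 <= tau ^+ m by rewrite exprn_ge0.
have [small|large] := leP (C2 * tau ^+ m) 2^-1.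
  have X1 : C2 * tau ^+ m < 1 by apply: le_lt_trans small _; lra.
  have h := majorized_ln1p r0 (cross_ratio_majorized s m) (fun=> X1).
  apply: majorized_ext (majorized_le _ h) => [z h' hr|z]; first by rewrite D_ln.
  rewrite ler_pdivrMr ?subr_gt0// /C3.
  set y := C2 * tau ^+ m in small *.
  have -> : 2 * C2 * Num.max 1 M0 * tau ^+ m = 2 * Num.max 1 M0 * y by rewrite /y; ring.
  have y0 : 0 <= y by rewrite /y mulr_ge0// ltW.
  have mx : 1 <= Num.max 1 M0 by rewrite le_max lexx.
  set a := Num.max 1 M0 in mx *.
  have : 0 <= (a - 1) * (y * (1 - y)).
    by rewrite mulr_ge0 ?subr_ge0// mulr_ge0// subr_ge0 ltW.
  by nra.
apply: majorized_le (D_maj1 s m) => z.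
have mx : M0 <= Num.max 1 M0 by rewrite le_max lexx orbT.
have mx1 : 1 <= Num.max 1 M0 by rewrite le_max lexx.
have -> : C3 * tau ^+ m = 2 * Num.max 1 M0 * (C2 * tau ^+ m) by rewrite /C3; ring.
by nra.
Qed.

Lemma block_log_cross_ratio_majorized s m : majorized r (fun z h => B z h s m.+2 * D z h s m)
  (fun z => (1 + dl) ^+ 5 * C3 * ((1 + dl) ^+ 2 ^+ 2 * ((1 + dl) ^+ 2 - eps ^+ 2) *
      ((1 - t)^-1) ^+ 2) ^+ m * B z 0 s m.+2).
Proof.
have h := majorizedM r0 (block_majorized s m.+2) (log_cross_ratio_majorized s m).
apply: majorized_le h => z; rewrite le_eqVlt; apply/orP; left; apply/eqP.
(* The density of m + 2 outputs costs (1 + dl)^(2 (m + 2) + 1): a constant (1 + dl)^5, and (1 +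
   dl)^2 per unit of m, which multiplies [tau]. *)
have -> : (2 * m.+2).+1 = (5 + 2 * m)%N by rewrite !mulnS.
rewrite exprD exprM.
have -> : (1 + dl) ^+ 2 ^+ 2 * ((1 + dl) ^+ 2 - eps ^+ 2) * ((1 - t)^-1) ^+ 2 =
  (1 + dl) ^+ 2 * tau by rewrite /tau /sig /ka; ring.
by rewrite [((1 + dl) ^+ 2 * tau) ^+ m]exprMn; ring.
Qed.

End closeness.

(** * Output densities and the entropy rate *)

Section measure_extra.
Context {R : realType} {d : measure_display} {T : measurableType d}.

Lemma measure_finite_partition (mu : {measure set T -> \bar R}) (I : finType)
    (E : set T) (F : I -> set T) : measurable E -> (forall i, measurable (F i)) ->
  (forall w, exists i, F i w) -> (forall i j w, F i w -> F j w -> i = j) ->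
  mu E = (\sum_i mu (F i `&` E))%E.
Proof.
move=> mE mF cF dF.
have key (s : seq I) : uniq s ->
    mu (\big[setU/set0]_(i <- s) (F i `&` E)) = (\sum_(i <- s) mu (F i `&` E))%E.
  elim: s => [|i s IH]; first by rewrite !big_nil measure0.
  move=> /= /andP[is_ us]; rewrite !big_cons.
  transitivity (mu (F i `&` E) + mu (\big[setU/set0]_(i <- s) (F i `&` E)))%E.
  apply: measureU.
  - exact: measurableI.
  - by apply: bigsetU_measurable => j _; exact: measurableI.
  - apply/seteqP; split=> // w [[Fi _]]; rewrite -bigcup_seq => -[j /= js [Fj _]].
    by move: is_; rewrite (dF _ _ _ Fi Fj) js.
  by rewrite IH.
rewrite -key ?index_enum_uniq//; congr (mu _).
rewrite -bigcup_seq; apply/seteqP; split=> w.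
  by move=> Ew; have [i Fi] := cF w; exists i => //=; exact: mem_index_enum.
by move=> [i _ []].
Qed.

Section density.
Variables (mu : {measure set T -> \bar R}) (p : T -> R).
Hypotheses (mp : measurable_fun setT p) (p0 : forall x, 0 <= p x).

Let dens A := (\int[mu]_(x in A) (p x)%:E)%E.
Let dens0 : dens set0 = 0%E. Proof. exact: integral_set0. Qed.
Let dens_ge0 A : (0 <= dens A)%E.
Proof. by apply: integral_ge0 => x _; rewrite lee_fin. Qed.
Let dens_sigma : semi_sigma_additive dens.
Proof.
move=> F mF tF mUF; apply: cvg_toP.
  by apply: is_cvg_nneseries => n _ _; exact: dens_ge0.
rewrite /dens ge0_integral_bigcup//.
  by apply/measurable_EFinP; exact: measurable_funTS.
by move=> x _; rewrite lee_fin.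
Qed.

HB.instance Definition _ := isMeasure.Build _ _ _ dens dens0 dens_ge0 dens_sigma.

Lemma density_measure : exists nu : {measure set T -> \bar R},
  forall A, nu A = (\int[mu]_(x in A) (p x)%:E)%E.
Proof. by exists dens. Qed.

End density.

(** [p] agrees almost everywhere with the Radon-Nikodym derivative, as both have the same integrals
    over measurable sets. The identity holds for every measurable [g] because positive and negative
    parts are treated separately. *)
Lemma integral_density (mu : {sigma_finite_measure set T -> \bar R})
    (nu : {finite_measure set T -> \bar R}) (p : T -> R) :
  measurable_fun setT p -> (forall x, 0 <= p x) ->
  (forall A, measurable A -> nu A = \int[mu]_(x in A) (p x)%:E)%E ->
  forall g : T -> R, measurable_fun setT g ->
  (\int[nu]_x (g x)%:E = \int[mu]_x (g x * p x)%:E)%E.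
Proof.
move=> mp p0 nup g mg.
have numu : nu `<< mu.
  apply/null_content_dominatesP => A mA A0; rewrite nup//.
  by rewrite null_set_integral//; apply/measurable_EFinP; exact: measurable_funTS.
have RNp : ae_eq mu setT (Radon_Nikodym_SigmaFinite.f nu mu) (EFin \o p).
  apply: integral_ae_eq => //.
  - exact: Radon_Nikodym_SigmaFinite.f_integrable.
  - exact/measurable_EFinP.
  - by move=> E _ mE; rewrite -Radon_Nikodym_SigmaFinite.f_integral// nup.
have mRN : measurable_fun setT (Radon_Nikodym_SigmaFinite.f nu mu).
  by have /integrableP[] := Radon_Nikodym_SigmaFinite.f_integrable numu.
have key (f : T -> R) : measurable_fun setT f -> (forall x, 0 <= f x) ->
    (\int[nu]_x (f x)%:E = \int[mu]_x (f x * p x)%:E)%E.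
  move=> mf f0.
  rewrite -(Radon_Nikodym_SigmaFinite.change_of_variables numu)//; last exact/measurable_EFinP.
  apply: ae_eq_integral => //.
  - by apply: emeasurable_funM => //; exact/measurable_EFinP.
  - by apply/measurable_EFinP; exact: measurable_funM.
  - have := ae_eqe_mul2l (EFin \o f) RNp; apply: filterS => x /= H xT.
    by rewrite H.
rewrite integralE [RHS]integralE.
have pE x : ((fun x => (g x)%:E)^\+ x = (Num.max (g x) 0)%:E)%E.
  by rewrite funeposE EFin_max.
have nE x : ((fun x => (g x)%:E)^\- x = (Num.max (- g x) 0)%:E)%E.
  by rewrite funenegE EFin_max.
under eq_integral do rewrite pE; under [X in (_ - X)%E]eq_integral do rewrite nE.
rewrite !key.
- congr (_ - _)%E; apply: eq_integral => x _.
    by rewrite funeposE -EFin_max maxr_pMl// mul0r.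
  by rewrite funenegE -EFinN -EFin_max maxr_pMl// mul0r mulNr.
- by apply: measurable_maxr => //; exact: measurable_funN.
- by move=> x; rewrite le_max lexx orbT.
- by apply: measurable_maxr.
- by move=> x; rewrite le_max lexx orbT.
Qed.

End measure_extra.

Section tuple_measures.
Context {R : realType}.
Local Notation RR := (measurableTypeR R).

Definition box n (A : 'I_n -> set RR) : set (n.-tuple RR) :=
  [set t | forall i, A i (tnth t i)].

Lemma measurable_box n (A : 'I_n -> set RR) : (forall i, measurable (A i)) ->
  measurable (box A).
Proof.
move=> mA; rewrite (_ : box A = \bigcap_(i in [set: 'I_n])
    ((fun t : n.-tuple RR => tnth t i) @^-1` A i)).
  apply: fin_bigcap_measurable => // i _.
  by rewrite -[X in measurable X]setTI; exact: measurable_tnth.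
by apply/seteqP; split=> t Bt i //=; exact: Bt.
Qed.

Lemma tuple_measure_unique n (m1 m2 : {measure set (n.-tuple RR) -> \bar R}) :
  (m1 setT < +oo)%E ->
  (forall A : 'I_n -> set RR, (forall i, measurable (A i)) -> m1 (box A) = m2 (box A)) ->
  forall A, measurable A -> m1 A = m2 A.
Proof.
move=> m1T m12 A mA.
pose G := [set B | exists2 A : 'I_n -> set RR, (forall i, measurable (A i)) & B = box A].
have GT : G setT.
  by exists (fun=> setT) => //; apply/seteqP; split.
apply: (measure_unique G (fun=> setT)) => //.
- apply/seteqP; split.
    apply: smallest_sub; first exact: smallest_sigma_algebra.
    rewrite -bigcup_seq/=; apply: bigcup_sub => i _ _ [B mB <-].
    apply: sub_sigma_algebra; exists (fun j => if j == i then B else setT).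
      by move=> j; case: ifP.
    apply/seteqP; split=> t /=.
      by move=> [_ Bt] j; case: eqP => [->|].
    by move=> /(_ i); rewrite eqxx.
  apply: smallest_sub; first exact: sigma_algebra_measurable.
  by move=> _ [B mB ->]; exact: measurable_box.
- move=> _ _ [B mB ->] [C mC ->]; exists (fun i => B i `&` C i).
    by move=> i; exact: measurableI.
  by apply/seteqP; split=> t; [move=> [H1 H2] i; split|move=> H; split=> i; case: (H i)].
- by rewrite bigcup_const.
- by move=> _ [B mB ->]; exact: m12.
Qed.

Lemma integral_tuple_prod n (g : 'I_n -> RR -> R) :
  (forall i, measurable_fun setT (g i)) -> (forall i x, 0 <= g i x) ->
  (\int[lebesgue_tuple n]_t (\prod_(i < n) g i (tnth t i))%:E =
   \prod_(i < n) \int[lebesgue_measure]_x (g i x)%:E)%E.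
Proof.
elim: n g => [|n IH] g mg g0.
  rewrite big_ord0 /=; under eq_integral do rewrite big_ord0.
  by rewrite integral_cst//= mul1e diracE mem_set.
have mprod m (f : 'I_m -> RR -> R) : (forall i, measurable_fun setT (f i)) ->
    measurable_fun setT (fun t : m.-tuple RR => \prod_(i < m) f i (tnth t i)).
  move=> mf; apply: measurable_prod => i _.
  exact: measurableT_comp (mf i) (measurable_tnth i).
have p0 m (f : 'I_m -> RR -> R) (t : m.-tuple RR) : (forall i x, 0 <= f i x) ->
    0 <= \prod_(i < m) f i (tnth t i).
  by move=> f0; apply: prodr_ge0.
transitivity (\int[(lebesgue_measure \x lebesgue_tuple n)%E]_xt
   (\prod_(i < n.+1) g i (tnth (cons_pair xt) i))%:E)%E.
  apply: (@ge0_integral_pushforward _ _ _ _ R _ (measurable_cons_pair (n:=n))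
    (lebesgue_measure \x lebesgue_tuple n)%E setT
    (fun t => (\prod_(i < n.+1) g i (tnth t i))%:E)) => //.
  - by apply/measurable_EFinP; exact: (mprod _ _ mg).
  - by move=> t _; rewrite lee_fin; apply: prodr_ge0 => i _; exact: g0.
rewrite fubini_tonelli1//; last 2 first.
- apply/measurable_EFinP.
  exact: measurableT_comp (mprod _ _ mg) (@measurable_cons_pair _ n).
- by move=> t; rewrite lee_fin; apply: prodr_ge0 => i _; exact: g0.
rewrite /fubini_F /=.
rewrite big_ord_recl.
have E x (t : n.-tuple RR) : \prod_(i < n.+1) g i (tnth (cons_pair (x, t)) i) =
    g ord0 x * \prod_(i < n) g (lift ord0 i) (tnth t i).
  by rewrite big_ord_recl; congr (_ * _); apply: eq_bigr => i _; rewrite tnthS.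
under eq_integral => x _.
  under eq_integral do rewrite E EFinM.
  rewrite ge0_integralZl_EFin//; last 2 first.
  - by move=> t _; rewrite lee_fin; apply: prodr_ge0 => i _; exact: g0.
  - apply/measurable_EFinP; apply: (mprod _ (fun i => g (lift ord0 i))) => i.
    exact: mg.
  over.
rewrite ge0_integralZr//.
- congr (_ * _)%E; apply: (IH (fun i => g (lift ord0 i))) => [i|i x]; [exact: mg|exact: g0].
- exact/measurable_EFinP.
- by move=> x _; rewrite lee_fin.
- apply: integral_ge0 => t _; rewrite lee_fin; apply: prodr_ge0 => i _; exact: g0.
Qed.

End tuple_measures.

Section hidden_markov_law.
Context {R : realType} {l : nat} {d : measure_display} {T : measurableType d}.
Variables (P : probability T R) (Pi : 'M[R]_l) (q : 'I_l -> R -> R).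
Variables (Y : int -> T -> 'I_l) (Z : int -> T -> R).
Local Notation RR := (measurableTypeR R).
Hypotheses (Pi_stochastic : stochastic_mx Pi)
  (hmm : hidden_markov_chain P Pi q Y Z)
  (mq : forall i, measurable_fun setT (q i : RR -> R))
  (q0 : forall i x, 0 <= q i x).

Definition path_weight n (y : n.-tuple 'I_l) : R := fine (P (path_event Y 0 y)).

Definition initial_law (i : 'I_l) : R := path_weight [tuple i].

Definition output_block k n (w : T) : n.-tuple RR := [tuple Z (k + i%:Z) w | i < n].

Definition output_density n (t : n.-tuple RR) : R :=
  \sum_(y : n.-tuple 'I_l) path_weight y * \prod_(i < n) q (tnth y i) (tnth t i).

Lemma measurable_path_event k n (y : n.-tuple 'I_l) : measurable (path_event Y k y).
Proof.
have [mY _ _] := hmm.1.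
rewrite (_ : path_event Y k y = \bigcap_(i in [set: 'I_n])
    (Y (k + i%:Z) @^-1` [set tnth y i])).
  by apply: fin_bigcap_measurable.
by apply/seteqP; split=> w H i //=; exact: H.
Qed.

Lemma path_weight_ge0 n (y : n.-tuple 'I_l) : 0 <= path_weight y.
Proof. by rewrite /path_weight fine_ge0. Qed.

Lemma path_eventE k n (y : n.-tuple 'I_l) : P (path_event Y k y) = (path_weight y)%:E.
Proof.
have [_ sY _] := hmm.1.
by rewrite sY /path_weight fineK// fin_num_measure//; exact: measurable_path_event.
Qed.

Lemma path_weight_rcons n (y : n.+1.-tuple 'I_l) j :
  path_weight [tuple of rcons y j] = path_weight y * Pi (tnth y ord_max) j.
Proof.
have [_ _ mkY] := hmm.1; apply: EFin_inj.
by rewrite -(path_eventE 0) mkY path_eventE EFinM.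
Qed.

Lemma measurable_output_block k n : measurable_fun setT (@output_block k n).
Proof.
apply/measurable_fun_tnthP => i.
rewrite (_ : _ \o _ = Z (k + i%:Z)); first exact: (output_measurable hmm.2).
by apply/funext => w /=; rewrite tnth_mktuple.
Qed.

Lemma path_partition k n (E : set T) : measurable E ->
  P E = (\sum_(y : n.-tuple 'I_l) P (path_event Y k y `&` E))%E.
Proof.
move=> mE; apply: (measure_finite_partition _ mE (F := fun y => path_event Y k y)).
- by move=> y; exact: measurable_path_event.
- by move=> w; exists [tuple Y (k + i%:Z) w | i < n] => i; rewrite tnth_mktuple.
- by move=> y y' w H H'; apply: eq_from_tnth => i; rewrite -H -H'.
Qed.

Lemma measurable_output_density n : measurable_fun setT (@output_density n).
Proof.
apply: measurable_sum => y; apply: measurable_funM => //.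
apply: measurable_prod => i _.
exact: measurableT_comp (mq _) (measurable_tnth i).
Qed.

Lemma output_density_ge0 n (t : n.-tuple RR) : 0 <= output_density t.
Proof.
apply: sumr_ge0 => y _; rewrite mulr_ge0 ?path_weight_ge0//.
by apply: prodr_ge0 => i _; exact: q0.
Qed.

Lemma integral_box_prod n (f : 'I_n -> RR -> R) (A : 'I_n -> set RR) :
  (forall i, measurable_fun setT (f i)) -> (forall i x, 0 <= f i x) ->
  (forall i, measurable (A i)) ->
  (\int[lebesgue_tuple n]_(t in box A) (\prod_(i < n) f i (tnth t i))%:E =
   \prod_(i < n) \int[lebesgue_measure]_(x in A i) (f i x)%:E)%E.
Proof.
move=> mf f0 mA.
transitivity (\int[lebesgue_tuple n]_t (\prod_(i < n) (f i \_ (A i)) (tnth t i))%:E)%E.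
  rewrite integral_mkcond; apply: eq_integral => t _; rewrite patchE.
  case: ifPn => [|]; rewrite ?inE ?notin_setE => tA.
    by congr EFin; apply: eq_bigr => i _; rewrite patchE mem_set//; exact: tA.
  have [i Ai] : exists i, ~ A i (tnth t i) by apply/existsNP.
  by rewrite (bigD1 i)//= patchE memNset// mul0r.
rewrite (integral_tuple_prod (g := fun i => f i \_ (A i))).
- apply: eq_bigr => i _; rewrite [RHS]integral_mkcond; apply: eq_integral => x _.
  by rewrite !patchE; case: ifP.
- by move=> i; apply/(measurable_restrictT _ (mA i)); exact: measurable_funTS.
- by move=> i x; rewrite patchE; case: ifP.
Qed.

(** Two finite measures that agree on boxes are equal. On a box, the event is partitioned by the
    input path, given which the law of the outputs factorizes. *)
Lemma output_block_law k n (A : set (n.-tuple RR)) : measurable A ->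
  P (output_block k n @^-1` A) = (\int[lebesgue_tuple n]_(t in A) (output_density t)%:E)%E.
Proof.
move=> mA.
have [nu nuE] := density_measure (lebesgue_tuple n)
  (@measurable_output_density n) (@output_density_ge0 n).
pose X : {mfun T >-> n.-tuple RR} :=
  HB.pack (@output_block k n) (isMeasurableFun.Build _ _ _ _ _ (@measurable_output_block k n)).
rewrite -nuE -[LHS]/(distribution P X A).
apply: tuple_measure_unique mA.
  by rewrite -ge0_fin_numE// fin_num_measure.
move=> B mB; rewrite nuE.
have mE : measurable (output_block k n @^-1` box B).
  by rewrite -[X in measurable X]setTI; apply: measurable_output_block => //; exact: measurable_box.
rewrite -[LHS]/(P (output_block k n @^-1` box B)) (path_partition k n mE).
rewrite /output_density; under eq_integral do rewrite -sumEFin.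
rewrite ge0_integral_sum//; last 3 first.
- exact: measurable_box.
- move=> y; apply/measurable_EFinP; apply: measurable_funM => //; apply: measurable_funTS.
  apply: measurable_prod => i _.
  exact: measurableT_comp (mq _) (measurable_tnth i).
- move=> y t _; rewrite lee_fin mulr_ge0 ?path_weight_ge0//.
  by apply: prodr_ge0 => i _; exact: q0.
apply: eq_bigr => y _.
under eq_integral do rewrite EFinM.
rewrite ge0_integralZl_EFin//; last 4 first.
- exact: measurable_box.
- by move=> t _; rewrite lee_fin; apply: prodr_ge0 => i _; exact: q0.
- apply/measurable_EFinP; apply: measurable_funTS; apply: measurable_prod => i _.
  exact: measurableT_comp (mq _) (measurable_tnth i).
- exact: path_weight_ge0.
rewrite (integral_box_prod (f := fun i => q (tnth y i)))//.
rewrite -(path_eventE k) -(output_law hmm.2)//; congr (P (_ `&` _)).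
by apply/seteqP; split=> w /= H i; have := H i; rewrite tnth_mktuple.
Qed.

Lemma sum_rcons_tuple n (F : n.+1.-tuple 'I_l -> R) :
  \sum_y F y = \sum_(y : n.-tuple 'I_l) \sum_j F [tuple of rcons y j].
Proof.
rewrite pair_big/= (reindex (fun p : n.-tuple 'I_l * 'I_l => [tuple of rcons p.1 p.2]))//=.
exists (fun y => ([tuple tnth y (widen_ord (leqnSn n) i) | i < n], tnth y ord_max)).
  move=> [y j] _; congr pair.
    apply: eq_from_tnth => i; rewrite tnth_mktuple !(tnth_nth j)/= nth_rcons.
    by rewrite size_tuple ltn_ord.
  by rewrite (tnth_nth j)/= nth_rcons size_tuple ltnn eqxx.
move=> y _; apply: eq_from_tnth => i; set j := tnth y ord_max.
rewrite (tnth_nth j)/= nth_rcons size_tuple card_ord; case: ltngtP => [i_n|ni|i_n].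
- transitivity (tnth [tuple tnth y (widen_ord (leqnSn n) i) | i < n] (Ordinal i_n)).
    by rewrite (tnth_nth j).
  by rewrite tnth_mktuple !(tnth_nth j).
- by have := ltn_ord i; rewrite ltnS leqNgt ni.
- by rewrite /j; congr tnth; apply: val_inj.
Qed.

(** The last coordinate of [y] is a state whose output has not been emitted yet; hence paths of
    length n + 1 with only n emission factors. *)
Lemma forward_paths n (x : nat -> R) j :
  forward initial_law Pi (fun k i => q i (x k)) 0 n j =
  \sum_(y : n.+1.-tuple 'I_l | tnth y ord_max == j)
     path_weight y * \prod_(i < n) q (tnth y (widen_ord (leqnSn n) i)) (x i).
Proof.
elim: n j => [|n IH] j.
  rewrite /= (big_pred1 [tuple j]).
    by rewrite big_ord0 mulr1.
  move=> y; rewrite (tnth_nth j) /=; apply/eqP/eqP => [<-|->//].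
  by apply: val_inj; case: y => -[|a [|b s]] sz.
rewrite forwardS [RHS]big_mkcond sum_rcons_tuple.
under eq_bigr do rewrite IH.
under eq_bigr do rewrite -mulrA mulr_suml.
rewrite (exchange_big_dep xpredT)//=; apply: eq_bigr => y _.
rewrite (big_pred1 (tnth y ord_max)); last by move=> i; rewrite eq_sym.
have lastE j' : tnth [tuple of rcons y j'] ord_max = j'.
  by rewrite (tnth_nth j') /= nth_rcons size_tuple ltnn eqxx.
under [RHS]eq_bigr do rewrite lastE.
rewrite -big_mkcond big_pred1_eq path_weight_rcons.
rewrite [in RHS]big_ord_recr /=.
have tE (i : 'I_n.+1) j' : tnth [tuple of rcons y j'] (widen_ord (leqnSn n.+1) i) = tnth y i.
  by rewrite !(tnth_nth j') /= nth_rcons size_tuple ltn_ord.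
rewrite tE add0n.
have -> : \prod_(i < n) q (tnth [tuple of rcons y j]
    (widen_ord (leqnSn n.+1) (widen_ord (leqnSn n) i))) (x i) =
  \prod_(i < n) q (tnth y (widen_ord (leqnSn n) i)) (x i).
  by apply: eq_bigr => i _; rewrite tE.
by ring.
Qed.

Lemma output_density_block n (t : n.+1.-tuple RR) :
  output_density t = block initial_law Pi (fun k i => q i (nth 0 t k)) 0 n.+1.
Proof.
rewrite blockS; last exact: Pi_stochastic.2.
under [RHS]eq_bigr do rewrite forward_paths mulr_suml.
rewrite (exchange_big_dep xpredT)//=; apply: eq_bigr => y _.
rewrite (big_pred1 (tnth y ord_max)); last by move=> i; rewrite eq_sym.
rewrite big_ord_recr /= -mulrA add0n; congr (_ * (_ * _)); last by rewrite (tnth_nth 0).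
by apply: eq_bigr => i _; rewrite (tnth_nth 0).
Qed.

Lemma initial_law_sum : \sum_i initial_law i = 1.
Proof.
apply: EFin_inj; rewrite -sumEFin.
rewrite -(probability_setT P) (@path_partition 0 1 setT measurableT).
under [RHS]eq_bigr do rewrite setIT path_eventE.
rewrite (reindex (fun i : 'I_l => [tuple i]))//.
exists (fun y => tnth y ord0) => [i _|y _]; first by rewrite tnth0.
by apply: val_inj; case: y => -[|a [|b s]] sz.
Qed.

(** The Markov property gives the law of (Y_0, Y_1); summing over Y_0 leaves the event Y_1 = j,
    which by stationarity has the probability of Y_0 = j. *)
Lemma initial_law_stationary j : \sum_i initial_law i * Pi i j = initial_law j.
Proof.
have [mY _ _] := hmm.1.
apply: EFin_inj; rewrite -sumEFin -[RHS](path_eventE 1).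
rewrite (@path_partition 0 1 (path_event Y 1 [tuple j])); last exact: measurable_path_event.
rewrite (reindex (fun i : 'I_l => [tuple i])) /=; last first.
  exists (fun y => tnth y ord0) => [i _|y _]; first by rewrite tnth0.
  by apply: val_inj; case: y => -[|a [|b s]] sz.
apply: eq_bigr => i _.
have := path_weight_rcons [tuple i] j; rewrite (tnth_nth j)/= => <-.
rewrite -(path_eventE 0); congr (P _); apply/seteqP; split=> w /=.
  move=> H; split=> k; rewrite ord1 (tnth_nth j)/=.
    by have := H ord0; rewrite (tnth_nth j).
  by have := H (lift ord0 ord0); rewrite (tnth_nth j).
move=> [H0 H1] k; rewrite (tnth_nth j) /=.
case: k => -[|[|//]] kn /=.
  by have := H0 ord0; rewrite (tnth_nth j).
by have := H1 ord0; rewrite (tnth_nth j).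
Qed.

Lemma initial_law_ge0 i : 0 <= initial_law i.
Proof. exact: path_weight_ge0. Qed.

End hidden_markov_law.

Section forward_shift.
Context {R : realFieldType} {l : nat}.
Implicit Types (pi : 'I_l -> R) (Q : 'I_l -> 'I_l -> R) (f : nat -> 'I_l -> R).

Lemma forward_ext pi Q f f' s m : (forall k, (k < m)%N -> f (s + k)%N = f' (s + k)%N) ->
  forward pi Q f s m = forward pi Q f' s m.
Proof.
elim: m => [//|m IH] H; apply/funext => j; rewrite !forwardS.
by apply: eq_bigr => i _; rewrite H// IH// => k km; rewrite H// ltnS ltnW.
Qed.

Lemma forward_shift pi Q f s m :
  forward pi Q f s m = forward pi Q (fun k => f (s + k)%N) 0 m.
Proof.
by elim: m => [//|m IH]; apply/funext => j; rewrite !forwardS IH.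
Qed.

Lemma block_ext pi Q f f' s m : (forall k, (k < m)%N -> f (s + k)%N = f' (s + k)%N) ->
  block pi Q f s m = block pi Q f' s m.
Proof. by move=> H; rewrite /block (forward_ext pi Q H). Qed.

Lemma block_shift pi Q f s m :
  block pi Q f s m = block pi Q (fun k => f (s + k)%N) 0 m.
Proof. by rewrite /block forward_shift. Qed.

End forward_shift.

Section log_block.
Context {R : realType} {l : nat}.
Variables (pi : 'I_l -> R) (Pi : 'I_l -> 'I_l -> R) (q : 'I_l -> R -> R).

Definition log_block s m (x : nat -> R) : R := ln (block pi Pi (fun k i => q i (x k)) s m).

Definition log_ratio s m (x : nat -> R) : R := log_block s m.+2 x + log_block s.+1 m x -
  log_block s m.+1 x - log_block s.+1 m.+1 x.

Lemma log_block_ext s m x x' : (forall k, (k < m)%N -> x (s + k)%N = x' (s + k)%N) ->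
  log_block s m x = log_block s m x'.
Proof.
move=> H; congr ln; apply: block_ext => k km.
by apply/funext => i; rewrite H.
Qed.

Lemma log_block_shift s m x : log_block s m x = log_block 0 m (fun k => x (s + k)%N).
Proof. by rewrite /log_block block_shift. Qed.

Lemma log_ratio_ext m x x' : (forall k, (k < m.+2)%N -> x k = x' k) ->
  log_ratio 0 m x = log_ratio 0 m x'.
Proof.
move=> H; rewrite /log_ratio.
rewrite (@log_block_ext 0 m.+2 x x')//.
rewrite (@log_block_ext 1 m x x'); last first.
  by move=> k km; rewrite H// add1n !ltnS ltnW.
rewrite (@log_block_ext 0 m.+1 x x'); last first.
  by move=> k km; rewrite add0n H// ltnW.
by rewrite (@log_block_ext 1 m.+1 x x')// => k km; rewrite add1n H.
Qed.

Lemma log_ratio_shift s m x : log_ratio s m x = log_ratio 0 m (fun k => x (s + k)%N).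
Proof.
rewrite /log_ratio !(log_block_shift s) !(log_block_shift s.+1) !(log_block_shift 1).
rewrite (_ : (fun k => x (s.+1 + k)%N) = (fun k => x (s + (1 + k))%N))//.
by apply/funext => k; rewrite addSnnS.
Qed.

End log_block.

Lemma integral_distribution_any {R : realType} d1 d2 (X : measurableType d1)
    (X' : measurableType d2) (P : probability X R) (phi : {mfun X >-> X'})
    (f : X' -> \bar R) : measurable_fun setT f ->
  (\int[distribution P phi]_y f y = \int[P]_x f (phi x))%E.
Proof.
move=> mf; have mphi : measurable_fun setT phi by exact: measurable_funPT.
rewrite [LHS]integralE [RHS]integralE.
have H1 := ge0_integral_pushforward mphi P measurableT (measurable_funepos mf)
   ltac:(by move=> y _; exact: funepos_ge0).
have H2 := ge0_integral_pushforward mphi P measurableT (measurable_funeneg mf)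
   ltac:(by move=> y _; exact: funeneg_ge0).
rewrite /distribution H1 H2 preimage_setT.
congr (_ - _)%E; apply: eq_integral => x _ /=.
  by rewrite !funeposE.
by rewrite !funenegE.
Qed.

(** * The entropy rate as a series of second differences *)

Section entropy_limit.
Context {R : realType} {l : nat} {d : measure_display} {T : measurableType d}.
Variables (P : probability T R) (Pi : 'M[R]_l) (q : 'I_l -> R -> R).
Variables (Y : int -> T -> 'I_l) (Z : int -> T -> R).
Local Notation RR := (measurableTypeR R).
Hypotheses (Pi_stochastic : stochastic_mx Pi)
  (hmm : hidden_markov_chain P Pi q Y Z)
  (mq : forall i, measurable_fun setT (q i : RR -> R))
  (q0 : forall i x, 0 <= q i x).

Let pi := initial_law P Y.
Local Notation dens n := (@output_density R l d T P q Y n%N).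
Let logb := log_block pi Pi q.
Let logr := log_ratio pi Pi q.
Let path w : nat -> R := fun k => Z k%:Z w.

Variables (C tau : R).
Hypotheses (tau0 : 0 <= tau) (tau1 : tau < 1)
  (logr_bound : forall m x, `|logr 0 m x| <= C * tau ^+ m)
  (int_dens1 : (lebesgue_tuple 1).-integrable setT
     (fun t => (dens 1 t * ln (dens 1 t))%:E)).

Let mblock k n : measurable_fun setT (@output_block R d T Z k n).
Proof. exact: (measurable_output_block hmm). Qed.

Lemma expectation_output k n (G : n.-tuple RR -> R) : measurable_fun setT G ->
  (\int[P]_w (G (output_block Z k n w))%:E =
   \int[lebesgue_tuple n]_t (dens n t * G t)%:E)%E.
Proof.
move=> mG.
pose X : {mfun T >-> n.-tuple RR} := HB.pack (@output_block _ _ _ Z k n)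
  (isMeasurableFun.Build _ _ _ _ _ (@mblock k n)).
have -> : (\int[P]_w (G (output_block Z k n w))%:E = \int[distribution P X]_t (G t)%:E)%E.
  rewrite integral_distribution_any//.
  exact/measurable_EFinP.
rewrite (@integral_density _ _ _ (lebesgue_tuple n) _ (dens n)).
- by apply: eq_integral => t _; rewrite mulrC.
- exact: measurable_output_density.
- by move=> t; exact: output_density_ge0.
- by move=> A mA; apply: (output_block_law hmm mq q0).
- exact: mG.
Qed.

Lemma logb_dens s n w : logb s n.+1 (path w) = ln (dens n.+1 (output_block Z s%:Z n.+1 w)).
Proof.
rewrite /logb log_block_shift /log_block (output_density_block Pi_stochastic hmm).
congr ln; apply: block_ext => k kn; apply/funext => i.
rewrite add0n /path -[k in RHS]/(nat_of_ord (Ordinal kn)) -tnth_nth tnth_mktuple/=.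
by rewrite PoszD.
Qed.

Lemma logb0 s x : logb s 0 x = 0.
Proof. by rewrite /logb /log_block /block /= (initial_law_sum hmm) ln1. Qed.

Lemma measurable_ln_dens n : measurable_fun setT (fun t => ln (dens n t)).
Proof. by apply: measurableT_comp => //; exact: measurable_output_density. Qed.

Lemma measurable_logb s n : measurable_fun setT (fun w => logb s n (path w)).
Proof.
case: n => [|n].
  by under eq_fun do rewrite logb0; exact: measurable_cst.
under eq_fun do rewrite logb_dens.
exact: measurableT_comp (@measurable_ln_dens n.+1) (@mblock _ _).
Qed.

(** Integrability is known for one output. It passes to longer blocks by induction on two
    consecutive lengths, because the second difference [logr] is bounded. *)
Lemma integrable_logb s n : P.-integrable setT (fun w => (logb s n (path w))%:E).
Proof.
suff H : forall s, P.-integrable setT (fun w => (logb s n (path w))%:E) /\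
   P.-integrable setT (fun w => (logb s n.+1 (path w))%:E) by case: (H s).
elim: n {s} => [|n IH] s.
  split; first by under eq_fun do rewrite logb0; exact: integrable0.
  apply/integrableP; split; first by apply/measurable_EFinP; exact: measurable_logb.
  under eq_integral do rewrite logb_dens abse_EFin.
  rewrite (expectation_output s (G := fun t => `|ln (dens 1 t)|)); last first.
    by apply: measurableT_comp => //; exact: measurable_ln_dens.
  have /integrableP[_] := int_dens1; apply: le_lt_trans.
  rewrite le_eqVlt; apply/orP; left; apply/eqP; apply: eq_integral => t _.
  by rewrite abse_EFin normrM (ger0_norm (output_density_ge0 _ _ _ _)).
have [Is Is1] := IH s; have [Js Js1] := IH s.+1.
split; first by [].
have E w : (logb s n.+2 (path w))%:E = ((EFin \o (fun w => logr s n (path w))) w +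
   ((EFin \o (fun w => logb s n.+1 (path w))) w + ((EFin \o (fun w => logb s.+1 n.+1 (path w))) w -
   (EFin \o (fun w => logb s.+1 n (path w))) w)))%E.
  rewrite /= -EFinB -!EFinD; congr EFin; rewrite /logr /log_ratio -/logb; ring.
under eq_fun do rewrite E.
apply: integrableD => //; last by apply: integrableD => //; exact: integrableB.
apply: (@le_integrable _ _ _ P _ _ _ (cst (C * tau ^+ n)%:E)) => //.
- apply/measurable_EFinP.
  apply: measurable_funB; last exact: measurable_logb.
  apply: measurable_funB; last exact: measurable_logb.
  by apply: measurable_funD; exact: measurable_logb.
- move=> w _ /=; rewrite lee_fin (le_trans _ (ler_norm _))//.
  by rewrite /logr log_ratio_shift; exact: logr_bound.
- by apply: finite_measure_integrable_cst.
Qed.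

(** Minus the entropy of n outputs, as an expectation on [T], where blocks with different starting
    times can be compared. *)
Let c n : R := \int[P]_w logb 0 n (path w).

Lemma expectation_logb s n : \int[P]_w logb s n (path w) = c n.
Proof.
case: n => [|n]; first by rewrite /c; apply: eq_Rintegral => w _; rewrite !logb0.
rewrite /c /Rintegral; congr fine.
under eq_integral do rewrite logb_dens; under [RHS]eq_integral do rewrite logb_dens.
by rewrite !(expectation_output _ (G := fun t => ln (dens n.+1 t)))//; exact: measurable_ln_dens.
Qed.

Definition first_entropy : R := \int[lebesgue_tuple 1]_t (dens 1 t * ln (dens 1 t)).

Definition ratio_entropy m : R :=
  \int[lebesgue_tuple m.+2]_t (dens m.+2 t * logr 0 m (nth 0 t)).

Lemma expected_log_block0 : c 0 = 0.
Proof.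
rewrite /c; under eq_Rintegral do rewrite logb0.
by rewrite Rintegral_cst// mul0r.
Qed.

Lemma expected_log_block1 : c 1 = first_entropy.
Proof.
rewrite /c /first_entropy /Rintegral; congr fine.
under eq_integral do rewrite logb_dens.
by rewrite (expectation_output 0 (G := fun t => ln (dens 1 t)))//; exact: measurable_ln_dens.
Qed.

Lemma logr_block m w :
  logr 0 m (path w) = logr 0 m (nth 0 (output_block Z 0 m.+2 w)).
Proof.
apply: log_ratio_ext => k km.
rewrite -[k in RHS]/(nat_of_ord (Ordinal km)) -tnth_nth tnth_mktuple/=.
by rewrite add0r.
Qed.

Lemma measurable_logr_nth m (n : nat) :
  measurable_fun setT (fun t : n.-tuple RR => logr 0 m (nth 0 t)).
Proof.
have mb s k : measurable_fun setT (fun t : n.-tuple RR => logb s k (nth 0 t)).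
  apply: measurableT_comp => //; apply: measurable_sum => i.
  elim: k i => [|k IH] i; first exact: measurable_cst.
  under eq_fun do rewrite forwardS.
  apply: measurable_sum => j; apply: measurable_funM => //.
  apply: measurable_funM; first exact: IH.
  apply: measurableT_comp (mq j) _.
  have [kn|kn] := ltnP (s + k) n.
    under eq_fun do rewrite -[(s + k)%N]/(nat_of_ord (Ordinal kn)) -tnth_nth.
    exact: measurable_tnth.
  under eq_fun do rewrite nth_default ?size_tuple//.
  exact: measurable_cst.
apply: measurable_funB => //; apply: measurable_funB => //.
exact: measurable_funD.
Qed.

(** By stationarity two of the four blocks may be started at time 1 instead of 0, which makes the
    integrand [logr 0 m]. *)
Lemma expected_log_block_second_difference m : c m.+2 + c m - c m.+1 - c m.+1 = ratio_entropy m.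
Proof.
rewrite -(expectation_logb 1 m) -{2}(expectation_logb 1 m.+1) /c.
rewrite -RintegralD//; [|exact: integrable_logb|exact: integrable_logb].
rewrite -RintegralB//; last exact: integrable_logb; last first.
  exact: (integrable_realD (integrable_logb _ _) (integrable_logb _ _)).
rewrite -RintegralB//; last exact: integrable_logb; last first.
  have H := integrableB measurableT
    (integrable_realD (integrable_logb 0 m.+2) (integrable_logb 1 m)) (integrable_logb 0 m.+1).
  exact: H.
transitivity (\int[P]_w logr 0 m (path w)); first by apply: eq_Rintegral.
rewrite /ratio_entropy /Rintegral; congr fine.
under eq_integral do rewrite logr_block.
rewrite (expectation_output 0 (G := fun t => logr 0 m (nth 0 t)))//.
exact: measurable_logr_nth.
Qed.

Lemma ratio_entropy_le m : `|ratio_entropy m| <= C * tau ^+ m.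
Proof.
have -> : ratio_entropy m = \int[P]_w logr 0 m (path w).
  rewrite /ratio_entropy /Rintegral; congr fine.
  under [RHS]eq_integral do rewrite logr_block.
  rewrite (expectation_output 0 (G := fun t => logr 0 m (nth 0 t)))//.
  exact: measurable_logr_nth.
have mr : measurable_fun setT (fun w => logr 0 m (path w)).
  under eq_fun do rewrite logr_block.
  exact: measurableT_comp (measurable_logr_nth m (n:=m.+2)) (@mblock _ _).
have Ir : P.-integrable setT (EFin \o (fun w => logr 0 m (path w))).
  apply: (@le_integrable _ _ _ P _ _ _ (cst (C * tau ^+ m)%:E)) => //.
  - exact/measurable_EFinP.
  - by move=> w _ /=; rewrite lee_fin (le_trans _ (ler_norm _))//; exact: logr_bound.
  - exact: finite_measure_integrable_cst.
apply: le_trans (le_normr_Rintegral measurableT Ir) _.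
have <- : \int[P]_w (C * tau ^+ m) = C * tau ^+ m.
  transitivity (C * tau ^+ m * fine (P setT)); first exact: Rintegral_cst.
  by rewrite probability_setT mulr1.
apply: le_Rintegral => //.
- by have := integrable_abse Ir.
- exact: finite_measure_integrable_cst.
Qed.

Lemma cvg_series_ratio_entropy : cvgn (series ratio_entropy).
Proof.
apply: normed_cvg.
apply: (@series_le_cvg _ (fun m => `|ratio_entropy m|) (fun m => C * tau ^+ m)).
- by move=> m; exact: normr_ge0.
- by move=> m; exact: le_trans (normr_ge0 _) (ratio_entropy_le m).
- exact: ratio_entropy_le.
- by apply: is_cvg_geometric_series; rewrite ger0_norm.
Qed.

Lemma cvg_mean_log_block : (n.+1%:R^-1 * c n.+1) @[n --> \oo] -->
  first_entropy + limn (series ratio_entropy).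
Proof.
(* These first differences are [first_entropy] plus partial sums of the second ones. As [c 0] = 0,
   the quotient of [c n.+1] by n + 1 is their Cesaro mean. *)
pose u k := c k.+1 - c k.
have uE k : u k = first_entropy + series ratio_entropy k.
  elim: k => [|k IH].
    by rewrite /u expected_log_block0 subr0 expected_log_block1 /series /= big_geq// addr0.
  rewrite seriesSr addrA -IH -expected_log_block_second_difference /u; ring.
have cu : u @ \oo --> first_entropy + limn (series ratio_entropy).
  rewrite (_ : u = (fun k => first_entropy + series ratio_entropy k)); last exact/funext.
  by apply: cvgD; [exact: cvg_cst|exact: cvg_series_ratio_entropy].
have := cesaro cu; rewrite (_ : arithmetic_mean u = (fun n => n.+1%:R^-1 * c n.+1))//.
apply/funext => n.
rewrite /arithmetic_mean /= /series /= /u telescope_sumr// expected_log_block0 subr0.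
by [].
Qed.

Lemma normalized_entropy_cvg (p : forall n, n.+1.-tuple RR -> R) :
  (forall n, is_density P (past_block Z n) (p n)) ->
  normalized_entropy p n @[n --> \oo] -->
  (- (first_entropy + limn (series ratio_entropy)))%:E.
Proof.
move=> pd.
have E n : normalized_entropy p n = (- (n.+1%:R^-1 * c n.+1))%:E.
  have [mp p0 pP] := pd n.
  have pbE : past_block Z n = output_block Z (- n%:Z) n.+1.
    by apply/funext => w; apply: eq_from_tnth => i; rewrite !tnth_mktuple addrC.
  (* A density is determined only up to a null set, which the entropy integral does not see. *)
  have aep : ae_eq (lebesgue_tuple n.+1) setT (EFin \o p n) (EFin \o dens n.+1).
    apply: integral_ae_eq => //.
    - apply/integrableP; split; first exact/measurable_EFinP.
      under eq_integral do rewrite /= ger0_norm//.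
      by rewrite -(pP setT measurableT) preimage_setT probability_setT ltry.
    - by apply/measurable_EFinP; exact: measurable_output_density.
    - move=> A _ mA; rewrite -pP// pbE.
      exact: (output_block_law hmm mq q0).
  rewrite /normalized_entropy /differential_entropy.
  have -> : (\int[lebesgue_tuple n.+1]_z (p n z * ln (p n z))%:E =
     \int[lebesgue_tuple n.+1]_z (dens n.+1 z * ln (dens n.+1 z))%:E)%E.
    apply: ae_eq_integral => //.
    - apply/measurable_EFinP; apply: measurable_funM => //.
      exact: measurableT_comp.
    - apply/measurable_EFinP; apply: measurable_funM; first exact: measurable_output_density.
      exact: measurable_ln_dens.
    - apply: filterS aep => z H zT; have [->] := H zT; by [].
  rewrite -(expectation_output 0 (G := fun t => ln (dens n.+1 t))); last exact: measurable_ln_dens.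
  under eq_integral do rewrite -(logb_dens 0).
  rewrite -[X in (- X)%E]fineK ?integrable_fin_num//; last exact: integrable_logb.
  by rewrite -EFinN -EFinM mulrN.
under eq_fun do rewrite E.
apply: cvg_EFin; first exact: nearW.
exact: cvgN cvg_mean_log_block.
Qed.

End entropy_limit.

(** * Analyticity of the stationary law and of the Cauchy density *)

Section radii.
Context {R : realType}.

(** Properties are required for all small radii and not for a single one, so that finitely many of
    them can be met together. *)
Lemma common_radius (I : finType) (A : I -> R -> Prop) :
  (forall i, exists2 r, 0 < r & forall r', 0 < r' <= r -> A i r') ->
  exists2 r, 0 < r & forall i r', 0 < r' <= r -> A i r'.
Proof.
move=> H; pose f i := projT1 (cid2 (H i)).
have f0 i : 0 < f i by rewrite /f; case: cid2.
have fA i r' : 0 < r' <= f i -> A i r' by rewrite /f; case: cid2 => /= x _; apply.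
exists (\big[Num.min/1]_i f i).
  by elim/big_ind: _ => // x y x0 y0; rewrite lt_min x0.
move=> i r' /andP[r'0 r'f]; apply: fA; rewrite r'0/= (le_trans r'f)//.
by rewrite (bigD1 i)//= ge_min lexx.
Qed.

End radii.

Section shrinking.
Context {R : realType} {N : nat} {d : measure_display} {Z : measurableType d}.

Lemma majorized_shrink (f : Z -> 'rV[R]_N -> R) (r M e : R) : 0 < r -> 0 < e ->
  majorized r f (fun=> M) -> exists2 r1, 0 < r1 & forall r', 0 < r' <= r1 ->
  majorized r' (fun z h => f z h - f z 0) (fun=> e).
Proof.
move=> r0 e0 fM.
pose t := Num.min 1 (e / (`|M| + 1)).
have M1 : 0 < `|M| + 1 by rewrite ltr_wpDl.
have t0 : 0 < t by rewrite lt_min ltr01 divr_gt0.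
exists (t * r); first by rewrite mulr_gt0.
move=> r' /andP[r'0 r'r].
have H : majorized (t * r) (fun z h => f z h - f z 0) (fun=> t * M).
  apply: majorized_comp_scale fM; first exact: ltW.
  by rewrite (ltW t0)/= ge_min lexx.
apply: (majorized_radius (r := t * r)); first by rewrite (ltW r'0).
apply: majorized_le H => z.
apply: (@le_trans _ _ (t * (`|M| + 1))).
  by rewrite ler_wpM2l ?(ltW t0)// (le_trans (ler_norm _))// lerDl.
by rewrite -ler_pdivlMr// ge_min lexx orbT.
Qed.

End shrinking.

Section cauchy.
Context {R : realType} {N : nat}.
Local Notation RR := (measurableTypeR R).
Variables (g0 m0 : R) (ig im : 'I_N).
Hypothesis g0_gt0 : 0 < g0.

Let num_aux : (1 + 10^-1) * 2 <= 3 :> R. Proof. by lra. Qed.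

Let q (z : R) (h : 'rV[R]_N) := cauchy_density (g0 + h 0 ig) (m0 + h 0 im) z.

Let s (z : R) := (z - m0) ^+ 2 + g0 ^+ 2.
Let s_gt0 z : 0 < s z. Proof. by rewrite ltr_wpDl ?sqr_ge0// exprn_gt0. Qed.
(** With this radius [g] below has majorant at most 1/10 + 22/100 <= 1/2, and the ratio of the
    scales at most 11/10, so that the ratio of densities is majorized by (11/10) * 2 <= 3. *)
Let r := g0 / 10.
Let r_gt0 : 0 < r. Proof. by rewrite divr_gt0. Qed.

Let measurable_s : measurable_fun setT (s : RR -> R).
Proof.
apply: measurable_funD => //; apply: measurable_funX.
exact: measurable_funB.
Qed.

Let measurable_sV : measurable_fun setT (fun z : RR => (s z)^-1).
Proof. exact: measurable_fun_inv. Qed.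

Let c1 z : R := - (2 * (z - m0)) / s z.
Let c2 z : R := (s z)^-1.

Let measurable_c1 : measurable_fun setT (c1 : RR -> R).
Proof.
apply: measurable_funM => //; apply: measurable_funN; apply: measurable_funM => //.
exact: measurable_funB.
Qed.

(** This is 2 |z - m0| g0 <= (z - m0)^2 + g0^2. It makes the expansion uniform in [z], although the
    numerator of [c1] is unbounded. *)
Let c1_le z : `|c1 z| <= g0^-1.
Proof.
rewrite /c1 normrM normrN normfV (gtr0_norm (s_gt0 z)) ler_pdivrMr//.
rewrite -[leRHS]mulrC ler_pdivlMr// normrM ger0_norm// /s.
have := sqr_ge0 (`|z - m0| - g0); rewrite -[(z - m0) ^+ 2]real_normK ?num_real//.
set a := `|z - m0|; nra.
Qed.

Let c2_le z : `|c2 z| <= (g0 ^+ 2)^-1.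
Proof.
rewrite /c2 gtr0_norm ?invr_gt0// lef_pV2 ?posrE ?exprn_gt0// /s.
by rewrite lerDr sqr_ge0.
Qed.

(** 1 + g is the quotient of the denominators of the Cauchy density at h and at 0. *)
Let g (z : R) (h : 'rV[R]_N) : R := c1 z * h 0 im +
  c2 z * (h 0 im * h 0 im + (2 * g0) * h 0 ig + h 0 ig * h 0 ig).

Let g_maj : majorized (Z := RR) r g (fun=> 2^-1).
Proof.
have r0 := ltW r_gt0.
have hm := majorized_coord (Z := RR) im r0; have hg := majorized_coord (Z := RR) ig r0.
have h1 := majorized_scale r0 measurable_c1 hm.
have h2 := majorized_scale r0 measurable_sV (majorizedD r0 (majorizedD r0 (majorizedM r0 hm hm)
  (majorized_scale r0 (measurable_cst (2 * g0)) hg)) (majorizedM r0 hg hg)).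
apply: majorized_ext (majorized_le _ (majorizedD r0 h1 h2)) => [z h _|z]; first by [].
have a1 : `|c1 z| * r <= 10^-1.
  apply: le_trans (ler_wpM2r r0 (c1_le z)) _.
  by rewrite /r mulrA mulVf ?mul1r// lt0r_neq0.
have a2 : `|(s z)^-1| * (r * r + `|2 * g0| * r + r * r) <= 22 / 100.
  apply: (@le_trans _ _ ((g0 ^+ 2)^-1 * (r * r + `|2 * g0| * r + r * r))).
    have n0 : 0 <= r * r + `|2 * g0| * r + r * r.
      by apply: addr_ge0; [apply: addr_ge0|]; apply: mulr_ge0.
    exact: ler_wpM2r n0 _ _ (c2_le z).
  rewrite gtr0_norm ?mulr_gt0// le_eqVlt; apply/orP; left; apply/eqP.
  by rewrite /r; field; rewrite lt0r_neq0.
rewrite /=; move: a1 a2; lra.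
Qed.

Let scale_gt0 (h : 'rV[R]_N) : `|h| <= r -> 0 < g0 + h 0 ig.
Proof.
move=> hr.
have := le_trans (coord_le_norm h ig) hr.
by rewrite ler_norml /r => /andP[+ _]; move: g0_gt0; lra.
Qed.

Lemma cauchy_ratio_majorized : majorized (Z := RR) r
  (fun z h => q z h / q z 0) (fun=> 3).
Proof.
have r0 := ltW r_gt0.
have h1 := majorized_1p r0 (majorized_scale r0 (measurable_cst g0^-1)
  (majorized_coord (Z := RR) ig r0)).
have g1 : forall z : RR, (2^-1 : R) < 1 by move=> _; lra.
have h2 := majorized_inv1p r0 g_maj g1.
apply: majorized_ext (majorized_le _ (majorizedM r0 h1 h2)) => [z h hr /=|z]; last first.
  rewrite gtr0_norm ?invr_gt0// /r mulrA mulVf ?mul1r ?lt0r_neq0//.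
  have -> : (1 - 2^-1 : R)^-1 = 2 by field.
  exact: num_aux.
have gh := scale_gt0 hr.
rewrite /q /cauchy_density !mxE !addr0 -/(s z).
have s' : 0 < (z - (m0 + h 0 im)) ^+ 2 + (g0 + h 0 ig) ^+ 2.
  by rewrite ltr_wpDl ?sqr_ge0// exprn_gt0.
have E : 1 + g z h = ((z - (m0 + h 0 im)) ^+ 2 + (g0 + h 0 ig) ^+ 2) / s z.
  by rewrite /g /c1 /c2; move: (s_gt0 z); rewrite /s => /lt0r_neq0 sz; field.
rewrite E; move: (lt0r_neq0 (pi_gt0 R)); generalize (@trigo.pi R) => p p0.
by field; rewrite p0 !lt0r_neq0 ?s_gt0.
Qed.

End cauchy.

Section stationary_law.
Context {R : realType} {N l : nat} {d : measure_display} {Z : measurableType d}.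
Variables (r eps : R) (pi : 'rV[R]_N -> 'I_l -> R) (Q : 'rV[R]_N -> 'I_l -> 'I_l -> R).
Hypotheses (r0 : 0 <= r) (eps0 : 0 < eps) (l0 : (0 < l)%N).
Hypotheses (pi_ge0 : forall h i, `|h| <= r -> 0 <= pi h i)
  (pi_sum : forall h, `|h| <= r -> \sum_i pi h i = 1)
  (pi_stat : forall h j, `|h| <= r -> \sum_i pi h i * Q h i j = pi h j)
  (Q_ge : forall i j, eps <= Q 0 i j) (Q_sum : forall i, \sum_j Q 0 i j = 1).

(** Half of the mass l * eps removed from each row: a reduced row, enlarged by this tolerance, has
    sum 1 - l * eps + dl = 1 - dl, still less than 1. *)
Let dl : R := l%:R * eps / 2.

Hypothesis Q_close : forall i j,
  majorized (Z := Z) r (fun _ h => Q h i j - Q 0 i j) (fun=> dl * Q 0 i j).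

Let s : R := 1 - dl.
Let le_gt0 : 0 < l%:R * eps. Proof. by rewrite mulr_gt0// ltr0n. Qed.
Let le_le1 : l%:R * eps <= 1.
Proof.
rewrite -[leRHS](Q_sum (Ordinal l0)) mulr_natl -[X in eps *+ X](card_ord l) -sumr_const.
exact: ler_sum.
Qed.
Let s_ge0 : 0 <= s. Proof. by rewrite /s /dl; move: le_le1; lra. Qed.
Let s_lt1 : s < 1. Proof. by rewrite /s /dl; move: le_gt0; lra. Qed.

Let m i j : R := Q 0 i j - eps + dl * Q 0 i j.
Let m_ge0 i j : 0 <= m i j.
Proof.
rewrite addr_ge0 ?subr_ge0// mulr_ge0//; first by rewrite /dl; move: le_gt0; lra.
exact: le_trans (ltW eps0) (Q_ge i j).
Qed.
Let m_sum i : \sum_j m i j = s.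
Proof.
rewrite big_split/= sumrB -mulr_sumr Q_sum sumr_const card_ord -mulr_natl /s /dl; lra.
Qed.

Let K_maj i j : majorized (Z := Z) r (fun _ h => Q h i j - eps) (fun=> m i j).
Proof.
have h := majorizedD r0 (Q_close i j) (majorized_const (Q 0 i j - eps) r0).
apply: majorized_ext (majorized_le _ h) => [z h' _|z]; first by ring.
by rewrite ger0_norm ?subr_ge0// /m addrC.
Qed.

(* The terms of the Neumann series of the rank-one perturbation Q - eps of Q. *)
Fixpoint neumann h k : 'I_l -> R := if k is k'.+1 then
  fun j => \sum_i neumann h k' i * (Q h i j - eps) else fun=> eps.

Let neumann_maj k : exists2 V : 'I_l -> R,
  (forall j, majorized (Z := Z) r (fun _ h => neumann h k j) (fun=> V j)) &
  (\sum_j V j <= l%:R * eps * s ^+ k) /\ (forall j, 0 <= V j).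
Proof.
elim: k => [|k [W Wm [Ws W0]]].
  exists (fun=> eps).
    by move=> j; apply: majorized_le (majorized_const eps r0) => z; rewrite gtr0_norm.
  by split=> [|j]; [rewrite sumr_const card_ord expr0 mulr1 mulr_natl|exact: ltW].
exists (fun j => \sum_i W i * m i j).
  by move=> j; exact: majorized_sum (fun i => majorizedM r0 (Wm i) (K_maj i j)).
split=> [|j]; last by apply: sumr_ge0 => i _; rewrite mulr_ge0.
rewrite exchange_big/=; under eq_bigr do rewrite -mulr_sumr m_sum.
by rewrite -mulr_suml exprSr mulrA ler_wpM2r.
Qed.

Fixpoint remainder h k : 'I_l -> R := if k is k'.+1 then
  fun j => \sum_i remainder h k' i * (Q h i j - eps) else pi h.

(** As the entries of [pi h] sum to 1, the stationarity equation reads pi = eps + pi (Q - eps),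
    [eps] standing for a constant vector or matrix. Iteration produces the Neumann series with
    remainder pi (Q - eps)^k. *)
Let remainderE h k j : `|h| <= r ->
  pi h j = \sum_(0 <= i < k) neumann h i j + remainder h k j.
Proof.
move=> hr; elim: k j => [|k IH] j; first by rewrite big_geq// add0r.
rewrite -pi_stat//.
rewrite big_nat_recl//=.
transitivity (\sum_i pi h i * eps + \sum_i pi h i * (Q h i j - eps)).
  by rewrite -big_split/=; apply: eq_bigr => i _; ring.
rewrite -mulr_suml pi_sum// mul1r -addrA; congr (_ + _).
transitivity (\sum_i ((\sum_(0 <= k' < k) neumann h k' i) * (Q h i j - eps) +
    remainder h k i * (Q h i j - eps))).
  by apply: eq_bigr => i _; rewrite -mulrDl -IH.
rewrite big_split/=; congr (_ + _).
under eq_bigr do rewrite mulr_suml.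
by rewrite exchange_big.
Qed.

Let remainder_le (z : Z) h k : `|h| <= r -> \sum_j `|remainder h k j| <= s ^+ k.
Proof.
move=> hr; elim: k => [|k IH].
  rewrite expr0 -(pi_sum hr); apply: ler_sum => j _.
  by rewrite ger0_norm// pi_ge0.
apply: (@le_trans _ _ (\sum_j \sum_i `|remainder h k i| * m i j)).
  apply: ler_sum => j _; rewrite (le_trans (ler_norm_sum _ _ _))//.
  apply: ler_sum => i _; rewrite normrM ler_wpM2l//.
  exact: (majorized_bound z (K_maj i j)).
rewrite exchange_big/=; under eq_bigr do rewrite -mulr_sumr m_sum.
by rewrite -mulr_suml exprSr ler_wpM2r.
Qed.

(** The invariant law is identified, at each h, with the sum of the Neumann series, whose terms are
    polynomials in the entries of [Q]. The bound 2 is l * eps / (1 - s), with 1 - s = l * eps /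
    2. *)
Lemma stationary_majorized j : majorized (Z := Z) r (fun _ h => pi h j) (fun=> 2).
Proof.
have /choice[W HW] : forall k, exists V : 'I_l -> R,
  (forall j, majorized (Z := Z) r (fun _ h => neumann h k j) (fun=> V j)) /\
  ((\sum_j V j <= l%:R * eps * s ^+ k) /\ (forall j, 0 <= V j)).
  by move=> k; have [V' H1 H2] := neumann_maj k; exists V'.
apply: (majorized_series (f_ := fun k _ h => neumann h k j) (m := fun k _ => W k j)) => //.
- by move=> k; case: (HW k).
- move=> n z; apply: (@le_trans _ _ (\sum_(0 <= k < n) l%:R * eps * s ^+ k)).
    apply: ler_sum => k _; have [_ [H1 H2]] := HW k; apply: le_trans H1.
    by rewrite (bigD1 j)//= lerDl sumr_ge0.
  rewrite -mulr_sumr.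
  apply: le_trans (ler_wpM2l (ltW le_gt0) (sum_geometric_le n _)) _.
    by rewrite s_ge0.
  rewrite /s /dl opprD addNKr opprK ler_pdivrMr ?divr_gt0//.
  by lra.
- move=> z h hr; apply/cvgrPdist_lt => e e0.
  have : geometric 1 s @ \oo --> (0 : R) by apply: cvg_geometric; rewrite ger0_norm.
  move=> /cvgrPdist_lt /(_ _ e0); apply: filterS => n /=.
  rewrite sub0r normrN mul1r ger0_norm ?exprn_ge0// => H.
  rewrite (remainderE n j hr) addrAC subrr add0r.
  apply: le_lt_trans H; apply: le_trans (remainder_le z n hr).
  by rewrite (bigD1 j)//= lerDl sumr_ge0.
Qed.

End stationary_law.

(** * Integrability of f ln f under quadratic decay *)

Section log_tail.
Context {R : realType}.
Local Notation RR := (measurableTypeR R).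
Local Notation mu := (@lebesgue_measure R).

(** (1 + |x|)^(-3/2): the exponent lies between the decay -2 of the density and the integrability
    threshold -1, which leaves room for the logarithm. *)
Definition tail (x : R) : R := ((1 + `|x|) * Num.sqrt (1 + `|x|))^-1.

Let one_norm_gt0 (x : R) : 0 < 1 + `|x|. Proof. by rewrite ltr_wpDr. Qed.

Lemma tail_ge0 x : 0 <= tail x.
Proof. by rewrite invr_ge0 mulr_ge0// ltW. Qed.

Lemma continuous_tail : continuous tail.
Proof.
move=> x; apply: cvgV.
  by rewrite mulf_neq0// lt0r_neq0// sqrtr_gt0.
have c1 : {for x, continuous (fun x : R => 1 + `|x|)}.
  by apply: cvgD; [exact: cvg_cst|exact: norm_continuous].
apply: cvgM; first exact: c1.
by apply: continuous_comp; [exact: c1|exact: sqrt_continuous].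
Qed.

Let prim (x : R) : R := - 2 * (Num.sqrt (1 + x))^-1.

Let is_derive_prim (x : R) : 0 <= x -> is_derive x 1 prim (tail x).
Proof.
move=> x0; have x1 : 0 < 1 + x by rewrite ltr_wpDr.
have s0 : 0 < Num.sqrt (1 + x) by rewrite sqrtr_gt0.
have h1 : is_derive x 1 (fun x : R => 1 + x) 1.
  rewrite (_ : (fun x : R => 1 + x) = cst 1 + id)//.
  by apply: is_derive_eq; rewrite add0r.
have h2 := @is_derive1_comp _ (@Num.sqrt R) (fun x : R => 1 + x) x _ _ (is_derive1_sqrt x1) h1.
have h3 := @is_deriveV _ (Num.sqrt \o (fun x : R => 1 + x)) x _ 1 (lt0r_neq0 s0) h2.
have h4 := is_deriveZ (-2 : R) h3.
apply: is_derive_eq h4 _.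
rewrite /tail ger0_norm// /GRing.scale/= mulr1.
rewrite -{3}(sqr_sqrtr (ltW x1)).
by have := lt0r_neq0 s0; set y := Num.sqrt _ => y0; field.
Qed.

Let cvg_prim : prim x @[x --> +oo%R] --> 0.
Proof.
apply/cvgrPdist_le => e e0; near=> x.
have x1 : 0 < 1 + x by rewrite ltr_wpDr//; near: x; exact: nbhs_pinfty_ge.
have s0 : 0 < Num.sqrt (1 + x) by rewrite sqrtr_gt0.
rewrite sub0r normrN /prim normrM normrN !gtr0_norm ?invr_gt0//.
rewrite ler_pdivrMr// mulrC -ler_pdivrMr//.
rewrite -(@ler_pXn2r _ 2)// ?nnegrE ?divr_ge0 ?ltW// sqr_sqrtr ?ltW//.
rewrite -ltrBlDl; near: x; apply: nbhs_pinfty_gt; exact: num_real.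
Unshelve. all: by end_near. Qed.

Lemma integrable_tail : mu.-integrable setT (EFin \o tail).
Proof.
have mt : measurable_fun setT tail by exact: continuous_measurable_fun continuous_tail.
apply/integrableP; split; first exact/measurable_EFinP.
under eq_integral do rewrite /= ger0_norm ?tail_ge0//.
rewrite ge0_symfun_integralT//=; last 3 first.
- exact: tail_ge0.
- exact: continuous_tail.
- by move=> x /=; rewrite /tail normrN.
rewrite (_ : [set x | _] = `[0, +oo[%classic); last first.
  by apply/seteqP; split => x/=; rewrite in_itv/= andbT.
rewrite (@ge0_continuous_FTC2y _ tail prim 0 0).
- by rewrite -EFinB -EFinM ltry.
- by move=> x _; exact: tail_ge0.
- by apply: continuous_subspaceT; exact: continuous_tail.
- exact: cvg_prim.
- by move=> x x0; have [] := is_derive_prim (ltW x0).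
- apply: cvg_at_right_filter; apply: differentiable_continuous.
  by apply/derivable1_diffP; have [] := is_derive_prim (lexx 0).
- move=> x; rewrite in_itv/= andbT => x0; rewrite derive1E.
  by have [] := is_derive_prim (ltW x0).
Qed.

(** With y = 1 + |x|, [f] is of order y^-2 and |ln f| is at most a constant plus ln (1 + x^2), which
    sqrt y absorbs; y^(-3/2) is integrable. *)
Lemma integrable_quadratic_decay_entropy (f : RR -> R) (a A : R) :
  measurable_fun setT f -> 0 < a ->
  (forall x, a <= f x * (1 + x ^+ 2) <= A) ->
  mu.-integrable setT (fun x => (f x * ln (f x))%:E).
Proof.
move=> mf a0 fA.
have q0 (x : R) : 0 < 1 + x ^+ 2 by rewrite ltr_wpDr ?sqr_ge0.
have f0 x : 0 < f x.
  by have /andP[af _] := fA x; rewrite -(pmulr_lgt0 _ (q0 x)) (lt_le_trans a0).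
have A0 : 0 < A by have /andP[h1 h2] := fA 0; exact: lt_le_trans a0 (le_trans h1 h2).
pose K := `|ln a| + `|ln A|.
apply: (@le_integrable _ _ _ mu _ _ _ (fun x => (2 * A * (K + 4) * tail x)%:E)) => //.
- by apply/measurable_EFinP; apply: measurable_funM => //; exact: measurableT_comp.
- move=> x _ /=; rewrite lee_fin.
  set y := 1 + `|x|; have y1 : 1 <= y by rewrite lerDl.
  have y0 : 0 < y by exact: lt_le_trans y1.
  have s1 : 1 <= Num.sqrt y by rewrite -sqrtr1 ler_wsqrtr.
  have s0 : 0 < Num.sqrt y by exact: lt_le_trans s1.
  have yy : Num.sqrt y ^+ 2 = y by rewrite sqr_sqrtr// ltW.
  have xx : x ^+ 2 = `|x| ^+ 2 by rewrite real_normK// num_real.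
  have y2 : y ^+ 2 <= 2 * (1 + x ^+ 2).
    by rewrite xx /y; have := sqr_ge0 (1 - `|x|); nra.
  have y3 : 1 + x ^+ 2 <= y ^+ 2.
    by rewrite xx /y; have := normr_ge0 x; nra.
  have /andP[lo hi] := fA x.
  have fle : f x <= 2 * A / y ^+ 2.
    rewrite ler_pdivlMr ?exprn_gt0//.
    apply: (@le_trans _ _ (f x * (2 * (1 + x ^+ 2)))); first by rewrite ler_wpM2l// ltW.
    by rewrite mulrCA ler_wpM2l.
  (* ln (y^2) = 4 ln (sqrt y), and a logarithm is below its argument. *)
  have lns : ln (1 + x ^+ 2) <= 4 * Num.sqrt y.
    apply: (@le_trans _ _ (ln (y ^+ 2))); first by rewrite ler_ln ?posrE ?exprn_gt0.
    rewrite lnXn// -{1}yy lnXn// -mulrnA -[_ *+ _]mulr_natl ler_wpM2l//.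
    by rewrite ltW// ln_sublinear.
  have ln0 : 0 <= ln (1 + x ^+ 2) by rewrite ln_ge0// lerDl sqr_ge0.
  have lnf : `|ln (f x)| <= (K + 4) * Num.sqrt y.
    have h1 : ln a <= ln (f x) + ln (1 + x ^+ 2).
      by rewrite -lnM ?posrE// ler_ln ?posrE// mulr_gt0.
    have h2 : ln (f x) + ln (1 + x ^+ 2) <= ln A.
      by rewrite -lnM ?posrE// ler_ln ?posrE// mulr_gt0.
    apply: (@le_trans _ _ (K + ln (1 + x ^+ 2))).
      have := ler_norm (ln A); have := ler_norm (- ln a); rewrite normrN.
      have := normr_ge0 (ln A); have := normr_ge0 (ln a); rewrite /K => *.
      by rewrite ler_norml; apply/andP; split; lra.
    rewrite mulrDl lerD// ler_peMr// /K addr_ge0//.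
  rewrite normrM (gtr0_norm (f0 x)) [leRHS]ger0_norm; last first.
    by rewrite !mulr_ge0 ?tail_ge0// ?(ltW A0)// addr_ge0// addr_ge0.
  apply: (@le_trans _ _ (2 * A / y ^+ 2 * ((K + 4) * Num.sqrt y))).
    by rewrite ler_pM// ltW.
  rewrite /tail -/y le_eqVlt; apply/orP; left; apply/eqP.
  rewrite -{1 3}yy; have := lt0r_neq0 s0; set w := Num.sqrt y => w0.
  by rewrite -/w in yy *; rewrite ?sqrtr_sqr; field.
- under eq_fun do rewrite EFinM; apply: integrableZl => //; exact: integrable_tail.
Qed.

End log_tail.

Section cauchy_bounds.
Context {R : realType}.
Local Notation RR := (measurableTypeR R).

Lemma cauchy_density_gt0 (g m x : R) : 0 < g -> 0 < cauchy_density g m x.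
Proof.
move=> g0; rewrite /cauchy_density mulr_gt0 ?invr_gt0 ?pi_gt0// divr_gt0//.
by rewrite ltr_wpDl ?sqr_ge0// exprn_gt0.
Qed.

Lemma measurable_cauchy_density (g m : R) : 0 < g ->
  measurable_fun setT (cauchy_density g m : RR -> R).
Proof.
move=> g0; apply: measurable_funM => //; apply: measurable_funM => //.
apply: measurable_fun_inv; last by move=> z; rewrite ltr_wpDl ?sqr_ge0// exprn_gt0.
by apply: measurable_funD => //; apply: measurable_funX; exact: measurable_funB.
Qed.

Lemma cauchy_density_quadratic (g m : R) : 0 < g -> exists a A, 0 < a /\
  forall x, a <= cauchy_density g m x * (1 + x ^+ 2) <= A.
Proof.
move=> g0.
(* 1 + x^2 <= C1 s follows from x^2 <= 2 (x - m)^2 + 2 m^2, and s <= C2 (1 + x^2) from (x - m)^2 <=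
   2 x^2 + 2 m^2. *)
pose C1 := 2 + (1 + 2 * m ^+ 2) / g ^+ 2; pose C2 := 2 + 2 * m ^+ 2 + g ^+ 2.
have m2 := sqr_ge0 m; have g2 : 0 < g ^+ 2 by rewrite exprn_gt0.
have C20 : 0 < C2 by rewrite /C2; lra.
have p0 : 0 < trigo.pi^-1 * g :> R by rewrite mulr_gt0 ?invr_gt0 ?pi_gt0.
exists (trigo.pi^-1 * g * C2^-1), (trigo.pi^-1 * g * C1); split.
  by rewrite mulr_gt0// invr_gt0.
move=> x; set s := (x - m) ^+ 2 + g ^+ 2.
have xm2 := sqr_ge0 (x - m).
have s0 : 0 < s by rewrite /s; lra.
have -> : cauchy_density g m x * (1 + x ^+ 2) = trigo.pi^-1 * g * ((1 + x ^+ 2) / s).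
  by rewrite /cauchy_density -/s; ring.
rewrite !ler_wpM2l ?(ltW p0)//.
  rewrite ler_pdivrMr// /C1 /s mulrDl.
  have -> : (1 + 2 * m ^+ 2) / g ^+ 2 * ((x - m) ^+ 2 + g ^+ 2) =
     (1 + 2 * m ^+ 2) / g ^+ 2 * (x - m) ^+ 2 + (1 + 2 * m ^+ 2).
    by field; rewrite lt0r_neq0.
  have : 0 <= (1 + 2 * m ^+ 2) / g ^+ 2 * (x - m) ^+ 2.
    by rewrite mulr_ge0// divr_ge0 ?(ltW g2)//; lra.
  have := sqr_ge0 (x - 2 * m); nra.
rewrite ler_pdivlMr// mulrC ler_pdivrMr// /C2 /s.
have := sqr_ge0 (x + m); have := sqr_ge0 x => h1 h2.
have : 0 <= m ^+ 2 * x ^+ 2 by rewrite mulr_ge0.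
have : 0 <= g ^+ 2 * x ^+ 2 by rewrite mulr_ge0 ?(ltW g2).
nra.
Qed.

End cauchy_bounds.

Section single_output.
Context {R : realType}.
Local Notation RR := (measurableTypeR R).

Lemma integrable_tuple1 (F : RR -> R) : measurable_fun setT F ->
  lebesgue_measure.-integrable setT (EFin \o F) ->
  (lebesgue_tuple 1).-integrable setT (fun t : 1.-tuple RR => (F (tnth t ord0))%:E).
Proof.
move=> mF /integrableP[_ IF]; apply/integrableP; split.
  by apply/measurable_EFinP; exact: measurableT_comp mF (measurable_tnth ord0).
have := @integral_tuple_prod R 1 (fun _ x => `|F x|).
rewrite big_ord1 => H.
rewrite (eq_integral (fun t : 1.-tuple RR => (\prod_(i < 1) `|F (tnth t i)|)%:E)).
  by rewrite H// => i; exact: measurableT_comp.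
by move=> t _; rewrite big_ord1.
Qed.

End single_output.

Section geometric_series.
Context {R : realType} {N : nat} {d : measure_display} {Z : measurableType d}.

Lemma majorized_geometric (r C rho : R) (f : nat -> Z -> 'rV[R]_N -> R) : 0 <= r ->
  0 <= rho < 1 -> (forall m, majorized r (f m) (fun=> C * rho ^+ m)) ->
  majorized r (fun z h => limn (series (fun m => f m z h))) (fun=> C / (1 - rho)).
Proof.
move=> r0 /andP[rho0 rho1] fm.
apply: (majorized_series r0 fm) => [n z|z h hr].
  have C0 : 0 <= C by have := majorized_ge0 (fm 0%N) z; rewrite expr0 mulr1.
  by rewrite -mulr_sumr ler_wpM2l// sum_geometric_le// rho0.
have C0 m : 0 <= C * rho ^+ m by exact: majorized_ge0 (fm m) z.
suff : cvgn (series (fun m => f m z h)) by [].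
apply: normed_cvg.
apply: (@series_le_cvg _ (fun m => `|f m z h|) (fun m => C * rho ^+ m)).
- by move=> m; exact: normr_ge0.
- exact: C0.
- by move=> m; exact: majorized_bound (fm m) hr.
- by apply: is_cvg_geometric_series; rewrite ger0_norm.
Qed.

(** Expansions of the parameters alone are established over the space of one output and used over
    tuples of any length; the coefficients are those read at [z]. *)
Lemma majorized_parameter d' (Z' : measurableType d') (z : Z) (r M : R) (f : 'rV[R]_N -> R) :
  majorized (Z := Z) r (fun _ => f) (fun=> M) -> majorized (Z := Z') r (fun _ => f) (fun=> M).
Proof.
move=> [a [c [_ H]]]; exists a, (fun k _ => c k z); split=> [k|_].
  exact: measurable_cst.
exact: H.
Qed.

End geometric_series.

(** * Analyticity of the entropy rate *)

Section constants.
Context {R : realFieldType}.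
Variable eps : R.
Hypothesis eps01 : 0 < eps <= 1.

(* The tolerances are chosen so that an error [filter_tol] in the normalized
   forward variables reproduces itself ([filter_step]) and so that the loss
   (1 + param_tol)^6 / (1 - filter_tol)^2 per output is beaten by the
   contraction of the 2x2 minors ([entropy_rate_factor_lt1]). *)
Definition filter_tol : R := eps ^+ 2 / 16.
Definition param_tol : R := eps * filter_tol / 4.
Definition entropy_rate_factor : R :=
  (1 + param_tol) ^+ 2 ^+ 2 * ((1 + param_tol) ^+ 2 - eps ^+ 2) *
      ((1 - filter_tol)^-1) ^+ 2.
Definition forgetting_factor : R :=
  (1 + param_tol) ^+ 2 * ((1 + param_tol) ^+ 2 - eps ^+ 2) *
      ((1 - filter_tol)^-1) ^+ 2.

Lemma filter_tol_gt0 : 0 < filter_tol.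
Proof. by case/andP: eps01 => e0 e1; rewrite divr_gt0// exprn_gt0. Qed.

Lemma filter_tol_le : filter_tol <= 16^-1.
Proof.
case/andP: eps01 => e0 e1; have : eps ^+ 2 <= 1 by rewrite exprn_ile1// ltW.
by rewrite /filter_tol; lra.
Qed.

Lemma filter_tol_lt1 : filter_tol < 1.
Proof. by have := filter_tol_le; lra. Qed.

Lemma param_tol_gt0 : 0 < param_tol.
Proof.
case/andP: eps01 => e0 e1; rewrite /param_tol divr_gt0// mulr_gt0//.
exact: filter_tol_gt0.
Qed.

Lemma param_tol_le4 : 4 * param_tol <= filter_tol.
Proof.
case/andP: eps01 => e0 e1; rewrite /param_tol mulrCA divff// mulr1.
by rewrite ler_piMl// ltW// filter_tol_gt0.
Qed.

Lemma param_tol_le : param_tol <= filter_tol.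
Proof. by have := param_tol_le4; have := param_tol_gt0; lra. Qed.

Lemma filter_step : (1 + filter_tol) * ((1 + param_tol) ^+ 2 - 1) + (1 - eps) * filter_tol <=
  filter_tol * (1 - eps * filter_tol).
Proof.
case/andP: eps01 => e0 e1.
have t0 := filter_tol_gt0; have t1 := filter_tol_le.
have d0 := param_tol_gt0; have d1 := param_tol_le4.
have E : 4 * param_tol = eps * filter_tol by rewrite /param_tol; field.
set t := filter_tol in t0 t1 d1 E *; set p := param_tol in d0 d1 E *.
have h1 : (1 + p) ^+ 2 - 1 <= 3 * p by nra.
have h2 : (1 + t) * ((1 + p) ^+ 2 - 1) <= (1 + t) * (3 * p).
  by rewrite ler_wpM2l//; lra.
have h3 : (1 - eps) * t = t - 4 * p by rewrite E; ring.
have h4 : t * (1 - eps * t) = t - 4 * p * t by rewrite E; ring.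
rewrite h3 h4; nra.
Qed.

Lemma spread_ge0 : 0 <= (1 + param_tol) ^+ 2 - eps ^+ 2.
Proof.
case/andP: eps01 => e0 e1; have d0 := param_tol_gt0.
by have : eps ^+ 2 <= 1; [rewrite exprn_ile1// ltW|nra].
Qed.

Lemma entropy_rate_factor_lt1 : 0 <= entropy_rate_factor < 1.
Proof.
have t0 := filter_tol_gt0; have t1 := filter_tol_le.
have d0 := param_tol_gt0; have d1 := param_tol_le4; have s0 := spread_ge0.
have t1' : 0 < 1 - filter_tol by lra.
apply/andP; split.
  rewrite mulr_ge0//; last by rewrite exprn_ge0// invr_ge0 ltW.
  by rewrite mulr_ge0// exprn_ge0// sqr_ge0.
rewrite /entropy_rate_factor exprVn ltr_pdivrMr ?exprn_gt0// mul1r.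
(* With t = [filter_tol] the claim reduces to (1 + t)^2 (1 - 15 t) < (1 - t)^2; the divisor 16 in
   [filter_tol] provides the term -15 t. *)
have -> : eps ^+ 2 = 16 * filter_tol by rewrite /filter_tol; field.
have E : eps ^+ 2 = 16 * filter_tol by rewrite /filter_tol; field.
rewrite E in s0.
set t := filter_tol in t0 t1 d1 t1' s0 E *; set p := param_tol in d0 d1 s0 *.
have h1 : (1 + p) ^+ 2 <= 1 + t by nra.
have h2 : (1 + p) ^+ 2 ^+ 2 <= (1 + t) ^+ 2.
  by rewrite lerXn2r ?nnegrE ?exprn_ge0//; lra.
apply: (@le_lt_trans _ _ ((1 + t) ^+ 2 * (1 + t - 16 * t))).
  by apply: ler_pM => //; [rewrite !exprn_ge0//; lra|lra].
nra.
Qed.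

Lemma forgetting_factor_lt1 : 0 <= forgetting_factor < 1.
Proof.
have /andP[_ H] := entropy_rate_factor_lt1.
have t0 := filter_tol_gt0; have t1 := filter_tol_le; have s0 := spread_ge0.
have d0 := param_tol_gt0; have t1' : 0 < 1 - filter_tol by lra.
have p1 : 1 <= (1 + param_tol) ^+ 2 by nra.
apply/andP; split.
  rewrite mulr_ge0//; last by rewrite exprn_ge0// invr_ge0 ltW.
  by rewrite mulr_ge0// sqr_ge0.
apply: le_lt_trans H; rewrite /forgetting_factor /entropy_rate_factor.
rewrite ler_wpM2r//; first by rewrite exprn_ge0// invr_ge0 ltW.
rewrite ler_wpM2r// [leRHS]expr2 ler_peMr//; lra.
Qed.

End constants.

Section entropy_majorant.
Context {R : realType} {N l : nat}.
Local Notation RR := (measurableTypeR R).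
Variables (i0 : 'I_l) (r eps : R).
Variables (pi : 'rV[R]_N -> 'I_l -> R) (Q : 'rV[R]_N -> 'I_l -> 'I_l -> R).
Variable q : 'I_l -> RR -> 'rV[R]_N -> R.
Hypotheses (r0 : 0 < r) (eps01 : 0 < eps <= 1).
Hypotheses (pi_ge : forall i, eps <= pi 0 i)
  (pi_sum : forall h, `|h| <= r -> \sum_i pi h i = 1)
  (Q_ge : forall i j, eps <= Q 0 i j)
  (Q_sum : forall h, `|h| <= r -> forall i, \sum_j Q h i j = 1)
  (q_gt0 : forall i z, 0 < q i z 0)
  (q_meas : forall i, measurable_fun setT (q i ^~ 0)).
Let dl := param_tol eps.
Hypotheses
  (pi_close : forall i, majorized (Z := RR) r (fun _ h => pi h i / pi 0 i - 1) (fun=> dl))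
  (Q_close : forall i j,
    majorized (Z := RR) r (fun _ h => Q h i j / Q 0 i j - 1) (fun=> dl))
  (q_close : forall i,
    majorized r (fun z h => q i z h / q i z 0 - 1) (fun=> dl)).

(** Forward variables take emissions indexed by all of [nat], so a tuple is read with the default
    output 0 beyond its length; blocks within the first n outputs never meet it. *)
Let qt n (k : nat) (i : 'I_l) (t : n.-tuple RR) (h : 'rV[R]_N) := q i (nth 0 t k) h.
Arguments qt : clear implicits.

Let measurable_nth n k : measurable_fun setT (fun t : n.-tuple RR => nth 0 t k : RR).
Proof.
have [kn|kn] := ltnP k n.
  rewrite (_ : (fun t => _) = (@tnth _ _)^~ (Ordinal kn)); first exact: measurable_tnth.
  by apply/funext => t; rewrite (tnth_nth 0).
rewrite (_ : (fun t => _) = cst 0); first exact: measurable_cst.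
by apply/funext => t; rewrite nth_default ?size_tuple.
Qed.

Let eps0 : 0 < eps. Proof. by case/andP: eps01. Qed.
Let r0' := ltW r0.
Let t0 := filter_tol_gt0 eps01.
Let t1 := filter_tol_lt1 eps01.
Let dl0 : 0 <= dl. Proof. exact: ltW (param_tol_gt0 eps01). Qed.
Let dlt : dl <= filter_tol eps := param_tol_le eps01.
Let step := filter_step eps01.
Let norm0 : `|0 : 'rV[R]_N| <= r. Proof. by rewrite normr0. Qed.

Let qt_gt0 n k i (t : n.-tuple RR) : 0 < qt n k i t 0. Proof. exact: q_gt0. Qed.
Let qt_meas n k i : measurable_fun setT (qt n k i ^~ 0).
Proof. exact: measurableT_comp (q_meas i) (@measurable_nth n k). Qed.
Let pi_close' n i :
  majorized (Z := n.-tuple RR) r (fun _ h => pi h i / pi 0 i - 1) (fun=> dl).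
Proof. exact: (majorized_parameter _ (0 : RR) (pi_close i)). Qed.
Let Q_close' n i j :
  majorized (Z := n.-tuple RR) r (fun _ h => Q h i j / Q 0 i j - 1) (fun=> dl).
Proof. exact: (majorized_parameter _ (0 : RR) (Q_close i j)). Qed.
Let qt_close n k i :
  majorized r (fun t h => qt n k i t h / qt n k i t 0 - 1) (fun=> dl).
Proof. exact: (majorized_comp (@measurable_nth n k) (q_close i)). Qed.

Let B n (t : n.-tuple RR) h s m := block (pi h) (Q h) (fun k i => qt n k i t h) s m.
Arguments B : clear implicits.

Let C : R := 2 * ((1 + dl) ^+ 5 * (eps^-1 + 1) * ((1 - filter_tol eps)^-1) ^+ 4) *
  Num.max 1 (- ln eps + 6 * (filter_tol eps / (1 - filter_tol eps))).

Let ratio_maj n m : majorized r (fun (t : n.-tuple RR) h =>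
    log_ratio (pi h) (Q h) (fun i z => q i z h) 0 m (nth 0 t))
  (fun=> C * forgetting_factor eps ^+ m).
Proof.
exact: (log_cross_ratio_majorized (q := qt n) i0 r0' eps0 t0 t1 dl0 dlt step pi_ge
  (pi_sum norm0) Q_ge Q_sum (@qt_gt0 n) (@qt_meas n)
  (@pi_close' n) (@Q_close' n) (@qt_close n) 0 m).
Qed.

Lemma log_ratio_bound h m x : `|h| <= r ->
  `|log_ratio (pi h) (Q h) (fun i z => q i z h) 0 m x| <= C * forgetting_factor eps ^+ m.
Proof.
move=> hr; pose t : m.+2.-tuple RR := [tuple x i | i < m.+2].
rewrite (@log_ratio_ext _ _ _ _ _ m x (nth 0 t)).
  exact: (majorized_bound t (ratio_maj m.+2 m) hr).
move=> k km; rewrite -[k in RHS]/(nat_of_ord (Ordinal km)) -tnth_nth tnth_mktuple.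
by [].
Qed.

Hypotheses (int_B : forall n, (lebesgue_tuple n.+1).-integrable setT
    (fun t => (B n.+1 t 0 0 n.+1)%:E))
  (int_B1 : forall n, \int[lebesgue_tuple n.+1]_t B n.+1 t 0 0 n.+1 = 1)
  (int_BlnB : (lebesgue_tuple 1).-integrable setT
    (fun t => (B 1%N t 0 0 1%N * ln (B 1%N t 0 0 1%N))%:E)).

(** The majorant is a constant times the block density at h = 0, whose integral is 1 for every
    number of outputs, so integration costs no factor depending on m. *)
Lemma ratio_entropy_majorized m : majorized (Z := RR) r
  (fun _ h => \int[lebesgue_tuple m.+2]_t (B m.+2 t h 0 m.+2 *
     log_ratio (pi h) (Q h) (fun i z => q i z h) 0 m (nth 0 t)))
  (fun=> (1 + dl) ^+ 5 * C * entropy_rate_factor eps ^+ m).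
Proof.
have H := block_log_cross_ratio_majorized (q := qt m.+2) i0 r0' eps0 t0 t1 dl0 dlt step pi_ge
  (pi_sum norm0) Q_ge Q_sum (@qt_gt0 _) (@qt_meas _) (@pi_close' _) (@Q_close' _) (@qt_close _) 0 m.
set K := (1 + dl) ^+ 5 * C * entropy_rate_factor eps ^+ m.
have iK : (lebesgue_tuple m.+2).-integrable setT (EFin \o (fun t => K * B m.+2 t 0 0 m.+2)).
  by apply: eq_integrable (integrableZl _ K (int_B m.+1)).
have := majorized_integral RR r0 H iK.
apply: majorized_le => _.
by rewrite RintegralZl// int_B1 mulr1.
Qed.

(** The empty block has density 1, so ln B is its increment over the empty block: it equals its
    value at h = 0 plus an expansion with constant majorant. Integrability of B and of B ln B at h =
    0 then gives that of the majorant. *)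
Lemma first_entropy_majorized : exists M, majorized (Z := RR) r
  (fun _ h => \int[lebesgue_tuple 1]_t (B 1%N t h 0 1%N * ln (B 1%N t h 0 1%N)))
  (fun=> M).
Proof.
have HB := block_majorized (q := qt 1%N) r0' eps0 pi_ge Q_ge (@qt_gt0 _) (@qt_meas _)
  (@pi_close' _) (@Q_close' _) (@qt_close _) 0 1.
have HL := ln_block_increment_majorized (q := qt 1%N) i0 r0' eps0 t0 t1 dlt step pi_ge
  Q_ge Q_sum (@qt_gt0 _) (@qt_meas _) (@pi_close' _) (@Q_close' _) (@qt_close _) 0 0.
have mB : measurable_fun setT (fun t => B 1%N t 0 0 1%N).
  by have /integrableP[/measurable_EFinP] := int_B 0.
have mL : measurable_fun setT (fun t => ln (B 1%N t 0 0 1%N)) by exact: measurableT_comp.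
have B0 h t : `|h| <= r -> B 1%N t h 0 0%N = 1 by move=> hr; rewrite /B /block /= pi_sum.
have H := majorizedM r0' HB (majorizedD r0' (majorized_cst r0' mL) HL).
eexists; apply: (majorized_ext _ (majorized_integral RR r0 (majorized_ext _ H) _)).
- by move=> _ h hr; reflexivity.
- move=> t h hr /=; rewrite -!/(B _ _ _ _ _) !B0// ln1 !subr0.
  by congr (_ * _); rewrite addrC subrK.
- set c := (1 + _) ^+ _; set c' := 3 * _.
  apply: (@eq_integrable _ _ _ _ _ measurableT (fun t =>
    (c%:E * `|(B 1%N t 0 0 1%N * ln (B 1%N t 0 0 1%N))%:E| +
     (c * c')%:E * (B 1%N t 0 0 1%N)%:E)%E)).
    move=> t _ /=; rewrite -!EFinM -EFinD; congr EFin.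
    have B1 : 0 < B 1%N t 0 0 1%N.
      exact: (block_near_gt0 (q := qt 1%N) i0 eps0 t1 dlt pi_ge Q_ge
        (@qt_gt0 _) (@pi_close' _) (@Q_close' _) (@qt_close _)).
    rewrite normrM (gtr0_norm B1) -/(B 1%N t 0 0 1%N).
    by move: (B _ _ _ _ _) `|ln _| => b v; ring.
  apply: integrableD => //; apply: integrableZl => //; first exact: integrable_abse.
Qed.

Lemma entropy_majorized : exists M, majorized (Z := RR) r
  (fun _ h => - (\int[lebesgue_tuple 1]_t (B 1%N t h 0 1%N * ln (B 1%N t h 0 1%N)) +
    limn (series (fun m => \int[lebesgue_tuple m.+2]_t (B m.+2 t h 0 m.+2 *
     log_ratio (pi h) (Q h) (fun i z => q i z h) 0 m (nth 0 t))))))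
  (fun=> M).
Proof.
have [M1 H1] := first_entropy_majorized.
have H2 := majorized_geometric r0' (entropy_rate_factor_lt1 eps01) ratio_entropy_majorized.
by eexists; apply: majorizedN => //; exact: majorizedD H1 H2.
Qed.

End entropy_majorant.

Section parameters.
Context {R : realType} {N : nat}.
Local Notation RR := (measurableTypeR R).

Lemma majorized_relative (r e : R) (f : 'rV[R]_N -> R) : 0 <= r -> 0 < f 0 ->
  majorized (Z := RR) r (fun _ h => f h - f 0) (fun=> e * f 0) ->
  majorized (Z := RR) r (fun _ h => f h / f 0 - 1) (fun=> e).
Proof.
move=> r0 f0 H.
have := majorized_scale r0 (measurable_cst (f 0)^-1) H.
have Hle (z : RR) : `|cst (f 0)^-1 z| * (e * f 0) <= e.
  by rewrite gtr0_norm ?invr_gt0// mulrCA mulVf ?mulr1// gt_eqF.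
move/(majorized_le Hle); apply: majorized_ext => _ h hr /=.
by field; rewrite gt_eqF.
Qed.

End parameters.

Section hidden_cauchy_chain.
Context {R : realType} {m1 l : nat}.
Local Notation RR := (measurableTypeR R).

Lemma cauchy_scaleD (th h : 'rV[R]_(m1 + l * 2)) (i : 'I_l) :
  cauchy_scale (th + h) i = cauchy_scale th i + h 0 (rshift m1 (mxvec_index i (0 : 'I_2))).
Proof. by rewrite /cauchy_scale !mxE. Qed.

Lemma cauchy_locationD (th h : 'rV[R]_(m1 + l * 2)) (i : 'I_l) :
  cauchy_location (th + h) i =
    cauchy_location th i + h 0 (rshift m1 (mxvec_index i (1 : 'I_2))).
Proof. by rewrite /cauchy_location !mxE. Qed.

Lemma input_paramD (th h : 'rV[R]_(m1 + l * 2)) :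
  input_param (th + h) = input_param th + lsubmx h :> 'rV_m1.
Proof. by apply/rowP => i; rewrite !mxE. Qed.

Lemma cauchy_channel_relative (th : 'rV[R]_(m1 + l * 2)) (i : 'I_l) (e : R) :
  0 < cauchy_scale th i -> 0 < e ->
  exists2 r, 0 < r & forall r', 0 < r' <= r ->
    majorized (Z := RR) r' (fun z h =>
      cauchy_channel (th + h) i z / cauchy_channel (th + 0) i z - 1) (fun=> e).
Proof.
move=> g0 e0.
have g10 : 0 < cauchy_scale th i / 10 by rewrite divr_gt0.
have G := cauchy_ratio_majorized (cauchy_location th i)
  (rshift m1 (mxvec_index i (0 : 'I_2))) (rshift m1 (mxvec_index i (1 : 'I_2))) g0.
have [r r0 H] := majorized_shrink g10 e0 G.
exists r => // r' /H; apply: majorized_ext => z h _.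
rewrite /cauchy_channel !cauchy_scaleD !cauchy_locationD divff// gt_eqF//.
by apply: cauchy_density_gt0; rewrite mxE addr0.
Qed.

Variables (Omega1 : set 'rV[R]_m1) (Pi : 'rV[R]_m1 -> 'M[R]_l)
  (d : measure_display) (T : 'rV[R]_(m1 + l * 2) -> measurableType d)
  (P : forall th, probability (T th) R)
  (Y : forall th, int -> T th -> 'I_l) (Z : forall th, int -> T th -> R)
  (p : 'rV[R]_(m1 + l * 2) -> forall n, n.+1.-tuple (measurableTypeR R) -> R).
Arguments Y : clear implicits.
Arguments Z : clear implicits.
Arguments p : clear implicits.
Hypotheses (Omega1_open : open Omega1)
  (Pi_stochastic : forall e, Omega1 e -> stochastic_mx (Pi e))
  (Pi_analytic : forall i j e, Omega1 e ->
     real_analytic_at (fun e' => Pi e' i j) e)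
  (YZ_hidden_markov : forall th, Omega1 (input_param th) ->
     (forall i, 0 < cauchy_scale th i) ->
     hidden_markov_chain (P th) (Pi (input_param th)) (cauchy_channel th)
       (Y th) (Z th))
  (Z_density : forall th, Omega1 (input_param th) ->
     (forall i, 0 < cauchy_scale th i) ->
     forall n, is_density (P th) (past_block (Z th) n) (p th n)).

Definition admissible (th : 'rV[R]_(m1 + l * 2)) : Prop :=
  [/\ Omega1 (input_param th), forall i, 0 < cauchy_scale th i &
      forall i j, 0 < Pi (input_param th) i j].

Lemma transition_close (th : 'rV[R]_(m1 + l * 2)) (e : 'I_l -> 'I_l -> R) :
  Omega1 (input_param th) -> (forall i j, 0 < e i j) ->
  exists2 r, 0 < r & forall r', 0 < r' <= r -> forall i j,
    majorized (Z := RR) r' (fun _ h =>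
      Pi (input_param (th + h)) i j - Pi (input_param (th + 0)) i j) (fun=> e i j).
Proof.
move=> Oth e0.
have [[i j]|r r0 H] := common_radius (I := ('I_l * 'I_l)%type) (A := fun ij r' =>
    majorized (Z := RR) r' (fun _ h =>
      Pi (input_param (th + h)) ij.1 ij.2 - Pi (input_param (th + 0)) ij.1 ij.2)
      (fun=> e ij.1 ij.2)); last by exists r => // r' rr' i j; exact: (H (i, j)).
have [r [M [r0 H]]] := analytic_majorized (k := (l * 2)%N) (Pi_analytic i j Oth).
have [r1 r10 {}H] := majorized_shrink r0 (e0 i j) (H _ RR).
exists r1 => // r' /H; apply: majorized_ext => _ h _ /=.
by rewrite !input_paramD.
Qed.

(** On a small ball each scale and each entry of the matrix moves by at most half of its value, and
    [Omega1] is open. *)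
Lemma admissible_ball th : admissible th -> exists2 r, 0 < r &
  forall r', 0 < r' <= r -> forall h, `|h| <= r' -> admissible (th + h).
Proof.
move=> [Oth gth Pth].
have [i|rs rs0 Hs] := common_radius (I := 'I_l) (A := fun i r' => forall h : 'rV_(m1 + l * 2),
    `|h| <= r' -> 0 < cauchy_scale (th + h) i).
  exists (cauchy_scale th i / 2) => [|r' /andP[r0 rg] h hr]; first by rewrite divr_gt0.
  rewrite cauchy_scaleD.
  have := le_trans (coord_le_norm h (rshift m1 (mxvec_index i (0 : 'I_2)))) (le_trans hr rg).
  by rewrite ler_norml => /andP[]; have := gth i; lra.
have /nbhs_normP[eO /= eO0 HO] := open_nbhs_nbhs (conj Omega1_open Oth).
have [|rQ rQ0 HQ] := transition_close (e := fun i j => Pi (input_param (th + 0)) i j / 2) Oth.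
  by move=> i j; rewrite divr_gt0// addr0.
exists (Num.min rs (Num.min (eO / 2) rQ)).
  by rewrite !lt_min rs0 rQ0 divr_gt0.
move=> r'; rewrite !le_min => /and4P[r'0 r's r'O r'Q] h hr; split.
- rewrite input_paramD; apply: HO => /=.
  rewrite opprD addNKr normrN (le_lt_trans (norm_lsubmx _))//.
  by rewrite (le_lt_trans (le_trans hr r'O))// ltr_pdivrMr//; lra.
- by move=> i; apply: Hs hr; rewrite r'0.
- move=> i j; have r'Q' : 0 < r' <= rQ by rewrite r'0.
  have := majorized_bound (0 : RR) (HQ r' r'Q' i j) hr.
  have := Pth i j; rewrite -[in Pi (input_param th)](addr0 th) => Q0.
  by rewrite ler_norml => /andP[]; lra.
Qed.

(** A probability space has a point, and the chain sends it to a state. *)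
Lemma input_alphabet_nonempty (th : 'rV[R]_(m1 + l * 2)) : 'I_l.
Proof.
suff /cid[w _] : [set: T th] !=set0 by exact: Y th 0 w.
apply/set0P/negP => /eqP T0.
by have := @probability_setT _ _ _ (P th); rewrite T0 measure0 => /eqP; rewrite eq_sym onee_eq0.
Qed.

(** By stationarity each entry of the initial law is an average of a column of the matrix. *)
Lemma initial_law_ge th (e : R) : Omega1 (input_param th) ->
  (forall i, 0 < cauchy_scale th i) -> (forall i j, e <= Pi (input_param th) i j) ->
  forall j, e <= initial_law (P th) (Y th) j.
Proof.
move=> Oth gth eP j; have hmm := YZ_hidden_markov Oth gth.
rewrite -(initial_law_stationary hmm) -[leLHS]mul1r -(initial_law_sum hmm) mulr_suml.
by apply: ler_sum => i _; rewrite ler_wpM2l// initial_law_ge0.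
Qed.

Lemma measurable_cauchy_channel (th : 'rV[R]_(m1 + l * 2)) i : 0 < cauchy_scale th i ->
  measurable_fun [set: RR] (cauchy_channel th i).
Proof. exact: measurable_cauchy_density. Qed.

Lemma output_entropy_integrable th : Omega1 (input_param th) ->
  (forall i, 0 < cauchy_scale th i) ->
  (lebesgue_tuple 1).-integrable setT (fun t =>
    (output_density (P th) (cauchy_channel th) (Y th) t *
     ln (output_density (P th) (cauchy_channel th) (Y th) t))%:E).
Proof.
move=> Oth gth; have hmm := YZ_hidden_markov Oth gth.
set w := initial_law (P th) (Y th).
pose F (x : RR) : R := \sum_i w i * cauchy_channel th i x.
have FE (t : 1.-tuple RR) : output_density (P th) (cauchy_channel th) (Y th) t = F (tnth t ord0).
  have -> := output_density_block (n := 0%N) (Pi_stochastic Oth) hmm t.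
  rewrite (@blockS _ _ _ _ _ 0 0); last first.
    by move=> i; have [_ ->] := Pi_stochastic Oth.
  by apply: eq_bigr => i _; rewrite (tnth_nth 0).
have mF : measurable_fun setT F.
  apply: measurable_sum => i; apply: measurable_funM; first exact: measurable_cst.
  exact: measurable_cauchy_channel.
have w0 i : 0 <= w i by exact: initial_law_ge0.
have w1 : \sum_i w i = 1 by exact: initial_law_sum hmm.
have [i|a a0 Ha] := common_radius (A := fun i a => exists A, forall x,
    a <= cauchy_channel th i x * (1 + x ^+ 2) <= A).
  have [a [A [a0 H]]] := cauchy_density_quadratic (cauchy_location th i) (gth i).
  exists a => // b /andP[_ ba]; exists A => x.
  by have /andP[H1 H2] := H x; rewrite (le_trans ba).
have aa : 0 < a <= a by rewrite a0 lexx.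
have /choice[A HA] := fun i => Ha i a aa.
under eq_fun do rewrite FE.
apply: (@integrable_tuple1 _ (fun x => F x * ln (F x))).
  by apply: measurable_funM => //; exact: measurableT_comp.
apply: (@integrable_quadratic_decay_entropy _ F a (\sum_i w i * A i)) => // x.
have -> : a = \sum_i w i * a by rewrite -mulr_suml w1 mul1r.
rewrite /F mulr_suml; apply/andP; split.
  by apply: ler_sum => i _; rewrite -mulrA ler_wpM2l//; case/andP: (HA i x).
by apply: ler_sum => i _; rewrite -mulrA ler_wpM2l//; case/andP: (HA i x).
Qed.

Lemma output_density_integrable th n : Omega1 (input_param th) ->
  (forall i, 0 < cauchy_scale th i) ->
  (lebesgue_tuple n).-integrable setT
    (fun t => (output_density (P th) (cauchy_channel th) (Y th) t)%:E) /\
  \int[lebesgue_tuple n]_t output_density (P th) (cauchy_channel th) (Y th) t = 1.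
Proof.
move=> Oth gth; have hmm := YZ_hidden_markov Oth gth.
have mq i : measurable_fun [set: RR] (cauchy_channel th i).
  exact: measurable_cauchy_channel.
have q0 i x : 0 <= cauchy_channel th i x by exact/ltW/cauchy_density_gt0.
have /= E := @output_block_law _ _ _ _ _ _ _ _ _ hmm mq q0 0 n setT measurableT.
rewrite preimage_setT probability_setT in E.
split; last by rewrite /Rintegral -E.
apply/integrableP; split.
  by apply/measurable_EFinP; exact: measurable_output_density.
under eq_integral => t _ do rewrite gee0_abs ?lee_fin ?output_density_ge0//.
by rewrite -E ltry.
Qed.

Lemma entropy_analytic_at th : admissible th ->
  normalized_entropy (p th) n @[n --> \oo] --> (fine (entropy_rate (p th)))%:E /\
  real_analytic_at (fun th => fine (entropy_rate (p th))) th.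
Proof.
move=> Ath; have [Oth gth Pth] := Ath.
have i0 := input_alphabet_nonempty th.
have l0 : (0 < l)%N by case: (i0) => k; exact: leq_ltn_trans.
pose Q h i j := Pi (input_param (th + h)) i j.
pose w h i := initial_law (P (th + h)) (Y (th + h)) i.
pose q i z h := cauchy_channel (th + h) i z.
(* [common_radius] serves here to bound finitely many positive entries below by a single positive
   number. *)
have [[i j]|eps eps_gt0 He] := common_radius (I := ('I_l * 'I_l)%type)
    (A := fun ij e => e <= Q 0 ij.1 ij.2).
  exists (Q 0 i j); last by move=> e /andP[].
  by rewrite /Q addr0.
have Q_ge i j : eps <= Q 0 i j by apply: (He (i, j)); rewrite eps_gt0 lexx.
have transition_gt0 i j : 0 < Q 0 i j by exact: lt_le_trans (Q_ge i j).
have [rb rb0 Hb] := admissible_ball Ath.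
have eps01 : 0 < eps <= 1.
  rewrite eps_gt0 (le_trans (Q_ge i0 i0))//.
  have [Pge /(_ i0) <-] := Pi_stochastic Oth.
  rewrite /Q addr0.
  by rewrite (bigD1 i0)//= lerDl sumr_ge0.
have tol0 : 0 < param_tol eps := param_tol_gt0 eps01.
have [|r1 r10 H1] := transition_close (e := fun i j => param_tol eps * Q 0 i j) Oth.
  by move=> i j; rewrite mulr_gt0.
(* The coarser tolerance, relative to l * eps, under which the Neumann series of the initial law
   converges. *)
have [|r2 r20 H2] := transition_close (e := fun i j => l%:R * eps / 2 * Q 0 i j) Oth.
  by move=> i j; rewrite !mulr_gt0// ltr0n.
have [i|r3 r30 H3] := common_radius (A := fun i r' => majorized (Z := RR) r' (fun z h =>
    q i z h / q i z 0 - 1) (fun=> param_tol eps)).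
  exact: cauchy_channel_relative (gth i) tol0.
pose r4 := Num.min (Num.min rb r1) (Num.min r2 r3).
have r40 : 0 < r4 by rewrite !lt_min rb0 r10 r20.
have adm4 h : `|h| <= r4 -> admissible (th + h).
  by move=> hr; apply: Hb hr; rewrite r40 !ge_min lexx.
have w_ge0 h i : 0 <= w h i by exact: initial_law_ge0.
have w_sum h : `|h| <= r4 -> \sum_i w h i = 1.
  by move=> /adm4[Oh gh _]; exact: initial_law_sum (YZ_hidden_markov Oh gh).
have w_stat h j : `|h| <= r4 -> \sum_i w h i * Q h i j = w h j.
  by move=> /adm4[Oh gh _]; exact: initial_law_stationary (YZ_hidden_markov Oh gh) j.
have Q_sum h : `|h| <= r4 -> forall i, \sum_j Q h i j = 1.
  by move=> /adm4[Oh _ _]; have [] := Pi_stochastic Oh.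
have n40 : `|0 : 'rV[R]_(m1 + l * 2)| <= r4 by rewrite normr0 ltW.
have [W0 g0 _] := adm4 _ n40.
have w_ge i : eps <= w 0 i by exact: initial_law_ge.
have w_maj j : majorized (Z := RR) r4 (fun _ h => w h j) (fun=> 2).
  apply: (stationary_majorized (ltW r40) eps_gt0 l0 (fun h i _ => w_ge0 h i) w_sum
    w_stat Q_ge (Q_sum _ n40)).
  by move=> i' j'; apply: H2; rewrite r40 !ge_min lexx !orbT.
(* The Neumann series majorizes the initial law by 2 on radius [r4]; shrinking once more brings its
   increments below the relative tolerance. *)
have [j|r5 r50 H5] := common_radius (A := fun j r' => majorized (Z := RR) r'
    (fun _ h => w h j - w 0 j) (fun=> param_tol eps * w 0 j)).
  by apply: majorized_shrink (w_maj j); rewrite // mulr_gt0// (lt_le_trans eps_gt0).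
pose r := Num.min r4 r5.
have r0 : 0 < r by rewrite lt_min r40.
have rr4 : r <= r4 by rewrite ge_min lexx.
have w_close j : majorized (Z := RR) r (fun _ h => w h j / w 0 j - 1) (fun=> param_tol eps).
  apply: majorized_relative; rewrite ?(ltW r0) ?(lt_le_trans eps_gt0)//.
  by apply: H5; rewrite r0 ge_min lexx orbT.
have Q_close i j : majorized (Z := RR) r (fun _ h => Q h i j / Q 0 i j - 1) (fun=> param_tol eps).
  apply: (majorized_relative (f := fun h => Q h i j)); rewrite ?(ltW r0)//.
  by apply: H1; rewrite r0 (le_trans rr4)// !ge_min lexx !orbT.
have q_close i : majorized (Z := RR) r (fun z h => q i z h / q i z 0 - 1) (fun=> param_tol eps).
  by apply: H3; rewrite r0 (le_trans rr4)// !ge_min lexx !orbT.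
have q_gt0 i z : 0 < q i z 0 by exact: cauchy_density_gt0.
have mq h : `|h| <= r4 -> forall i, measurable_fun [set: RR] (q i ^~ h).
  by move=> /adm4[_ gh _] i; exact: measurable_cauchy_channel.
have w_sum' h : `|h| <= r -> \sum_i w h i = 1 by move=> hr; apply/w_sum/(le_trans hr).
have Q_sum' h : `|h| <= r -> forall i, \sum_j Q h i j = 1.
  by move=> hr; apply/Q_sum/(le_trans hr).
have densE h n (t : n.+1.-tuple RR) : `|h| <= r4 ->
    output_density (P (th + h)) (cauchy_channel (th + h)) (Y (th + h)) t =
    block (w h) (Q h) (fun k i => q i (nth 0 t k) h) 0 n.+1.
  move=> /adm4[Oh gh _].
  exact: (output_density_block (Pi_stochastic Oh) (YZ_hidden_markov Oh gh) t).
have int_B n : (lebesgue_tuple n.+1).-integrable setT (fun t =>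
    (block (w 0) (Q 0) (fun k i => q i (nth 0 t k) 0) 0 n.+1)%:E).
  have [+ _] := output_density_integrable n.+1 W0 g0.
  by apply: eq_integrable => // t _; rewrite densE.
have int_B1 n : \int[lebesgue_tuple n.+1]_t
    block (w 0) (Q 0) (fun k i => q i (nth 0 t k) 0) 0 n.+1 = 1.
  have [_ <-] := output_density_integrable n.+1 W0 g0.
  by apply: eq_Rintegral => t _; rewrite densE.
have int_BlnB : (lebesgue_tuple 1).-integrable setT (fun t =>
    (block (w 0) (Q 0) (fun k i => q i (nth 0 t k) 0) 0 1 *
     ln (block (w 0) (Q 0) (fun k i => q i (nth 0 t k) 0) 0 1))%:E).
  have := output_entropy_integrable W0 g0.
  by apply: eq_integrable => // t _; rewrite densE.
have [M HM] := entropy_majorized i0 r0 eps01 w_ge w_sum' Q_ge Q_sum' q_gt0 (mq _ n40)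
    w_close Q_close q_close int_B int_B1 int_BlnB.
pose E h := - (first_entropy (P (th + h)) (cauchy_channel (th + h)) (Y (th + h)) +
  limn (series (ratio_entropy (P (th + h)) (Pi (input_param (th + h)))
    (cauchy_channel (th + h)) (Y (th + h))))).
have cvgE h : `|h| <= r ->
    normalized_entropy (p (th + h)) n @[n --> \oo] --> (E h)%:E.
  move=> hr; have hr4 := le_trans hr rr4; have [Oh gh _] := adm4 _ hr4.
  have /andP[f0 f1] := forgetting_factor_lt1 eps01.
  apply: (normalized_entropy_cvg (Pi_stochastic Oh) (YZ_hidden_markov Oh gh) (mq h hr4)
    _ f0 f1 _ (output_entropy_integrable Oh gh) (Z_density Oh gh)).
    by move=> i x; exact/ltW/cauchy_density_gt0.
  move=> m x; exact: (log_ratio_bound i0 r0 eps01 w_ge w_sum' Q_ge Q_sum' q_gt0 (mq _ n40)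
    w_close Q_close q_close m x hr).
have HE h : `|h| <= r -> fine (entropy_rate (p (th + h))) = E h.
  by move=> /cvgE/cvg_lim Eh; rewrite /entropy_rate Eh.
have nr0 : `|0 : 'rV[R]_(m1 + l * 2)| <= r by rewrite normr0 ltW.
split; first by have := cvgE _ nr0; rewrite -(HE _ nr0) addr0.
apply: (majorized_analytic (0 : RR) r0 (majorized_ext _ HM)) => _ h hr.
rewrite HE// /E /first_entropy /ratio_entropy; congr (- (_ + limn (series _))).
  by apply: eq_Rintegral => t _; rewrite densE// (le_trans hr).
by apply/funext => m; apply: eq_Rintegral => t _; rewrite densE// (le_trans hr).
Qed.

End hidden_cauchy_chain.

(** Admissibility is an open condition, so every parameter near [th0] has its own expansion. The
    convergence clause guarantees that [fine] and [limn] stand for a genuine finite limit. *)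
Theorem mainTheorem4 (R : realType) (m1 l : nat) (Omega1 : set 'rV[R]_m1)
    (Pi : 'rV[R]_m1 -> 'M[R]_l)
    (d : measure_display) (T : 'rV[R]_(m1 + l * 2) -> measurableType d)
    (P : forall th, probability (T th) R)
    (Y : forall th, int -> T th -> 'I_l)
    (Z : forall th, int -> T th -> R)
    (p : 'rV[R]_(m1 + l * 2) ->
         forall n, n.+1.-tuple (measurableTypeR R) -> R)
    (th0 : 'rV[R]_(m1 + l * 2))
    (Omega1_open : open Omega1)
    (Omega1_connected : connected Omega1)
    (Omega1_bounded : bounded_set Omega1)
    (Pi_stochastic : forall e, Omega1 e -> stochastic_mx (Pi e))
    (Pi_analytic : forall i j e, Omega1 e ->
       real_analytic_at (fun e' => Pi e' i j) e)
    (YZ_hidden_markov : forall th, Omega1 (input_param th) ->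
       (forall i, 0 < cauchy_scale th i) ->
       hidden_markov_chain (P th) (Pi (input_param th)) (cauchy_channel th)
         (Y th) (Z th))
    (Z_density : forall th, Omega1 (input_param th) ->
       (forall i, 0 < cauchy_scale th i) ->
       forall n, is_density (P th) (past_block (Z th) n) (p th n))
    (th0_Omega1 : Omega1 (input_param th0))
    (Pi_positive : forall i j, 0 < Pi (input_param th0) i j)
    (th0_scale : forall i, 0 < cauchy_scale th0 i) :
  let H := fun th => fine (entropy_rate (p th)) in
  (\forall th \near th0,
     normalized_entropy (p th) n @[n --> \oo] --> (H th)%:E) /\
  real_analytic_around H th0.
Proof.
move=> H.
have [|r r0 Hr] := @admissible_ball R m1 l Omega1 Pi Omega1_open Pi_analytic th0.
  by split.
have admN : \forall th \near th0, admissible Omega1 Pi th.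
  apply/nbhs_normP; exists r => // th /= thr.
  have -> : th = th0 + (th - th0) by rewrite addrC subrK.
  by apply: (Hr r); rewrite ?r0 ?lexx// distrC ltW.
have HA th : admissible Omega1 Pi th -> _ := entropy_analytic_at Omega1_open Pi_stochastic
  Pi_analytic YZ_hidden_markov Z_density (th := th).
by split; apply: filterS admN => th /HA[].
Qed.
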